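(* Assume there is a Borel $h:\mathrm{TS}\times\mathcal P(\mathbb S)\times\mathbb R^S\to\mathbb A^S$ with $h^i(t,u,m,v)\in\operatorname{argmax}_{a\in\mathbb A}\{\psi^i(t,Z(u),m,a)+\sum_jQ^{ij}(t,Z(u),m,a)v^j\}$, and set $\hat Q^{ij}(t,u,m,v)=Q^{ij}(t,Z(u),m,h^i(t,u,m,v))$, $\hat\psi^i(t,u,m,v)=\psi^i(t,Z(u),m,h^i(t,u,m,v))$. Assume: (i) $\|\hat\psi(t,u,m_1,v_1)-\hat\psi(t,u,m_2,v_2)\|\le L_{\hat\psi}(\|m_1-m_2\|+\|v_1-v_2\|)$; (ii) $\|\hat Q(t,u,m_1,v_1)-\hat Q(t,u,m_2,v_2)\|\le L_{\hat Q}(\|m_1-m_2\|+\|v_1-v_2\|)$; (iii) $\|\Psi(k,m_1)-\Psi(k,m_2)\|\le L_\Psi\|m_1-m_2\|$; (iv) $|\lambda^k(t,m_1)-\lambda^k(t,m_2)|\le L_\lambda\|m_1-m_2\|$; (v) $J^i(t,m_1)=J^i(t,m_2)$, for all arguments, with constants $L_{\hat\psi},L_{\hat Q},L_\Psi,L_\lambda>0$. Let $m_0\in\mathcal P(\mathbb S)$ and suppose $$L_{\hat Q}T\Big(\sum_{i=0}^n\big(e^{(Q_{\max}+L_{\hat Q})T}\big)^{i+1}J_{\max}^i\Big)(L_\Psi+K_1T)\,e^{K_2T}\Big(\sum_{i=0}^n\big(e^{K_2T}\lambda_{\max}T\big)^i\Big)<1.$$ Then there exists a unique pair of regular functions $\mu:\mathrm{TS}\to\mathcal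 P(\mathbb S)$, $v:\mathrm{TS}\to\mathbb R^S$ satisfying, for all $i\in\mathbb S$, $(t,u)\in\mathrm{TS}$ (Carathéodory sense in $t$, writing $J^i(t)$ for $J^i(t,m)$): (E1) $\partial_tv^i(t,u)=-\hat\psi^i(t,u,\mu(t,u),v(t,u))-\sum_j\hat Q^{ij}(t,u,\mu(t,u),v(t,u))v^j(t,u)-\mathbb I_{\{Z(u)<n\}}\lambda^{Z(u)+1}(t,\mu(t,u))\big(v^{J^i(t)}(t,\overrightarrow{(u,t)})-v^i(t,u)\big)$; (E2) $\partial_t\mu^i(t,u)=\sum_j\mu^j(t,u)\hat Q^{ji}(t,u,\mu(t,u),v(t,u))$; (E3) $v(T,u)=\Psi(Z(u),\mu(T,u))$; (E4) $\mu(0,u_0)=m_0$; (E5) $\mu(t_u,u)=\mu(t_u,\overleftarrow u)(\mathbb I_{\{J^i(t_u)=j\}})_{i,j}$ for $Z(u)\ge1$, $t_u=u^{Z(u)}$.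
   Context: $\mathbb S=\{1,\dots,S\}$, $\mathbb A\subseteq\mathbb R^A$, $n\in\mathbb N$, $T>0$; $\mathcal P(\mathbb S)$ is the simplex (row vectors). Bounded Borel coefficients: $\lambda=(\lambda^1,\dots,\lambda^n):[0,T]\times\mathcal P(\mathbb S)\to(0,\infty)^n$, $Q:[0,T]\times\{0,\dots,n\}\times\mathcal P(\mathbb S)\times\mathbb A\to\mathbb R^{S\times S}$ (intensity matrices), $\psi:[0,T]\times\{0,\dots,n\}\times\mathcal P(\mathbb S)\times\mathbb A\to\mathbb R^S$, $\Psi:\{0,\dots,n\}\times\mathcal P(\mathbb S)\to\mathbb R^S$, $J:[0,T]\times\mathcal P(\mathbb S)\to\mathbb S^{\mathbb S}$. Norms: maximum norm on $\mathbb R^S$ and a compatible matrix norm. Constants: $\Psi_{\max}=\sup\|\Psi\|$, $\psi_{\max}=\sup\|\psi\|$, $Q_{\max}=\sup\|Q\|$, $\lambda_{\max}=\sup_{t,k,m}\lambda^k(t,m)$, $J_{\max}=\sup_{t,m,j}|\{i\in\mathbb S:J^i(t,m)=j\}|$, $v_{\max}=(\Psi_{\max}+\psi_{\max}T)e^{(Q_{\max}+\lambda_{\max})T}\sum_{i=0}^n(e^{(Q_{\max}+\lambda_{\max})T}\lambda_{\max}T)^i$, $K_1=L_{\hat\psi}+L_{\hat Q}v_{\max}+2v_{\max}L_\lambda$, $K_2=L_{\hat\psi}+v_{\max}L_{\hat Q}+Q_{\max}+\lambda_{\max}$. $\mathbb U$: $u\in(\{-1\}\cup[0,T])^n$ with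 $0\le u^1\le\dots\le u^k$, $u^{k+1}=\dots=u^n=-1$ for some $k\in\{0,\dots,n\}$; $Z(u)=k$; $u_0=(-1,\dots,-1)$. $\mathrm{TS}=\{(t,u)\in[0,T]\times\mathbb U:\max_ku^k\le t\}$. Regular: absolutely continuous in $t$ on $\{t:(t,u)\in\mathrm{TS}\}$ for each $u$. $\overrightarrow{(u,t)}$ ($Z(u)<n$, $t\ge\max_ku^k$): $u$ with entry $Z(u)+1$ set to $t$; $\overleftarrow u$ ($Z(u)\ge1$): $u$ with entry $Z(u)$ set to $-1$. *)

(* Defs.v *)
From HB Require Import structures.
From mathcomp Require Import all_boot all_order all_algebra.
From mathcomp Require Import all_classical all_reals all_analysis.
Set Implicit Arguments. Unset Strict Implicit. Unset Printing Implicit Defensive.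
Import Order.TTheory GRing.Theory Num.Theory.
Import numFieldNormedType.Exports.
Local Open Scope classical_set_scope.
Local Open Scope ring_scope.

Section Defs.
Context {R : realType}.

Definition vnorm (p : nat) (x : 'rV[R]_p) : R := \big[Num.max/0]_(i < p) `|x 0 i|.
(* the matrix norm induced by the maximum norm (max row sum) *)
Definition mnorm (p : nat) (M : 'M[R]_p) : R :=
  \big[Num.max/0]_(i < p) \sum_(j < p) `|M i j|.

Definition simplex (p : nat) : set 'rV[R]_p :=
  [set m | (forall i, 0 <= m 0 i) /\ \sum_(i < p) m 0 i = 1].

Definition intensity (p : nat) (M : 'M[R]_p) : Prop :=
  (forall i j, i != j -> 0 <= M i j) /\ (forall i, \sum_(j < p) M i j = 0).

(* the set U of jump-time vectors *)
Definition inU (n : nat) (T : R) (u : 'rV[R]_n) : Prop :=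
  exists2 k, (k <= n)%N &
    [/\ forall i : 'I_n, (i < k)%N -> 0 <= u 0 i <= T,
        forall i j : 'I_n, (i <= j)%N -> (j < k)%N -> u 0 i <= u 0 j
      & forall i : 'I_n, (k <= i)%N -> u 0 i = -1].

Definition Z (n : nat) (u : 'rV[R]_n) : nat := #|[pred i : 'I_n | u 0 i != -1]|.

Definition u0 (n : nat) : 'rV[R]_n := const_mx (-1).

Definition TS (n : nat) (T : R) (t : R) (u : 'rV[R]_n) : Prop :=
  0 <= t <= T /\ inU T u /\ (forall i : 'I_n, u 0 i <= t).

(* ->(u,t): entry number Z(u)+1 (0-based index Z(u)) set to t *)
Definition uright (n : nat) (u : 'rV[R]_n) (t : R) : 'rV[R]_n :=
  \row_(i < n) (if (i == Z u :> nat) then t else u 0 i).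
(* <-u : entry number Z(u) (0-based index Z(u)-1) set to -1 *)
Definition uleft (n : nat) (u : 'rV[R]_n) : 'rV[R]_n :=
  \row_(i < n) (if (i.+1 == Z u)%N then -1 else u 0 i).

Definition Jmx (p : nat) (Jf : 'I_p -> 'I_p) : 'M[R]_p :=
  \matrix_(i, j) (Jf i == j)%:R.

Definition abs_cont_on (p : nat) (D : set R) (f : R -> 'rV[R]_p) : Prop :=
  forall e : R, 0 < e -> exists2 d : R, 0 < d &
    forall (N : nat) (a b : nat -> R),
      (forall k, (k < N)%N -> [/\ D (a k), D (b k) & a k <= b k]) ->
      (forall k l, (k < N)%N -> (l < N)%N -> k != l -> b k <= a l \/ b l <= a k) ->
      \sum_(k < N) (b k - a k) < d ->
      \sum_(k < N) vnorm (f (b k) - f (a k)) < e.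

(* Borel sets of R^(p x q) (generated by the open sets) and Borel maps
   defined on a subset D (measurability w.r.t. the trace sigma-algebra) *)
Definition borelM (p q : nat) : set (set 'M[R]_(p, q)) :=
  <<s [set U | open U] >>.
Definition borel_on (p q r : nat) (D : set 'rV[R]_p) (f : 'rV[R]_p -> 'M[R]_(q, r))
  : Prop :=
  forall B, borelM B -> exists2 C, borelM C & D `&` f @^-1` B = D `&` C.

Definition fst3 (a b c : nat) (x : 'rV[R]_(a + b + c)) : 'rV[R]_a := lsubmx (lsubmx x).
Definition snd3 (a b c : nat) (x : 'rV[R]_(a + b + c)) : 'rV[R]_b := rsubmx (lsubmx x).
Definition thd3 (a b c : nat) (x : 'rV[R]_(a + b + c)) : 'rV[R]_c := rsubmx x.

Definition Qhat (S dA n : nat) (Q : R -> nat -> 'rV[R]_S -> 'rV[R]_dA -> 'M[R]_S)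
  (h : R -> 'rV[R]_n -> 'rV[R]_S -> 'rV[R]_S -> 'I_S -> 'rV[R]_dA)
  (t : R) (u : 'rV[R]_n) (m v : 'rV[R]_S) : 'M[R]_S :=
  \matrix_(i, j) Q t (Z u) m (h t u m v i) i j.
Definition psihat (S dA n : nat) (psi : R -> nat -> 'rV[R]_S -> 'rV[R]_dA -> 'rV[R]_S)
  (h : R -> 'rV[R]_n -> 'rV[R]_S -> 'rV[R]_S -> 'I_S -> 'rV[R]_dA)
  (t : R) (u : 'rV[R]_n) (m v : 'rV[R]_S) : 'rV[R]_S :=
  \row_i psi t (Z u) m (h t u m v i) 0 i.

Definition Qmax (S dA n : nat) (T : R) (AA : set 'rV[R]_dA)
  (Q : R -> nat -> 'rV[R]_S -> 'rV[R]_dA -> 'M[R]_S) : R :=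
  sup [set x | exists t k m a, [/\ 0 <= t <= T, (k <= n)%N, simplex m & AA a]
                              /\ x = mnorm (Q t k m a)].
Definition psimax (S dA n : nat) (T : R) (AA : set 'rV[R]_dA)
  (psi : R -> nat -> 'rV[R]_S -> 'rV[R]_dA -> 'rV[R]_S) : R :=
  sup [set x | exists t k m a, [/\ 0 <= t <= T, (k <= n)%N, simplex m & AA a]
                              /\ x = vnorm (psi t k m a)].
Definition Psimax (S n : nat) (Psi : nat -> 'rV[R]_S -> 'rV[R]_S) : R :=
  sup [set x | exists k m, [/\ (k <= n)%N & simplex m] /\ x = vnorm (Psi k m)].
Definition lammax (S n : nat) (T : R) (lam : R -> 'rV[R]_S -> nat -> R) : R :=
  sup [set x | exists t k m, [/\ 0 <= t <= T, (1 <= k <= n)%N & simplex m]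
                            /\ x = lam t m k].
Definition Jmax (S : nat) (T : R) (J : R -> 'rV[R]_S -> 'I_S -> 'I_S) : R :=
  sup [set x | exists t m (j : 'I_S), [/\ 0 <= t <= T & simplex m]
                            /\ x = (#|[set i | J t m i == j]|)%:R].
Definition vmax (S dA n : nat) (T : R) (AA : set 'rV[R]_dA)
  (lam : R -> 'rV[R]_S -> nat -> R)
  (Q : R -> nat -> 'rV[R]_S -> 'rV[R]_dA -> 'M[R]_S)
  (psi : R -> nat -> 'rV[R]_S -> 'rV[R]_dA -> 'rV[R]_S)
  (Psi : nat -> 'rV[R]_S -> 'rV[R]_S) : R :=
  (Psimax n Psi + psimax n T AA psi * T)
  * expR ((Qmax n T AA Q + lammax n T lam) * T)
  * \sum_(i < n.+1) (expR ((Qmax n T AA Q + lammax n T lam) * T) * lammax n T lam * T) ^+ i.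

End Defs.

(* Main.v *)
Require Import Defs.
From mathcomp Require Import all_boot all_order all_algebra.
From mathcomp Require Import all_classical all_reals all_analysis.
From mathcomp Require Import measurable_realfun ring lra.
Import Order.TTheory GRing.Theory Num.Theory.
Import numFieldNormedType.Exports.
Local Open Scope classical_set_scope.
Local Open Scope ring_scope.
Set Implicit Arguments. Unset Strict Implicit. Unset Printing Implicit Defensive.

(** The system is a fixed point problem for one Picard map acting on pairs [(mu, v)]: [v] is
    integrated backwards from time [T], and [nu = expR (q t) mu], with [q = Qmax], is integrated
    forwards from the last jump time. As [Qhat + q I] has nonnegative entries and row sums [q],
    the iterates of [mu] stay in the simplex. Measuring [mu] in the l1 norm (for which the maximal
    row sum norm is compatible with [mu |-> mu *m Q], and pushing forward by [J] is nonexpansive)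
    and [v] in the maximum norm, with weights depending on time and on the number of jumps that
    are supersolutions of the two Gronwall inequalities, the smallness condition makes the Picard
    map a contraction. Iterates are jointly Borel in [(t, u)] by Fubini-Tonelli, which makes
    [s |-> v (s, uright u s)] measurable. A solution in the Caratheodory sense need not be
    measurable in [u]; but all estimates only use that an absolutely continuous function whose
    derivative is a.e. nonpositive is nonincreasing, so that they apply to such a solution too,
    once a downward induction on the number of jumps has bounded [v]. *)

(** * Absolutely continuous functions *)

(** The equations are coupled in opposite directions: [mu] at [u] starts from [mu] at [uleft u],
    whereas [v] at [u] is driven by [v] at [uright u t] and ends at a value depending on [mu]. No
    induction on the number of jumps separates them, hence a single contraction over all of [TS].
    Its size is the gain of one round trip. A unit error in [v], of weight at most [bbar], produces
    in [expR (q t) mu] a source of at most [LQH * T * expR (q * T) * bbar] on each of the at most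
    [n.+1] intervals between jumps; this error grows with [mu] and comes back to [v] through the
    terminal condition and the source with factor [LPsi + K1 * T], then through the backward weight.
    The product is [kap], and since [Jmax] is at least 1 the smallness condition gives [kap < 1].
    The slack serves to make the weights strict supersolutions, so that each iteration shrinks the
    weighted error by a fixed fraction [dlt]. *)

Lemma is_derive_near_le (R : realType) (f : R -> R) (x l e : R) :
  is_derive x 1 f l -> l <= 0 -> 0 < e ->
  exists2 d : R, 0 < d & forall y, `|y - x| < d ->
    (x <= y -> f y - f x <= e * (y - x)) /\ (y <= x -> f x - f y <= e * (x - y)).
Proof.
move=> [df dl] l0 e0.
have /cvgrPdist_lt/(_ e e0) : h^-1 *: ((f \o shift x) (h *: (1 : R)) - f x) @[h --> 0^'] --> l.
  by move: df; rewrite -dl.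
move=> [d /= d0 dP]; exists d => // y yd.
have [->|xy] := eqVneq y x; first by split => _; rewrite !subrr mulr0.
have := dP (y - x); rewrite /= sub0r normrN => /(_ yd).
rewrite subr_eq0 => /(_ xy); rewrite /GRing.scale /= mulr1 subrK.
rewrite ltr_norml => /andP[+ _]; set q := _ * _ => h1.
have qe : q < e by lra.
have yx0 : y - x != 0 by rewrite subr_eq0.
have fE : f y - f x = q * (y - x) by rewrite /q mulrC mulrA divff // mul1r.
split => h2.
  by rewrite fE ler_wpM2r ?subr_ge0 // ltW.
by rewrite -(opprB (f y)) fE -mulrN opprB ler_wpM2r ?subr_ge0 // ltW.
Qed.

(** Families are listed from left to right, so that the continuous induction below can append an
    interval at the right end. [abs_cont_on] allows every non-overlapping family and therefore
    implies this coordinatewise. *)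
Definition ac_on (R : realType) (a b : R) (f : R -> R) : Prop :=
  forall e : R, 0 < e -> exists2 d : R, 0 < d &
    forall (N : nat) (x y : nat -> R),
      (forall k, (k < N)%N -> [/\ a <= x k, x k <= y k & y k <= b]) ->
      (forall k l, (k < l)%N -> (l < N)%N -> y k <= x l) ->
      \sum_(k < N) (y k - x k) < d ->
      \sum_(k < N) `|f (y k) - f (x k)| < e.

(** Continuous induction along [[a, b]], in place of a Vitali covering. Off a null set the
    derivative limits the growth to slope [e]; the null set lies in an open set [G] so small that
    absolute continuity limits the growth of [f] over intervals packed into [G]. *)
Lemma ac_on_nonincreasing (R : realType) (a b : R) (f : R -> R) : a <= b ->
  ac_on a b f ->
  {ae (@lebesgue_measure R), forall t, a < t < b ->
    exists2 l, is_derive t 1 f l & l <= 0} ->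
  f b <= f a.
Proof.
move=> ab acf [E0 [mE0 E00 E0P]].
suff H : forall e : R, 0 < e -> f b - f a <= e * (b - a) + e.
  rewrite -subr_le0; apply/ler_addgt0Pr => e e0; rewrite add0r.
  have p : 0 < b - a + 1 by rewrite ltr_wpDl // subr_ge0.
  have := H (e / (b - a + 1)); rewrite divr_gt0 // => /(_ isT) /le_trans; apply.
  by rewrite -[X in _ + X]mulr1 -mulrDr -mulrA mulVf ?mulr1 // gt_eqF.
move=> e e0; have [d d0 dP] := acf e e0.
pose E := E0 `|` [set a] `|` [set b].
have mEE : measurable E by do 2 apply: measurableU => //.
have EE0 : lebesgue_measure E = 0%E.
  rewrite /E measureU0 //; last exact: lebesgue_measure_set1.
    by rewrite measureU0 //; exact: lebesgue_measure_set1.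
  exact: measurableU.
have [G [oO EG Od]] := lebesgue_regularity_outer mEE
  (eq_ind_r (fun x => (x < +oo)%E) (ltry 0) EE0) d0.
have mO : measurable G by exact: open_measurable.
have {}Od : (lebesgue_measure G < d%:E)%E.
  have := measureDI (@lebesgue_measure R) mO mEE.
  rewrite (@subset_measure0 _ _ _ (@lebesgue_measure R) (G `&` E) E) ?adde0 //.
    by move=> ->.
  exact: measurableI.
(* [P x]: up to an error [e (x - a)], the increase of [f] on [a, x] is carried by
   finitely many non-overlapping intervals contained in the small open set [G]. *)
pose P (z : R) := exists (N : nat) (x y : nat -> R),
  [/\ forall k, (k < N)%N -> [/\ a <= x k, x k <= y k & y k <= z],
      forall k l, (k < l)%N -> (l < N)%N -> y k <= x l,
      ((\sum_(k < N) (y k - x k))%:E <= lebesgue_measure (G `&` `[a, z[))%E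
    & f z - f a <= e * (z - a) + \sum_(k < N) `|f (y k) - f (x k)|].
have Pb : P b -> f b - f a <= e * (b - a) + e.
  move=> [N [x [y [h1 h2 h3 h4]]]]; apply: (le_trans h4); rewrite lerD2l ltW //.
  apply: dP => //; rewrite -lte_fin; apply: le_lt_trans h3 _.
  apply: le_lt_trans Od; apply: le_measure; rewrite ?inE //.
  exact: measurableI.
apply: Pb.
have Pa : P a.
  exists 0%N, (fun=> 0), (fun=> 0); split => //.
    by rewrite big_ord0 measure_ge0.
  by rewrite big_ord0 !subrr mulr0 addr0.
pose A := [set z | a <= z <= b /\ P z].
have Aa : A a by split => //; rewrite lexx.
have hA : has_sup A by split; [exists a | exists b => z [/andP[]]].
pose c := sup A.
have ac : a <= c by apply: sup_upper_bound.
have cb : c <= b by apply: ge_sup; [exists a | move=> z [/andP[]]].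
(* Crossing [c]: if [c] is in [E], the step from [x] to [y] is charged to [G] as a new interval;
   otherwise the derivative at [c] pays for it with slope [e]. *)
have [r r0 rP] : exists2 r : R, 0 < r & forall x y, A x -> c - r < x -> x <= c ->
    c <= y -> y < c + r -> y <= b -> P y.
  have [Ec|nEc] := pselect (E c).
    have /nbhs_ballP[r /= r0 rO] : nbhs c G by apply: open_nbhs_nbhs; split => //; exact: EG.
    exists r => // x y [/andP[ax xb] [N [p [q [h1 h2 h3 h4]]]]] cx xc cy yc yb.
    exists N.+1, (fun k => if k == N then x else p k), (fun k => if k == N then y else q k).
    have xy : x <= y by exact: le_trans cy.
    split.
    - move=> k; rewrite ltnS leq_eqVlt; case: eqVneq => [-> _|kN /= kN'].
        by split.
      by have [? ? /le_trans qx] := h1 k kN'; split => //; exact: qx.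
    - move=> k l kl; rewrite ltnS leq_eqVlt; case: (eqVneq l N) => [lN _|lN /= lN'].
        rewrite ltn_eqF -?lN //; have [_ _] := h1 k (leq_trans kl (eq_leq lN)).
        by [].
      rewrite ltn_eqF ?(ltn_trans kl) //; exact: h2.
    - rewrite big_ord_recr /= eqxx EFinD.
      rewrite (_ : G `&` `[a, y[ = (G `&` `[a, x[) `|` `[x, y[); last first.
        apply/seteqP; split => z /=; rewrite !in_itv /=.
          move=> [Oz /andP[az zy]]; have [zx|xz] := ltP z x.
            by left; rewrite az.
          by right; rewrite zy.
        move=> [[Oz /andP[az zx]]|/andP[xz zy]].
          by rewrite az (lt_le_trans zx).
        split; last by rewrite zy (le_trans ax).
        by apply: rO; rewrite /ball /= ltr_norml; apply/andP; split; lra.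
      rewrite measureU //=; last 2 first.
      - by apply: measurableI.
      - rewrite -subset0 => z /= [[_]]; rewrite !in_itv /= => /andP[_ zx] /andP[xz _].
        by move: zx; rewrite ltNge xz.
      apply: leeD.
        under eq_bigr => i _ do rewrite ltn_eqF //.
        exact: h3.
      rewrite lebesgue_measure_itv /= lte_fin; case: ltP => // yx.
      by rewrite lee_fin subr_le0.
    - rewrite big_ord_recr /= eqxx; under eq_bigr => i _ do rewrite ltn_eqF //.
      have := ler_norm (f y - f x).
      have : e * (x - a) <= e * (y - a) by rewrite ler_wpM2l ?lerD2r // ltW.
      move: h4; lra.
  have acb : a < c < b.
    rewrite !lt_neqAle ac cb !andbT; apply/andP; split; apply/eqP => h; apply: nEc.
      by left; right.
    by right.
  have [l fl l0] : exists2 l, is_derive c 1 f l & l <= 0.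
    apply: contrapT => h; apply: nEc; left; left; apply: E0P => /= h'; apply: h.
    exact: h'.
  have [r r0 rP] := is_derive_near_le fl l0 e0.
  exists r => // x y [/andP[ax xb] [N [p [q [h1 h2 h3 h4]]]]] cx xc cy yc yb.
  exists N, p, q; split => //.
  - by move=> k kN; have [? ? /le_trans qx] := h1 k kN; split => //; apply: qx; lra.
  - apply: le_trans h3 _; apply: le_measure; rewrite ?inE.
    + by apply: measurableI.
    + by apply: measurableI.
    + apply: setIS => z /=; rewrite !in_itv /= => /andP[-> zx].
      by apply: lt_le_trans zx _; lra.
  - have [_ hx] := rP x ltac:(rewrite ltr_norml; apply/andP; split; lra).
    have [hy _] := rP y ltac:(rewrite ltr_norml; apply/andP; split; lra).
    move: (hx xc) (hy cy) h4; rewrite !mulrBr; lra.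
have [x Ax cx] : exists2 x, A x & c - r < x.
  by apply: sup_adherent.
have xc : x <= c by apply: sup_upper_bound.
have [cb'|] := ltP c b; last first.
  move=> bc; apply: (rP x) => //; lra.
(* A point of [A] beyond [c], which contradicts the choice of [c] as supremum. *)
pose y := Num.min b (c + r / 2).
have yb : y <= b by rewrite /y ge_min lexx.
have cy : c < y by rewrite /y lt_min cb' ltrDl divr_gt0.
have Py : P y.
  apply: (rP x) => //; first exact: ltW.
  rewrite /y gt_min; apply/orP; right; lra.
have : y <= c by apply: sup_upper_bound => //; split => //; rewrite yb andbT (le_trans ac) // ltW.
by rewrite leNgt cy.
Qed.

Definition lip_on (R : realType) (a b : R) (f : R -> R) : Prop :=
  exists2 L : R, 0 <= L & forall x y, a <= x -> x <= y -> y <= b -> `|f y - f x| <= L * (y - x).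

Lemma lip_on_ac_on (R : realType) (a b : R) (f : R -> R) : lip_on a b f -> ac_on a b f.
Proof.
move=> [L L0 fL] e e0; exists (e / (L + 1)); first by rewrite divr_gt0 // ltr_wpDl.
move=> N x y xy _ sd.
apply: (@le_lt_trans _ _ (L * \sum_(k < N) (y k - x k))).
  rewrite mulr_sumr; apply: ler_sum => k _; have [? ? ?] := xy k (ltn_ord k).
  exact: fL.
apply: (@le_lt_trans _ _ ((L + 1) * \sum_(k < N) (y k - x k))).
  apply: ler_wpM2r; last by rewrite lerDl.
  by apply: sumr_ge0 => k _; rewrite subr_ge0; have [] := xy k (ltn_ord k).
by rewrite mulrC -ltr_pdivlMr // ltr_wpDl.
Qed.

Lemma ac_onD (R : realType) (a b : R) (f g : R -> R) :
  ac_on a b f -> ac_on a b g -> ac_on a b (fun t => f t + g t).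
Proof.
move=> fac gac e e0; have e20 : 0 < e / 2 by rewrite divr_gt0.
have [d1 d10 h1] := fac _ e20; have [d2 d20 h2] := gac _ e20.
exists (Num.min d1 d2); first by rewrite lt_min d10.
move=> N x y xy dis; rewrite lt_min => /andP[s1 s2].
apply: (@le_lt_trans _ _ (\sum_(k < N) `|f (y k) - f (x k)| + \sum_(k < N) `|g (y k) - g (x k)|)).
  rewrite -big_split /=; apply: ler_sum => k _; rewrite opprD addrACA; exact: ler_normD.
by rewrite [ltRHS]splitr ltrD // ?h1 ?h2.
Qed.

Lemma ac_onN (R : realType) (a b : R) (f : R -> R) : ac_on a b f -> ac_on a b (fun t => - f t).
Proof.
move=> fac e e0; have [d d0 h] := fac _ e0; exists d => // N x y xy dis s.
under eq_bigr => k _ do rewrite -opprD normrN.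
exact: h.
Qed.

Lemma ac_onW (R : realType) (a b a' b' : R) (f : R -> R) : a <= a' -> b' <= b ->
  ac_on a b f -> ac_on a' b' f.
Proof.
move=> aa bb fac e e0; have [d d0 h] := fac e e0; exists d => // N x y xy dis s.
apply: h => // k kN; have [? ? ?] := xy k kN.
by split => //; [exact: le_trans aa _ | exact: le_trans bb].
Qed.

(** Cut [[a, x]] into [N.+1] equal steps shorter than the [d] that belongs to [e = 1]; each changes
    [f] by at most 1. For an arbitrary solution this is the first bound on [v] at hand. *)
Lemma ac_on_bounded (R : realType) (a b : R) (f : R -> R) : ac_on a b f ->
  exists2 B : R, 0 <= B & forall x, a <= x -> x <= b -> `|f x| <= B.
Proof.
move=> fac; have [d d0 dP] := fac 1 ltr01.
have [N Nd] : exists N : nat, (b - a) / d < N.+1%:R.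
  have NP := archi_boundP (normr_ge0 ((b - a) / d)).
  by exists (Num.bound `|(b - a) / d|); rewrite (le_lt_trans (ler_norm _)) //
    (lt_le_trans NP) // ler_nat.
exists (`|f a| + N.+1%:R) => [|x ax xb]; first by rewrite addr_ge0.
pose h := (x - a) / N.+1%:R.
have h0 : 0 <= h by rewrite divr_ge0 // subr_ge0.
have hd : h < d.
  rewrite /h ltr_pdivrMr // (le_lt_trans (lerB xb (lexx a))) // mulrC -ltr_pdivrMr //.
have st k : (k < N.+1)%N -> `|f (a + k.+1%:R * h) - f (a + k%:R * h)| <= 1.
  move=> kN; have := dP 1%N (fun=> a + k%:R * h) (fun=> a + k.+1%:R * h).
  rewrite !big_ord_recl !big_ord0 !addr0 => /(_ _ _ _)/ltW; apply.
  - move=> _ _; split; [by rewrite lerDl mulr_ge0 | by rewrite lerD2l ler_wpM2r // ler_nat |].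
    rewrite (le_trans _ xb) // -lerBrDl /h mulrA ler_pdivrMr // mulrC ler_wpM2l ?subr_ge0 //.
    by rewrite ler_nat.
  - by move=> k0 l kl; rewrite ltnS leqn0 => /eqP l0; rewrite l0 in kl.
  - by rewrite opprD addrACA subrr add0r -mulrBl -natr1 addrAC subrr add0r mul1r.
have tel k : (k <= N.+1)%N -> `|f (a + k%:R * h)| <= `|f a| + k%:R.
  elim: k => [_|k IH kN]; first by rewrite mul0r !addr0.
  rewrite -[f (a + k.+1%:R * h)](subrK (f (a + k%:R * h))) addrC (le_trans (ler_normD _ _)) //.
  by rewrite -natr1 addrA lerD ?IH ?(ltnW kN) // natr1 st.
have := tel N.+1 (leqnn _); rewrite /h mulrC divfK ?pnatr_eq0 //.
by rewrite addrC subrK.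
Qed.

Lemma lip_onW (R : realType) (a b a' b' : R) (f : R -> R) : a <= a' -> b' <= b ->
  lip_on a b f -> lip_on a' b' f.
Proof.
move=> aa bb [L L0 h]; exists L => // x y ax xy yb.
by apply: h => //; [exact: le_trans aa _ | exact: le_trans bb].
Qed.

Lemma lip_onN (R : realType) (a b : R) (f : R -> R) : lip_on a b f -> lip_on a b (fun t => - f t).
Proof. by move=> [L L0 h]; exists L => // x y *; rewrite -opprD normrN h. Qed.

Lemma lip_onD (R : realType) (a b : R) (f g : R -> R) :
  lip_on a b f -> lip_on a b g -> lip_on a b (fun t => f t + g t).
Proof.
move=> [L L0 h] [M M0 k]; exists (L + M) => [|x y ax xy yb]; first exact: addr_ge0.
rewrite opprD addrACA mulrDl (le_trans (ler_normD _ _)) // lerD ?h ?k //.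
Qed.

Lemma lip_on_cst (R : realType) (a b c : R) : lip_on a b (fun=> c).
Proof. by exists 0 => // x y *; rewrite subrr normr0 mul0r. Qed.

Lemma lip_on_bounded (R : realType) (a b : R) (f : R -> R) : lip_on a b f ->
  exists2 B : R, 0 <= B & forall x, a <= x -> x <= b -> `|f x| <= B.
Proof.
move=> [L L0 h]; exists (`|f a| + L * `|b - a|) => [|x ax xb].
  by rewrite addr_ge0 ?mulr_ge0.
rewrite -[f x](subrK (f a)) addrC (le_trans (ler_normD _ _)) // lerD2l.
apply: le_trans (h _ _ (lexx a) ax xb) _; rewrite ler_wpM2l // ler_normr.
by rewrite lerD2r xb.
Qed.

Lemma lip_onM (R : realType) (a b : R) (f g : R -> R) :
  lip_on a b f -> lip_on a b g -> lip_on a b (fun t => f t * g t).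
Proof.
move=> fl gl; have [F F0 fF] := lip_on_bounded fl; have [G G0 gG] := lip_on_bounded gl.
move: fl gl => [L L0 h] [M M0 k].
exists (F * M + L * G) => [|x y ax xy yb]; first by rewrite addr_ge0 ?mulr_ge0.
have -> : f y * g y - f x * g x = f y * (g y - g x) + (f y - f x) * g x by ring.
have -> : (F * M + L * G) * (y - x) = F * (M * (y - x)) + (L * (y - x)) * G by ring.
apply: le_trans (ler_normD _ _) _; rewrite !normrM lerD // ler_pM //.
- by apply: fF => //; exact: le_trans xy.
- exact: k.
- exact: h.
- by apply: gG => //; exact: le_trans yb.
Qed.

Lemma lip_on_is_derive (R : realType) (a b M : R) (f f' : R -> R) :
  (forall x : R, is_derive x 1 f (f' x)) -> (forall x, a <= x -> x <= b -> `|f' x| <= M) ->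
  lip_on a b f.
Proof.
move=> df fM; exists `|M| => // x y ax xy yb.
have [c /[!in_itv] /= /andP[xc cy] ->] : exists2 c, c \in `[x, y] & f y - f x = f' c * (y - x).
  apply: MVT_segment => //.
  by apply: derivable_within_continuous => z _; have [] := df z.
rewrite normrM [X in _ * X]ger0_norm ?subr_ge0 // ler_wpM2r ?subr_ge0 //.
apply: le_trans (fM _ _ _) (ler_norm _); lra.
Qed.

(** * Lipschitz primitives and comparison of increments *)

Local Instance lebesgue_ae_filter (R : realType) :
  Filter (nbhs (almost_everywhere (@lebesgue_measure R))).
Proof. exact: ae_filter_ringOfSetsType. Qed.

(** Lipschitz continuity is the right regularity because all right-hand sides are bounded on
    admissible pairs. No integral occurs and nothing is asked of the measurability of [f'], so that
    arbitrary solutions are covered. *)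
Definition prim_on (R : realType) (a b : R) (f f' : R -> R) : Prop :=
  lip_on a b f /\
  {ae (@lebesgue_measure R), forall t, a < t < b -> is_derive t 1 f (f' t)}.

Lemma prim_on_eq (R : realType) (a b : R) (f f' g' : R -> R) :
  (forall t, a < t < b -> f' t = g' t) -> prim_on a b f f' -> prim_on a b f g'.
Proof.
move=> fg [lf df]; split => //; apply: filterS df => t h abt.
by rewrite -fg //; exact: h.
Qed.

Lemma prim_onW (R : realType) (a b a' b' : R) (f f' : R -> R) : a <= a' -> b' <= b ->
  prim_on a b f f' -> prim_on a' b' f f'.
Proof.
move=> aa bb [lf df]; split; first exact: lip_onW lf.
apply: filterS df => t h /andP[at' tb']; apply: h.
by rewrite (le_lt_trans aa) ?(lt_le_trans tb').
Qed.

Lemma prim_onN (R : realType) (a b : R) (f f' : R -> R) :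
  prim_on a b f f' -> prim_on a b (fun t => - f t) (fun t => - f' t).
Proof.
move=> [lf df]; split; first exact: lip_onN.
by apply: filterS df => t h abt; have := h abt => ?; exact: is_deriveN.
Qed.

Lemma prim_onD (R : realType) (a b : R) (f f' g g' : R -> R) :
  prim_on a b f f' -> prim_on a b g g' -> prim_on a b (fun t => f t + g t) (fun t => f' t + g' t).
Proof.
move=> [lf df] [lg dg]; split; first exact: lip_onD.
by apply: filterS2 df dg => t h k abt; have := h abt; have := k abt => ? ?; exact: is_deriveD.
Qed.

Lemma prim_on_cst (R : realType) (a b c : R) : prim_on a b (fun=> c) (fun=> 0).
Proof.
split; first exact: lip_on_cst.
by apply: aeW => t _; exact: is_derive_cst.
Qed.

Lemma prim_onM (R : realType) (a b : R) (f f' g g' : R -> R) :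
  prim_on a b f f' -> prim_on a b g g' ->
  prim_on a b (fun t => f t * g t) (fun t => f t * g' t + g t * f' t).
Proof.
move=> [lf df] [lg dg]; split; first exact: lip_onM.
by apply: filterS2 df dg => t h k abt; have := h abt; have := k abt => ? ?; exact: is_deriveM.
Qed.

Lemma prim_onZ (R : realType) (a b c : R) (f f' : R -> R) :
  prim_on a b f f' -> prim_on a b (fun t => c * f t) (fun t => c * f' t).
Proof.
move=> fp; have := prim_onM (prim_on_cst a b c) fp.
by apply: prim_on_eq => t _; rewrite mulr0 addr0.
Qed.

Lemma prim_on_sum (R : realType) (a b : R) (n : nat) (f f' : 'I_n -> R -> R) :
  (forall i, prim_on a b (f i) (f' i)) ->
  prim_on a b (fun t => \sum_(i < n) f i t) (fun t => \sum_(i < n) f' i t).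
Proof.
elim: n f f' => [|n IH] f f' fp.
  have -> : (fun t : R => \sum_(i < 0) f i t) = (fun=> 0) by apply/funext => t; rewrite big_ord0.
  by apply: prim_on_eq (prim_on_cst _ _ _) => t _; rewrite big_ord0.
have -> : (fun t : R => \sum_(i < n.+1) f i t) =
    (fun t => \sum_(i < n) f (widen_ord (leqnSn n) i) t + f ord_max t).
  by apply/funext => t; rewrite big_ord_recr.
apply: prim_on_eq (prim_onD (IH (fun i => f (widen_ord (leqnSn n) i))
  (fun i => f' (widen_ord (leqnSn n) i)) (fun i => fp _)) (fp ord_max)) => t _.
by rewrite big_ord_recr.
Qed.

Lemma prim_on_id (R : realType) (a b : R) : prim_on a b id (fun=> 1).
Proof.
split; first by exists 1 => // x y ax xy yb; rewrite mul1r ger0_norm // subr_ge0.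
by apply: aeW => t _; exact: is_derive_id.
Qed.

Lemma is_derive_expR_lin (R : realType) (c T x : R) :
  is_derive x 1 (fun t => expR (c * (T - t))) (- c * expR (c * (T - x))).
Proof.
have h : is_derive x 1 (fun t => c * (T - t)) (- c).
  have := is_deriveZ c (is_deriveB (is_derive_cst T x 1) (is_derive_id x 1)).
  by move/is_derive_eq; apply; rewrite /GRing.scale /= sub0r mulrN1.
by have := is_derive1_comp (is_derive_expR _) h; rewrite mulrC.
Qed.

Lemma prim_on_expR (R : realType) (a b c T : R) :
  prim_on a b (fun t => expR (c * (T - t))) (fun t => - c * expR (c * (T - t))).
Proof.
split; last by apply: aeW => t _; exact: is_derive_expR_lin.
apply: (lip_on_is_derive (M := `|c| * expR (`|c| * (`|T| + `|a| + `|b|)))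
  (is_derive_expR_lin c T)).
move=> x ax xb; rewrite normrM normrN ler_wpM2l // ger0_norm ?expR_ge0 // ler_expR.
apply: le_trans (ler_norm _) _; rewrite normrM ler_wpM2l //.
apply: le_trans (ler_normB _ _) _; rewrite -addrA lerD2l ler_norml.
move: (ler_norm (- a)) (ler_norm b) (normr_ge0 a) (normr_ge0 b).
by rewrite normrN => h1 h2 h3 h4; apply/andP; split; lra.
Qed.

Lemma prim_on_expRM (R : realType) (a b c : R) :
  prim_on a b (fun t => expR (c * t)) (fun t => c * expR (c * t)).
Proof.
have E (t : R) : - c * (0 - t) = c * t by rewrite sub0r mulrNN.
have := prim_on_expR a b (- c) 0; rewrite opprK.
by under eq_fun do rewrite E; apply: prim_on_eq => t _; rewrite E.
Qed.

(** [f - g] is absolutely continuous with an a.e. nonpositive derivative. *)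
Lemma ac_on_le (R : realType) (a b : R) (f f' g g' : R -> R) : a <= b ->
  ac_on a b f ->
  {ae (@lebesgue_measure R), forall t, a < t < b -> is_derive t 1 f (f' t)} ->
  prim_on a b g g' -> (forall t, a < t < b -> f' t <= g' t) ->
  f b - f a <= g b - g a.
Proof.
move=> ab fac df [lg dg] fg.
suff : f b - g b <= f a - g a by lra.
apply: (@ac_on_nonincreasing _ a b (fun t => f t - g t)) => //.
  by apply: ac_onD => //; apply: ac_onN; exact: lip_on_ac_on.
apply: filterS2 df dg => t h k abt; exists (f' t - g' t); last by rewrite subr_le0 fg.
by have := h abt; have := k abt => ? ?; exact: is_deriveB.
Qed.

Lemma ac_on_norm_le (R : realType) (a b : R) (f f' g g' : R -> R) : a <= b ->
  ac_on a b f ->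
  {ae (@lebesgue_measure R), forall t, a < t < b -> is_derive t 1 f (f' t)} ->
  prim_on a b g g' -> (forall t, a < t < b -> `|f' t| <= g' t) ->
  `|f b - f a| <= g b - g a.
Proof.
move=> ab fac df gp fg; rewrite ler_norml; apply/andP; split; last first.
  by apply: (ac_on_le ab fac df gp) => t /fg; apply: le_trans (ler_norm _).
rewrite lerNl opprB.
suff : - f b - - f a <= g b - g a by lra.
apply: (@ac_on_le _ _ _ (fun t => - f t) (fun t => - f' t) g g') => //; first exact: ac_onN.
  by apply: filterS df => t h abt; have := h abt => ?; exact: is_deriveN.
by move=> t /fg; apply: le_trans; rewrite -normrN ler_norm.
Qed.

(** Turns a solution, known only to be absolutely continuous, into a primitive in the sense of
    [prim_on] once its right-hand side is bounded. *)
Lemma ac_on_lip_on (R : realType) (a b M : R) (f f' : R -> R) :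
  ac_on a b f ->
  {ae (@lebesgue_measure R), forall t, a < t < b -> is_derive t 1 f (f' t)} ->
  (forall t, a < t < b -> `|f' t| <= M) -> lip_on a b f.
Proof.
move=> fac df fM; exists `|M| => // x y ax xy yb.
have dxy t : x < t < y -> a < t < b.
  by move=> /andP[xt ty]; rewrite (le_lt_trans ax) ?(lt_le_trans ty).
rewrite mulrBr; apply: (ac_on_norm_le (f' := f') (g := fun t => `|M| * t) (g' := fun=> `|M|)) => //.
- exact: ac_onW fac.
- by apply: filterS df => t h /dxy; exact: h.
- by apply: prim_on_eq (prim_onZ `|M| (prim_on_id x y)) => t _; rewrite mulr1.
- by move=> t /dxy/fM/le_trans; apply; exact: ler_norm.
Qed.

Lemma prim_on_le (R : realType) (a b : R) (f f' g g' : R -> R) : a <= b ->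
  prim_on a b f f' -> prim_on a b g g' -> (forall t, a < t < b -> f' t <= g' t) ->
  f b - f a <= g b - g a.
Proof. by move=> ab [lf df]; apply: ac_on_le => //; exact: lip_on_ac_on. Qed.

(** * Indefinite integrals of bounded measurable functions *)

Lemma bounded_integrable (R : realType) (g : R -> R) (M : R) (A : set R) :
  measurable A -> (lebesgue_measure A < +oo)%E ->
  measurable_fun setT g -> (forall x, `|g x| <= M) ->
  (@lebesgue_measure R).-integrable A (EFin \o g).
Proof.
move=> mA Afin mg gM; apply: measurable_bounded_integrable => //.
  exact: measurable_funS mg.
exists M; split; first exact: num_real.
by move=> N MN x _ /=; apply: le_trans (gM x) (ltW MN).
Qed.

(** Lebesgue differentiation gives the derivative, the bound [M] the Lipschitz constant. The lower
    limit stays at 0 whatever the interval [[a, b]], which later keeps the integral jointly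
    measurable in time and jump times. *)
Lemma prim_on_Rintegral (R : realType) (g : R -> R) (M a b : R) : 0 <= a ->
  measurable_fun setT g -> (forall x, `|g x| <= M) ->
  prim_on a b (fun t => \int[lebesgue_measure]_(s in `[0, t]) g s)%R g.
Proof.
move=> a0 mg gM.
have ig y : (@lebesgue_measure R).-integrable `[0, y] (EFin \o g).
  apply: (bounded_integrable (M := M)) => //.
  by rewrite lebesgue_measure_itv /=; case: ifP => _; rewrite ltry.
split; last first.
  have lg : locally_integrable setT g.
    split => //; first exact: openT.
    move=> K _ cK.
    have /integrableP[_ //] := bounded_integrable (compact_measurable cK)
      (compact_finite_measure cK) mg gM.
  apply: filterS (FTC1 ig lg) => t h /andP[at0 _].
  have [|df fg] := h; first by rewrite /= lte_fin (le_lt_trans a0 at0).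
  by apply: DeriveDef => //; rewrite -derive1E.
exists `|M| => // x y ax xy yb.
rewrite Rintegral_itvB ?bnd_simp //; last exact: le_trans ax.
apply: le_trans (le_normr_Rintegral _ _) _ => //.
  by apply: integrableS (ig y) => //; apply: subset_itv; rewrite bnd_simp // (le_trans a0).
apply: (@le_trans _ _ (\int[lebesgue_measure]_(s in `]x, y]) `|M|)); last first.
  rewrite Rintegral_cst // (_ : fine _ = fine ((y - x)%:E)) //; congr fine.
  rewrite [LHS]lebesgue_measure_itv /= lte_fin; case: ltP => //= yx; rewrite (_ : y = x) ?subrr //.
  by apply: le_anti; rewrite xy yx.
apply: le_Rintegral => //.
- apply: (bounded_integrable (M := M)) => //.
  + by rewrite lebesgue_measure_itv /=; case: ifP => _; rewrite ltry.
  + by apply: measurableT_comp => //.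
  + by move=> s; rewrite normr_id.
- apply: (bounded_integrable (M := `|M|)) => //.
    by rewrite lebesgue_measure_itv /=; case: ifP => _; rewrite ltry.
  by move=> s; rewrite normr_id.
- by move=> s _; apply: le_trans (gM s) (ler_norm _).
Qed.

(** Writing the moving domain [[0, x.1]] as a cut-off in the integrand [k] gives an integral over a
    fixed space, to which Tonelli applies for the positive and the negative part separately. *)
Lemma measurable_Rintegral (d : measure_display) (U : measurableType d) (R : realType)
    (g : R * U -> R) : measurable_fun setT g ->
  measurable_fun setT
    (fun x : R * U => \int[lebesgue_measure]_(s in `[0, x.1]) g (s, x.2))%R.
Proof.
move=> mg.
pose k (z : (R * U) * R) : \bar R := if 0 <= z.2 <= z.1.1 then (g (z.2, z.1.2))%:E else 0%E.
have mk : measurable_fun setT k.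
  apply: measurable_fun_ifT => //.
    apply: measurable_and; apply: measurable_fun_ler => //.
    by apply: measurableT_comp => //; exact: measurable_fst.
  apply: measurableT_comp => //.
  apply: (measurableT_comp mg).
  apply: measurable_fun_pair => //.
  by apply: measurableT_comp => //; exact: measurable_fst.
have -> : (fun x : R * U => \int[lebesgue_measure]_(s in `[0, x.1]) g (s, x.2))%R =
  fine \o (fun x => fubini_F lebesgue_measure k^\+%E x - fubini_F lebesgue_measure k^\-%E x)%E.
  apply/funext => -[t u] /=; rewrite /Rintegral; congr fine.
  rewrite integral_mkcond integralE /fubini_F.
  have E s : ((fun s => (g (s, u))%:E) \_ `[0, t]) s = k ((t, u), s).
    rewrite /k /patch /=; case: ifPn => [|/negP]; rewrite inE /= in_itv /=.
      by move=> ->.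
    by move=> /negP/negbTE ->.
  congr (_ - _)%E; apply: eq_integral => s _; by rewrite ?funeposE ?funenegE E.
apply: measurableT_comp; first exact: fine_measurable.
apply: emeasurable_funB; apply: measurable_fun_fubini_tonelli_F => //.
exact: measurable_funepos.
exact: measurable_funeneg.
Qed.

(** * Borel maps between matrix spaces *)

Notation borelmx R p q := (g_sigma_algebraType [set U : set 'M[R]_(p, q) | open U]).

Section borel_matrices.
Context (R : realType).

Lemma measurable_fun_coord (p q : nat) (i : 'I_p) (j : 'I_q) :
  measurable_fun setT (fun M : borelmx R p q => (M : 'M[R]_(p, q)) i j).
Proof.
apply: (measurability (RGenOInfty.G (R := R))); first exact: RGenOInfty.measurableE.
move=> _ [_ [x ->] <-]; rewrite setTI; apply: sub_sigma_algebra => /=.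
by apply: (open_comp (D := `]x, +oo[%classic)) => [M _|];
  [exact: coord_continuous | exact: rray_open].
Qed.

Let box (p q : nat) (c : 'M[rat]_(p, q)) (k : nat) : set 'M[R]_(p, q) :=
  [set M | forall i j, `|M i j - ratr (c i j)| < k.+1%:R^-1].

(** Second countability: the boxes with rational centre and radius [k.+1%:R^-1] form a countable
    base. *)
Let open_bigcup_box (p q : nat) (U : set 'M[R]_(p, q)) : open U ->
  U = \bigcup_(x in [set: 'M[rat]_(p, q) * nat])
        (if `[< box x.1 x.2 `<=` U >] then box x.1 x.2 else set0).
Proof.
move=> oU; apply/seteqP; split => M; last first.
  by move=> [[c k] _ /=]; case: asboolP => [cU Mc|//]; exact: cU.
move=> UM; have /nbhs_ballP[e /= e0 eU] : nbhs M U by exact: open_nbhs_nbhs.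
(* Half of [e], since [M] and another point of the box are compared through its centre. *)
have [k ke] : exists k : nat, k.+1%:R^-1 < e / 2.
  by have [k _ /(_ k (leqnn k)) /=] :=
    near_infty_natSinv_lt (PosNum (divr_gt0 e0 (ltr0n R 2))); exists k.
have [c cM] : exists c : 'M[rat]_(p, q), box c k M.
  have h i j : exists r : rat, `|M i j - ratr r| < k.+1%:R^-1.
    have k0 : 0 < (k.+1%:R^-1 : R) by rewrite invr_gt0.
    have [|r] := @rat_in_itvoo R (M i j - k.+1%:R^-1) (M i j + k.+1%:R^-1);
      first by rewrite ltrBlDr -addrA ltrDl addr_gt0.
    by rewrite in_itv /= => h; exists r; rewrite distrC ltr_distl.
  exists (\matrix_(i, j) xchoose (h i j)) => i j; rewrite mxE; exact: (xchooseP (h i j)).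
exists (c, k) => //=; case: asboolP => // -[] N cN; apply: eU; split => // i j.
rewrite /ball /= -(subrK (ratr (c i j)) (M i j)) -addrA (le_lt_trans (ler_normD _ _)) //.
by rewrite [ltRHS]splitr ltrD // ?(lt_trans (cM i j)) // distrC (lt_trans (cN i j)).
Qed.

(** An open set is a countable union of boxes, and the preimage of a box is a finite intersection of
    conditions on single entries. *)
Lemma measurable_fun_mx (d : measure_display) (V : measurableType d) (p q : nat) (D : set V)
    (f : V -> borelmx R p q) : measurable D ->
  (forall i j, measurable_fun D (fun x => (f x : 'M[R]_(p, q)) i j)) -> measurable_fun D f.
Proof.
move=> mD mf; pose G : set (set 'M[R]_(p, q)) := [set U | open U].
apply: (@measurability _ _ _ (borelmx R p q) D f G) => //.
move=> _ [U oU <-]; rewrite (open_bigcup_box oU) preimage_bigcup setI_bigcupr.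
apply: countable_bigcupT_measurable => [|[c k]].
  exact: countableP.
rewrite /=; case: asboolP => _; last by rewrite preimage_set0 setI0.
have -> : D `&` f @^-1` box c k =
    D `&` \big[setI/setT]_(i < p) \big[setI/setT]_(j < q)
       (D `&` [set x | `|(f x : 'M[R]_(p, q)) i j - ratr (c i j)| < k.+1%:R^-1]).
  apply/seteqP; split => x [Dx h]; split => //.
    by rewrite -bigcap_seq => i /= _; rewrite -bigcap_seq => j /= _; split => //; exact: h.
  move=> i j; move: h; rewrite -bigcap_seq => /(_ i) /=; rewrite mem_index_enum => /(_ isT).
  by rewrite -bigcap_seq => /(_ j) /=; rewrite mem_index_enum => /(_ isT) [].
apply: measurableI => //; apply: bigsetI_measurable => i _; apply: bigsetI_measurable => j _.
have h : measurable_fun D (fun x => `|(f x : 'M[R]_(p, q)) i j - ratr (c i j)|).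
  by apply: measurableT_comp => //; apply: measurable_funB => //; exact: mf.
have -> : D `&` [set x | `|(f x : 'M[R]_(p, q)) i j - ratr (c i j)| < k.+1%:R^-1] =
   D `&` (fun x => `|(f x : 'M[R]_(p, q)) i j - ratr (c i j)|) @^-1` `]-oo, k.+1%:R^-1[%classic.
  by apply/seteqP; split => x /=; rewrite in_itv.
exact: h.
Qed.

(** [borel_on] controls only traces on [D]; as [g] maps [D0] into [D], the preimage can be computed
    with a Borel set [C] of the whole space. *)
Lemma borel_on_comp (d : measure_display) (V : measurableType d) (p q r : nat)
    (D0 : set V) (D : set 'rV[R]_p) (f : 'rV[R]_p -> 'M[R]_(q, r)) (g : V -> 'rV[R]_p) :
  measurable D0 -> borel_on D f -> (forall x, D0 x -> D (g x)) ->
  (forall i, measurable_fun D0 (fun x => g x 0 i)) ->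
  forall i j, measurable_fun D0 (fun x => f (g x) i j).
Proof.
move=> mD0 bf gD mg i j _ Y mY.
have mB : borelM ((fun M : 'M[R]_(q, r) => M i j) @^-1` Y).
  by have := @measurable_fun_coord q r i j measurableT _ mY; rewrite setTI.
have [C mC DC] := bf _ mB.
have -> : D0 `&` (fun x => f (g x) i j) @^-1` Y = D0 `&` g @^-1` C.
  apply/seteqP; split => x [D0x h]; split => //.
    by have [] : (D `&` C) (g x) by rewrite -DC; split => //; exact: gD.
  by have [] : (D `&` f @^-1` ((fun M : 'M[R]_(q, r) => M i j) @^-1` Y)) (g x)
    by rewrite DC; split => //; exact: gD.
have mg' : measurable_fun D0 (g : V -> borelmx R 1 p).
  by apply: measurable_fun_mx => // k l; rewrite (_ : k = 0) ?ord1 //; exact: mg.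
exact: mg'.
Qed.

End borel_matrices.

(** * Jump times *)

Section jump_times.
Context (R : realType) (n : nat) (T : R).
Hypothesis T0 : 0 < T.

(* On [inU] the entries are nondecreasing up to index [Z u], so this maximum is the last
   jump time [t_u], and it is [0] at [u0]. *)
Definition last_jump (u : 'rV[R]_n) : R := \big[Num.max/0]_(i < n) u 0 i.

Lemma last_jump_ge0 (u : 'rV[R]_n) : 0 <= last_jump u.
Proof. exact: bigmax_ge_id. Qed.

Lemma last_jump_leP (u : 'rV[R]_n) (t : R) :
  last_jump u <= t <-> 0 <= t /\ forall i, u 0 i <= t.
Proof.
split => [h|[t0 h]]; last exact: bigmax_le.
split => [|i]; apply: le_trans h; first exact: last_jump_ge0.
exact: (le_bigmax_cond 0 (fun i => u 0 i)).
Qed.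

Lemma inU_Z (u : 'rV[R]_n) (k : nat) : (k <= n)%N ->
  (forall i : 'I_n, (i < k)%N -> 0 <= u 0 i) ->
  (forall i : 'I_n, (k <= i)%N -> u 0 i = -1) -> Z u = k.
Proof.
move=> kn h1 h2; rewrite /Z -sum1_card (eq_bigl (fun i : 'I_n => (i < k)%N)).
  by rewrite -(big_ord_widen n (fun=> 1%N) kn) sum1_card card_ord.
move=> i; rewrite inE; have [ik|ki] := ltnP i k; last by rewrite h2 // eqxx.
by apply/eqP => ui; have := h1 i ik; rewrite ui; lra.
Qed.

Lemma inUP (u : 'rV[R]_n) : inU T u ->
  [/\ (Z u <= n)%N, forall i : 'I_n, (i < Z u)%N -> 0 <= u 0 i <= T,
      forall i j : 'I_n, (i <= j)%N -> (j < Z u)%N -> u 0 i <= u 0 j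
    & forall i : 'I_n, (Z u <= i)%N -> u 0 i = -1].
Proof.
move=> [k kn [h1 h2 h3]]; have -> : Z u = k by apply: inU_Z => // i /h1 /andP[].
by split.
Qed.

Lemma TSP (u : 'rV[R]_n) (t : R) : TS T t u <-> inU T u /\ last_jump u <= t <= T.
Proof.
split => [[/andP[t0 tT] [uU ut]]|[uU /andP[/last_jump_leP[t0 ut] tT]]].
  by split => //; rewrite tT andbT; apply/last_jump_leP.
by split; rewrite ?t0.
Qed.

Lemma TS_inU (u : 'rV[R]_n) (t : R) : TS T t u -> inU T u.
Proof. by move=> [_ []]. Qed.

Lemma last_jump_leT (u : 'rV[R]_n) : inU T u -> last_jump u <= T.
Proof.
move=> /inUP[_ h1 _ h2]; apply/last_jump_leP; split => [|i]; first exact: ltW.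
have [/h1/andP[]//|/h2 ->] := ltnP i (Z u); have := T0; lra.
Qed.

Lemma TS_T (u : 'rV[R]_n) : inU T u -> TS T T u.
Proof. by move=> uU; apply/TSP; rewrite last_jump_leT // lexx. Qed.

Lemma TS_last_jump (u : 'rV[R]_n) : inU T u -> TS T (last_jump u) u.
Proof. by move=> uU; apply/TSP; rewrite last_jump_leT // lexx. Qed.

Lemma last_jumpE (u : 'rV[R]_n) (i : 'I_n) : inU T u -> i.+1 = Z u -> last_jump u = u 0 i.
Proof.
move=> /inUP[_ h1 h2 h3] iZ; apply/le_anti/andP; split; last first.
  exact: (le_bigmax_cond 0 (fun i => u 0 i)).
have [ui _] : 0 <= u 0 i /\ u 0 i <= T by apply/andP/h1; rewrite -iZ.
apply/last_jump_leP; split => // j; have [jZ|/h3 ->] := ltnP j (Z u); last by lra.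
by apply: h2; rewrite -?iZ // -ltnS iZ.
Qed.

Lemma inU_u0 : inU T (u0 n : 'rV[R]_n).
Proof. by exists 0%N => //; split => // i _; rewrite mxE. Qed.

Lemma inU_Z0 (u : 'rV[R]_n) : inU T u -> Z u = 0%N -> u = u0 n.
Proof. by move=> /inUP[_ _ _ h] Z0; apply/rowP => i; rewrite h ?Z0 // mxE. Qed.

Lemma Z_u0 : Z (u0 n : 'rV[R]_n) = 0%N.
Proof. by apply: inU_Z => // i _; rewrite mxE. Qed.

Lemma last_jump_u0 : last_jump (u0 n) = 0.
Proof.
apply/le_anti; rewrite last_jump_ge0 andbT; apply/last_jump_leP.
by split => // i; rewrite mxE lerN10.
Qed.

Lemma inU_uright (u : 'rV[R]_n) (t : R) : TS T t u -> (Z u < n)%N ->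
  inU T (uright u t) /\ Z (uright u t) = (Z u).+1.
Proof.
move=> [/andP[t0 tT] [/inUP[_ h1 h2 h3] ut]] Zn.
have r1 (i : 'I_n) : (i < (Z u).+1)%N -> 0 <= uright u t 0 i <= T.
  rewrite mxE ltnS leq_eqVlt; case: eqVneq => [_ _|_ /= /h1 //]; exact/andP.
have r3 (i : 'I_n) : ((Z u).+1 <= i)%N -> uright u t 0 i = -1.
  by move=> Zi; rewrite mxE gtn_eqF // h3 // ltnW.
split; last by apply: inU_Z => // i /r1/andP[].
exists (Z u).+1 => //; split => // i j ij; rewrite !mxE ltnS leq_eqVlt.
case: (eqVneq (j : nat) (Z u)) => [jZ _|jZ /= jZ'].
  by case: eqVneq => // _; exact: ut.
by rewrite ltn_eqF ?(leq_ltn_trans ij) //; exact: h2.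
Qed.

Lemma TS_uright (u : 'rV[R]_n) (t : R) : TS T t u -> (Z u < n)%N -> TS T t (uright u t).
Proof.
move=> tu Zn; have [rU _] := inU_uright tu Zn; case: tu => [tT [_ ut]].
by split => //; split => // i; rewrite mxE; case: eqVneq.
Qed.

Lemma inU_uleft (u : 'rV[R]_n) : inU T u -> (0 < Z u)%N ->
  inU T (uleft u) /\ Z (uleft u) = (Z u).-1.
Proof.
move=> /inUP[Zn h1 h2 h3] Z0.
have ltP' (i : nat) : (i < (Z u).-1)%N -> (i < Z u)%N by move/leq_trans; apply; exact: leq_pred.
have r1 (i : 'I_n) : (i < (Z u).-1)%N -> uleft u 0 i = u 0 i.
  by move=> iZ; rewrite mxE -(ltn_predK Z0) eqSS ltn_eqF.
have r3 (i : 'I_n) : ((Z u).-1 <= i)%N -> uleft u 0 i = -1.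
  move=> Zi; rewrite mxE; case: eqVneq => // iZ; apply: h3.
  by move: Zi; rewrite leq_eqVlt -eqSS (ltn_predK Z0) eq_sym (negbTE iZ) /=.
have Pn : ((Z u).-1 <= n)%N by apply: leq_trans Zn; exact: leq_pred.
split; last by apply: inU_Z => // i iZ; rewrite r1 //; have /andP[] := h1 i (ltP' _ iZ).
exists (Z u).-1 => //; split => //.
- by move=> i iZ; rewrite r1 //; apply: h1; exact: ltP'.
- move=> i j ij jZ; rewrite !r1 ?(leq_ltn_trans ij) //; apply: h2 => //; exact: ltP'.
Qed.

Lemma TS_uleft (u : 'rV[R]_n) : inU T u -> (0 < Z u)%N -> TS T (last_jump u) (uleft u).
Proof.
move=> uU Z0; have [lU _] := inU_uleft uU Z0.
split; first by rewrite last_jump_ge0 last_jump_leT.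
split => // i; rewrite mxE; case: eqVneq => [_|_].
  by apply: le_trans (last_jump_ge0 u); lra.
by have /last_jump_leP[_] := lexx (last_jump u).
Qed.

End jump_times.

(** * Measurability in time and jump times *)

Section measurable_jump_times.
Context (R : realType) (n : nat) (T : R).
Local Notation BU := (borelmx R 1 n).

Lemma measurable_forall (d : measure_display) (V : measurableType d) (I : finType)
    (b : I -> V -> bool) : (forall i, measurable_fun setT (b i)) ->
  measurable_fun setT (fun x => [forall i, b i x]).
Proof.
move=> mb; apply: (measurable_fun_bool true); rewrite setTI.
have -> : (fun x => [forall i, b i x]) @^-1` [set true] =
    \big[setI/setT]_(i : I) (setT `&` b i @^-1` [set true]).
  apply/seteqP; split => x /=; rewrite -bigcap_seq.
    by move=> /forallP h i _; split => //; exact: h.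
  by move=> h; apply/forallP => i; have [] := h i (mem_index_enum i).
by apply: bigsetI_measurable => i _; exact: mb.
Qed.

Lemma measurable_exists (d : measure_display) (V : measurableType d) (I : finType)
    (b : I -> V -> bool) : (forall i, measurable_fun setT (b i)) ->
  measurable_fun setT (fun x => [exists i, b i x]).
Proof.
move=> mb.
have -> : (fun x => [exists i, b i x]) = (fun x => ~~ [forall i, ~~ b i x]).
  by apply/funext => x; rewrite negb_forall; apply: eq_existsb => i; rewrite negbK.
by apply: measurable_neg; apply: measurable_forall => i; exact: measurable_neg.
Qed.

Lemma measurable_entry (i : 'I_n) :
  measurable_fun setT (fun z : R * BU => (z.2 : 'rV[R]_n) 0 i).
Proof. exact: (measurableT_comp (@measurable_fun_coord R 1 n 0 i) measurable_snd). Qed.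

Let inUb (u : 'rV[R]_n) : bool := [exists k : 'I_n.+1, [forall i : 'I_n, [forall j : 'I_n,
  (if (i < k)%N then 0 <= u 0 i <= T else u 0 i == -1) &&
  (if (i <= j)%N && (j < k)%N then u 0 i <= u 0 j else true)]]].

Let inUbP (u : 'rV[R]_n) : inU T u <-> inUb u.
Proof.
split => [[k kn [h1 h2 h3]]|/existsP[k /forallP h]].
  apply/existsP; exists (inord k); apply/forallP => i; apply/forallP => j; rewrite inordK //.
  apply/andP; split; first by case: ltnP => [/h1|/h3/eqP].
  by case: ifP => // /andP[]; exact: h2.
have {}h i j := elimT andP (elimT forallP (h i) j).
exists k; first by rewrite -ltnS.
split => [i ik|i j ij jk|i ki].
- by have [+ _] := h i i; rewrite ik.
- by have [_] := h i j; rewrite ij jk.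
- by have [+ _] := h i i; rewrite ltnNge ki /= => /eqP.
Qed.

Lemma measurable_bigmax (d : measure_display) (V : measurableType d) (m : nat)
    (f : 'I_m -> V -> R) : (forall i, measurable_fun setT (f i)) ->
  measurable_fun setT (fun x => \big[Num.max/0]_(i < m) f i x).
Proof.
elim: m f => [|m IH] f mf.
  by under eq_fun do rewrite big_ord0; exact: measurable_cst.
under eq_fun do rewrite big_ord_recl.
by apply: measurable_maxr => //; apply: IH.
Qed.

Lemma measurable_last_jump :
  measurable_fun setT (fun z : R * BU => last_jump (z.2 : 'rV[R]_n)).
Proof. by apply: measurable_bigmax => i; exact: measurable_entry. Qed.

Lemma measurable_TS : measurable [set z : R * BU | TS T z.1 (z.2 : 'rV[R]_n)].
Proof.
have -> : [set z : R * BU | TS T z.1 (z.2 : 'rV[R]_n)] =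
   setT `&` (fun z : R * BU => inUb z.2 && (last_jump (z.2 : 'rV[R]_n) <= z.1 <= T))
     @^-1` [set true].
  apply/seteqP; split => z /=; rewrite TSP.
    by move=> [/inUbP -> h].
  by move=> [_ /andP[/inUbP]].
suff h : measurable_fun setT
    (fun z : R * BU => inUb z.2 && (last_jump (z.2 : 'rV[R]_n) <= z.1 <= T)) by exact: h.
apply: measurable_and; last first.
  apply: measurable_and; apply: measurable_fun_ler => //; exact: measurable_last_jump.
apply: measurable_exists => k; apply: measurable_forall => i; apply: measurable_forall => j.
apply: measurable_and.
  case: (i < k)%N.
    by apply: measurable_and; apply: measurable_fun_ler => //; exact: measurable_entry.
  by apply: measurable_fun_eqr => //; exact: measurable_entry.
by case: ((i <= j)%N && (j < k)%N) => //; apply: measurable_fun_ler; exact: measurable_entry.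
Qed.

(** A cardinal becomes a finite sum of real indicators, one for each entry. *)
Lemma measurable_Z (k : nat) :
  measurable_fun setT (fun z : R * BU => Z (z.2 : 'rV[R]_n) == k).
Proof.
have -> : (fun z : R * BU => Z (z.2 : 'rV[R]_n) == k) =
    (fun z : R * BU => \sum_(i < n) (if (z.2 : 'rV[R]_n) 0 i == -1 then 0 else 1 : R) == k%:R).
  apply/funext => z; rewrite -(eqr_nat R) /Z -sum1_card natr_sum big_mkcond /=.
  by congr (_ == _); apply: eq_bigr => i _; rewrite inE; case: eqP.
apply: measurable_fun_eqr => //; apply: measurable_sum => i.
by apply: measurable_fun_ifT => //; apply: measurable_fun_eqr => //; exact: measurable_entry.
Qed.

Lemma measurable_uright :
  measurable_fun setT (fun z : R * BU => (z.1, uright (z.2 : 'rV[R]_n) z.1) : R * BU).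
Proof.
apply: measurable_fun_pair => //; apply: measurable_fun_mx => // i j; rewrite ord1.
apply: (eq_measurable_fun (fun z : R * BU =>
  if Z (z.2 : 'rV[R]_n) == j then z.1 else (z.2 : 'rV[R]_n) 0 j)) => [z _|].
  by rewrite /= mxE eq_sym.
apply: measurable_fun_ifT; [exact: measurable_Z | by [] | exact: measurable_entry].
Qed.

Lemma measurable_uleft :
  measurable_fun setT
    (fun z : R * BU => (last_jump (z.2 : 'rV[R]_n), uleft (z.2 : 'rV[R]_n)) : R * BU).
Proof.
apply: measurable_fun_pair; first exact: measurable_last_jump.
apply: measurable_fun_mx => // i j; rewrite ord1.
apply: (eq_measurable_fun (fun z : R * BU =>
  if Z (z.2 : 'rV[R]_n) == j.+1 then -1 else (z.2 : 'rV[R]_n) 0 j)) => [z _|].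
  by rewrite /= mxE eq_sym.
apply: measurable_fun_ifT; [exact: measurable_Z | by [] | exact: measurable_entry].
Qed.

(* The number of jumps takes finitely many values on [TS]. *)
Lemma measurable_fun_split_Z (G : nat -> R * BU -> R) :
  (forall k, (k <= n)%N ->
     measurable_fun ([set z : R * BU | TS T z.1 (z.2 : 'rV[R]_n)] `&`
       [set z : R * BU | Z (z.2 : 'rV[R]_n) = k]) (G k)) ->
  measurable_fun [set z : R * BU | TS T z.1 (z.2 : 'rV[R]_n)]
    (fun z => G (Z (z.2 : 'rV[R]_n)) z).
Proof.
move=> mG; apply: (eq_measurable_fun (fun z : R * BU =>
  \sum_(k < n.+1) (if Z (z.2 : 'rV[R]_n) == k then G k z else 0))).
  move=> z; rewrite inE /= => /TS_inU/inUP[Zn _ _ _].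
  rewrite (bigD1 (inord (Z (z.2 : 'rV[R]_n)))) //= inordK // eqxx big1 ?addr0 // => k kZ.
  case: eqVneq => // Zk; move: kZ; rewrite -val_eqE /= inordK // Zk eqxx //.
apply: measurable_sum => k; apply: measurable_fun_if => //.
- exact: measurable_TS.
- apply: measurable_funTS; exact: measurable_Z.
- have -> : (fun t : R * BU => Z (t.2 : 'rV[R]_n) == k) @^-1` [set true] =
     [set z : R * BU | Z (z.2 : 'rV[R]_n) = k].
    by apply/seteqP; split => z /=; [move/eqP | move=> ->; rewrite eqxx].
  by apply: mG; rewrite -ltnS.
Qed.

End measurable_jump_times.

(** * Norms and geometric rates *)

Section norms.
Context (R : realType) (p : nat).
Implicit Types (x y m : 'rV[R]_p) (M : 'M[R]_p).

Definition norm1 x : R := \sum_(i < p) `|x 0 i|.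

Lemma norm1_ge0 x : 0 <= norm1 x.
Proof. exact: sumr_ge0. Qed.

Lemma ler_vnorm x i : `|x 0 i| <= vnorm x.
Proof. exact: (le_bigmax_cond 0 (fun i => `|x 0 i|)). Qed.

Lemma vnorm_ge0 x : 0 <= vnorm x.
Proof. exact: bigmax_ge_id. Qed.

Lemma vnorm_leP x (b : R) : 0 <= b -> (forall i, `|x 0 i| <= b) -> vnorm x <= b.
Proof. by move=> b0 h; apply: bigmax_le. Qed.

Lemma vnorm_norm1 x : vnorm x <= norm1 x.
Proof.
apply: vnorm_leP => [|i]; first exact: norm1_ge0.
by rewrite /norm1 (bigD1 i) //= lerDl sumr_ge0.
Qed.

Lemma vnormB x y : vnorm (x - y) <= vnorm x + vnorm y.
Proof.
apply: vnorm_leP => [|i]; first by rewrite addr_ge0 ?vnorm_ge0.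
by rewrite !mxE (le_trans (ler_normB _ _)) // lerD ?ler_vnorm.
Qed.

Lemma norm1B x y : norm1 (x - y) <= norm1 x + norm1 y.
Proof.
by rewrite /norm1 -big_split; apply: ler_sum => i _; rewrite !mxE (le_trans (ler_normB _ _)).
Qed.

Lemma ler_mnorm M i : \sum_(j < p) `|M i j| <= mnorm M.
Proof. exact: (le_bigmax_cond 0 (fun i => \sum_(j < p) `|M i j|)). Qed.

Lemma mnorm_ge0 M : 0 <= mnorm M.
Proof. exact: bigmax_ge_id. Qed.

Lemma mnorm_vnorm M x i : `|\sum_(j < p) M i j * x 0 j| <= mnorm M * vnorm x.
Proof.
apply: le_trans (ler_norm_sum _ _ _) _.
apply: (@le_trans _ _ (\sum_(j < p) `|M i j| * vnorm x)).
  by apply: ler_sum => j _; rewrite normrM ler_wpM2l // ler_vnorm.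
by rewrite -mulr_suml ler_wpM2r ?vnorm_ge0 // ler_mnorm.
Qed.

Lemma norm1_mulmx x M (c : R) : (forall j, \sum_(i < p) `|M j i| <= c) ->
  norm1 (x *m M) <= norm1 x * c.
Proof.
move=> hc; rewrite /norm1.
apply: (@le_trans _ _ (\sum_(i < p) \sum_(j < p) `|x 0 j| * `|M j i|)).
  apply: ler_sum => i _; rewrite mxE (le_trans (ler_norm_sum _ _ _)) //.
  by apply: ler_sum => j _; rewrite normrM.
rewrite exchange_big /= mulr_suml; apply: ler_sum => j _.
by rewrite -mulr_sumr ler_wpM2l.
Qed.

Lemma simplex_norm1 m : simplex m -> norm1 m = 1.
Proof. by move=> [h <-]; apply: eq_bigr => i _; rewrite ger0_norm. Qed.

(** Off-diagonal entries are rates, and a diagonal entry is at least [- mnorm M]. *)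
Lemma intensity_shift_ge0 M (c : R) : intensity M -> mnorm M <= c ->
  forall i j, 0 <= (M + c%:M) i j.
Proof.
move=> [h _] Mc i j; rewrite !mxE; case: eqVneq => [<-|ij]; last by rewrite addr0 h.
rewrite mulr1n -lerBlDl sub0r; apply: le_trans Mc.
apply: le_trans (ler_mnorm M i); rewrite (bigD1 i) //= ler_wpDr ?sumr_ge0 //.
by rewrite -normrN ler_norm.
Qed.

Lemma intensity_shift_row M (c : R) : intensity M -> forall i, \sum_(j < p) (M + c%:M) i j = c.
Proof.
move=> [_ h] i; under eq_bigr do rewrite !mxE.
rewrite big_split /= h add0r (bigD1 i) //= eqxx mulr1n big1 ?addr0 // => j ji.
by rewrite eq_sym (negbTE ji).
Qed.

Lemma Jmx_row (Jf : 'I_p -> 'I_p) i : \sum_(j < p) (Jmx Jf : 'M[R]_p) i j = 1.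
Proof.
under eq_bigr do rewrite mxE.
by rewrite (bigD1 (Jf i)) //= eqxx big1 ?addr0 // => j /negbTE; rewrite eq_sym => ->.
Qed.

(** Every row of [Jmx Jf] is a unit vector. In the maximum norm the same map can cost the size of
    the largest fibre of [Jf], which is the origin of a factor [Jmax]. *)
Lemma norm1_Jmx x (Jf : 'I_p -> 'I_p) : norm1 (x *m Jmx Jf) <= norm1 x.
Proof.
rewrite -[leRHS]mulr1; apply: norm1_mulmx => j; rewrite -(Jmx_row Jf j).
by apply: ler_sum => i _; rewrite mxE ger0_norm.
Qed.

Lemma simplex_Jmx m (Jf : 'I_p -> 'I_p) : simplex m -> simplex (m *m Jmx Jf).
Proof.
move=> [h0 h1]; split => [i|].
  by rewrite mxE sumr_ge0 // => j _; rewrite mulr_ge0 // mxE.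
under eq_bigr do rewrite mxE.
rewrite exchange_big /= -h1; apply: eq_bigr => j _.
by rewrite -mulr_sumr Jmx_row mulr1.
Qed.

End norms.

(** * Limits at a geometric rate *)

Section geometric_rate.
Context (R : realType) (r : R).
Hypotheses (r0 : 0 <= r) (r1 : r < 1).

Let cvg_geo (K : R) : (fun j : nat => K * r ^+ j) @ \oo --> 0.
Proof. by apply: cvg_geometric; rewrite ger0_norm. Qed.

Lemma le_geometric (a b K : R) : (forall j : nat, a <= b + K * r ^+ j) -> a <= b.
Proof.
move=> h; apply/ler_addgt0Pr => e e0.
have /cvgrPdist_lt/(_ e e0)[j _ /(_ j (leqnn j))] := cvg_geo K.
rewrite /= sub0r normrN => je; apply: le_trans (h j) _; rewrite lerD2l.
by apply: le_trans (ler_norm _) (ltW je).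
Qed.

(** With [c k] the tail of the geometric series, [a + c] decreases and [a - c] increases. Monotone
    convergence and [c --> 0] give the limit of [a], and the two monotone sequences enclose it,
    which is the error bound. *)
Lemma cvg_geometric_increments (a : nat -> R) (K : R) :
  (forall k, `|a k.+1 - a k| <= K * r ^+ k) ->
  a @ \oo --> limn a /\ forall k, `|limn a - a k| <= K / (1 - r) * r ^+ k.
Proof.
move=> aK; have r10 : 0 < 1 - r by rewrite subr_gt0.
have rn0 : 1 - r != 0 by rewrite gt_eqF.
pose c (k : nat) : R := K / (1 - r) * r ^+ k.
have cS k : c k - c k.+1 = K * r ^+ k by rewrite /c exprS; field.
have K0 : 0 <= K by have := le_trans (normr_ge0 _) (aK 0%N); rewrite expr0 mulr1.
have c0 k : 0 <= c k by rewrite mulr_ge0 ?exprn_ge0 // divr_ge0 // ltW.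
have c_to0 : c @ \oo --> 0 by exact: cvg_geo.
pose b k := a k + c k; pose d k := a k - c k.
have bdec : nonincreasing_seq b.
  apply/nonincreasing_seqP => k; have := aK k; rewrite -cS ler_norml => /andP[_].
  by rewrite /b; lra.
have dinc : nondecreasing_seq d.
  apply/nondecreasing_seqP => k; have := aK k; rewrite -cS ler_norml => /andP[+ _].
  by rewrite /d; lra.
have bcvg : cvgn b.
  apply: nonincreasing_is_cvgn => //; exists (d 0%N) => _ [k _ <-].
  by apply: le_trans (dinc _ _ (leq0n k)) _; rewrite /d /b; have := c0 k; lra.
have ab : a @ \oo --> limn b.
  rewrite (_ : a = (fun k => b k - c k)); last by apply/funext => k; rewrite /b addrK.
  by rewrite -[X in _ --> X]subr0; apply: cvgB.
have la : limn a = limn b by apply/cvg_lim.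
have da : d @ \oo --> limn a.
  by rewrite -[X in _ --> X]subr0; apply: cvgB => //; rewrite la.
split; first by rewrite la.
move=> k; rewrite ler_distl -/(c k); apply/andP; split.
  have dcvg : cvgn d by apply: cvgP da.
  by have := nondecreasing_cvgn_le dinc dcvg k; rewrite (cvg_lim _ da).
by have := nonincreasing_cvgn_ge bdec bcvg k; rewrite la.
Qed.

End geometric_rate.

Lemma abs_cont_on_coord (R : realType) (p : nat) (D : set R) (f : R -> 'rV[R]_p) (a b : R)
    (i : 'I_p) : (forall t, a <= t -> t <= b -> D t) -> abs_cont_on D f ->
  ac_on a b (fun t => f t 0 i).
Proof.
move=> abD fac e e0; have [d d0 dP] := fac e e0; exists d => // N x y xy dis s.
apply: le_lt_trans (dP N x y _ _ s).
- by apply: ler_sum => k _; have := ler_vnorm (f (y k) - f (x k)) i; rewrite !mxE.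
- move=> k kN; have [ax xyk yb] := xy k kN; split => //; apply: abD => //.
    exact: le_trans yb.
  exact: le_trans xyk.
- move=> k l kN lN; rewrite neq_ltn => /orP[kl|lk].
    by left; exact: dis.
  by right; exact: dis.
Qed.

Lemma lip_on_abs_cont_on (R : realType) (p : nat) (D : set R) (f : R -> 'rV[R]_p) (a b : R) :
  (forall t, D t -> a <= t <= b) -> (forall i, lip_on a b (fun t => f t 0 i)) ->
  abs_cont_on D f.
Proof.
move=> Dab fl.
have [L L0 LP] : exists2 L : R, 0 <= L & forall x y, a <= x -> x <= y -> y <= b ->
    vnorm (f y - f x) <= L * (y - x).
  have h i : exists L : R, 0 <= L /\ forall x y, a <= x -> x <= y -> y <= b ->
    `|f y 0 i - f x 0 i| <= L * (y - x) by have [L ? ?] := fl i; exists L.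
  have [F FP] := fin_all_exists h.
  exists (\sum_i F i) => [|x y ax xy yb]; first by apply: sumr_ge0 => i _; have [] := FP i.
  apply: le_trans (vnorm_norm1 _) _; rewrite /norm1 mulr_suml; apply: ler_sum => i _.
  by rewrite !mxE; have [_] := FP i; apply.
move=> e e0; exists (e / (L + 1)); first by rewrite divr_gt0 // ltr_wpDl.
move=> N x y xy _ s; apply: (@le_lt_trans _ _ ((L + 1) * \sum_(k < N) (y k - x k))).
  rewrite mulr_sumr; apply: ler_sum => k _; have [Dx Dy xyk] := xy k (ltn_ord k).
  have /andP[ax _] := Dab _ Dx; have /andP[_ yb] := Dab _ Dy.
  apply: le_trans (LP _ _ ax xyk yb) _; rewrite ler_wpM2r ?subr_ge0 // lerDl //.
by rewrite mulrC -ltr_pdivlMr // ltr_wpDl.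
Qed.

(** * The Picard map *)

Section backward_weight.
Context (R : realType) (n : nat) (T lm : R).
Hypotheses (T0 : 0 < T) (lm0 : 0 <= lm).

(** One term for each possible number of further jumps, from 0 to [n - k]. At [k = n.+1] the sum is
    empty, so that the weight vanishes where no jump can lead. *)
Definition wsum (c : R) (k : nat) : R := \sum_(i < n.+1 - k) (expR (c * T) * lm * T) ^+ i.

(* A supersolution of [f' = - (d + c f_k + lm f_{k+1})], [f_k(T) = e], for [e + d T <= D]. *)
Definition wt (c D : R) (k : nat) (t : R) : R := D * wsum c k * expR (c * (T - t)).

Let base_ge0 c : 0 <= expR (c * T) * lm * T.
Proof. by rewrite !mulr_ge0 ?expR_ge0 // ltW. Qed.

Lemma wsum_rec (c : R) (k : nat) : (k <= n)%N ->
  wsum c k = 1 + expR (c * T) * lm * T * wsum c k.+1.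
Proof.
move=> kn; rewrite /wsum subSn // subSS big_ord_recl expr0 mulr_sumr; congr (_ + _).
by apply: eq_bigr => i _; rewrite exprS.
Qed.

Lemma wsum_ge0 (c : R) (k : nat) : 0 <= wsum c k.
Proof. by apply: sumr_ge0 => i _; rewrite exprn_ge0. Qed.

Lemma wsum_ge1 (c : R) (k : nat) : (k <= n)%N -> 1 <= wsum c k.
Proof. by move=> kn; rewrite wsum_rec // lerDl mulr_ge0 // wsum_ge0. Qed.

Lemma wsum_le0 (c : R) (k : nat) : wsum c k <= wsum c 0.
Proof.
rewrite /wsum subn0 (big_ord_widen n.+1 (fun i => (expR (c * T) * lm * T) ^+ i)) ?leq_subr //.
by rewrite [leRHS](bigID (fun i : 'I_n.+1 => (i < n.+1 - k)%N)) /= lerDl sumr_ge0 // => i _;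
  rewrite exprn_ge0.
Qed.

Lemma wt_ge (c D t : R) (k : nat) : 0 <= c -> 0 <= D -> t <= T -> (k <= n)%N -> D <= wt c D k t.
Proof.
move=> c0 D0 tT kn; rewrite /wt -mulrA ler_peMr //.
rewrite -[1]mulr1 ler_pM ?wsum_ge1 // -expR0 ler_expR mulr_ge0 // subr_ge0 //.
Qed.

Lemma wt_ge0 (c D t : R) (k : nat) : 0 <= D -> 0 <= wt c D k t.
Proof. by move=> D0; rewrite !mulr_ge0 ?wsum_ge0 ?expR_ge0. Qed.

Lemma wt_le (c D t : R) (k : nat) : 0 <= c -> 0 <= D -> 0 <= t ->
  wt c D k t <= D * (wsum c 0 * expR (c * T)).
Proof.
move=> c0 D0 t0; rewrite /wt -mulrA ler_wpM2l // ler_pM ?wsum_ge0 ?expR_ge0 //.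
  exact: wsum_le0.
by rewrite ler_expR ler_wpM2l // lerBlDr lerDl.
Qed.

Lemma wtM (c C D t : R) (k : nat) : wt c (C * D) k t = C * wt c D k t.
Proof. by rewrite /wt !mulrA. Qed.

Lemma wtB (c C D t : R) (k : nat) : wt c (C - D) k t = wt c C k t - wt c D k t.
Proof. by rewrite /wt !mulrBl. Qed.

Lemma wt_backward (c D D' d e t : R) (k : nat) (f f' : R -> R) :
  0 <= c -> 0 <= D -> 0 <= d -> (k <= n)%N -> 0 <= t -> t <= T ->
  ac_on t T f ->
  {ae (@lebesgue_measure R), forall s, t < s < T -> is_derive s 1 f (f' s)} ->
  (forall s, t < s < T -> `|f' s| <= d + c * wt c D k s + lm * wt c D k.+1 s) ->
  `|f T| <= e -> e + d * T <= D' -> `|f t| <= wt c D k t - (D - D').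
Proof.
move=> c0 D0 d0 kn t0 tT fac df fb fT eD.
(* [wt c D k.+1] is replaced by its value at time 0, so that the comparison function [g] has a
   closed form. *)
pose A := d + lm * (D * wsum c k.+1 * expR (c * T)).
pose g s := A * s + (- (D * wsum c k)) * expR (c * (T - s)).
have gp : prim_on t T g (fun s => A * 1 + (- (D * wsum c k)) * (- c * expR (c * (T - s)))).
  by apply: prim_onD; apply: prim_onZ; [exact: prim_on_id | exact: prim_on_expR].
have h : `|f T - f t| <= g T - g t.
  apply: (ac_on_norm_le tT fac df gp) => s ts; apply: le_trans (fb s ts) _.
  have /andP[ts1 sT] := ts.
  have w1 : lm * wt c D k.+1 s <= lm * (D * wsum c k.+1 * expR (c * T)).
    rewrite ler_wpM2l // ler_wpM2l ?mulr_ge0 ?wsum_ge0 // ler_expR ler_wpM2l //.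
    by rewrite lerBlDr lerDl (le_trans t0) // ltW.
  have -> : A * 1 + (- (D * wsum c k)) * (- c * expR (c * (T - s))) = A + c * wt c D k s.
    by rewrite /wt; ring.
  by rewrite /A; lra.
have {}h : `|f t| <= e + (g T - g t).
  rewrite -[f t](subrKC (f T)) (le_trans (ler_normD _ _)) // lerD // distrC //.
apply: le_trans h _.
rewrite /g subrr mulr0 expR0 mulr1 /wt (wsum_rec c kn).
set E := expR (c * (T - t)); set X := D * _.
have AT : A * (T - t) <= A * T.
  rewrite ler_wpM2l ?lerBlDr ?lerDl // addr_ge0 // !mulr_ge0 ?wsum_ge0 ?expR_ge0 //.
(* By [wsum_rec], [X] exceeds [D] by exactly the jump contribution to [A * T]. *)
have XE : X = D + lm * (D * wsum c k.+1 * expR (c * T)) * T by rewrite /X; ring.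
have : A * T = d * T + lm * (D * wsum c k.+1 * expR (c * T)) * T by rewrite /A mulrDl.
have -> : A * T + - X - (A * t + - X * E) = A * (T - t) - X + X * E by ring.
move: AT eD; rewrite {1}XE; lra.
Qed.

End backward_weight.

(** The arithmetic of the forward estimate, with the exponentials abstracted for [lra]. One interval
    between jumps raises the weight from [k] to [k + 1] multiples of [D]; the source uses only
    [D * r] of this, which leaves the gain [D * (1 - r)]. *)
Lemma forward_gain (R : realFieldType) (C k D X E M t t' s n1 n2 r : R) :
  n1 - s <= C * (k + 1) * D * X + M * t - (C * (k + 1) * D * E + M * t') ->
  s <= n2 -> n2 <= C * k * D * E -> M * (t - t') <= C * (D * r) -> C * D * 1 <= C * D * E ->
  n1 <= C * ((k + 1) * D * X - D * (1 - r)).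
Proof. lra. Qed.

Lemma ae_neq (R : realType) (c : R) : {ae (@lebesgue_measure R), forall t, t != c}.
Proof.
exists [set c]; split => //; first exact: lebesgue_measure_set1.
by move=> t /= /negP; rewrite negbK => /eqP.
Qed.

(** * The system with abstract bounds, and its right-hand sides *)

Section system.
Context (R : realType) (S n : nat) (T q lm Pm psm LpsiH LQH LPsi Llam : R).
Context (lam : R -> 'rV[R]_S -> nat -> R)
  (Qh : R -> 'rV[R]_n -> 'rV[R]_S -> 'rV[R]_S -> 'M[R]_S)
  (ph : R -> 'rV[R]_n -> 'rV[R]_S -> 'rV[R]_S -> 'rV[R]_S)
  (Psi : nat -> 'rV[R]_S -> 'rV[R]_S) (J : R -> 'I_S -> 'I_S) (m0 : 'rV[R]_S).

Hypotheses (T0 : 0 < T) (q0 : 0 <= q) (lm0 : 0 <= lm) (Pm0 : 0 <= Pm) (psm0 : 0 <= psm).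
Hypotheses (LpsiH0 : 0 < LpsiH) (LQH0 : 0 < LQH) (LPsi0 : 0 < LPsi) (Llam0 : 0 < Llam).
Hypothesis lamP : forall t m k, 0 <= t <= T -> simplex m -> (1 <= k <= n)%N ->
  0 <= lam t m k <= lm.
Hypothesis QhI : forall t u m v, TS T t u -> simplex m -> intensity (Qh t u m v).
Hypothesis QhM : forall t u m v, TS T t u -> simplex m -> mnorm (Qh t u m v) <= q.
Hypothesis phM : forall t u m v, TS T t u -> simplex m -> vnorm (ph t u m v) <= psm.
Hypothesis PsiM : forall k m, (k <= n)%N -> simplex m -> vnorm (Psi k m) <= Pm.
Hypothesis phL : forall t u m1 m2 v1 v2, TS T t u -> simplex m1 -> simplex m2 ->
  vnorm (ph t u m1 v1 - ph t u m2 v2) <= LpsiH * (vnorm (m1 - m2) + vnorm (v1 - v2)).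
Hypothesis QhL : forall t u m1 m2 v1 v2, TS T t u -> simplex m1 -> simplex m2 ->
  mnorm (Qh t u m1 v1 - Qh t u m2 v2) <= LQH * (vnorm (m1 - m2) + vnorm (v1 - v2)).
Hypothesis PsiL : forall k m1 m2, (k <= n)%N -> simplex m1 -> simplex m2 ->
  vnorm (Psi k m1 - Psi k m2) <= LPsi * vnorm (m1 - m2).
Hypothesis lamL : forall t k m1 m2, 0 <= t <= T -> (1 <= k <= n)%N ->
  simplex m1 -> simplex m2 -> `|lam t m1 k - lam t m2 k| <= Llam * vnorm (m1 - m2).
Hypothesis m0S : simplex m0.

Local Notation state := ((R -> 'rV[R]_n -> 'rV[R]_S) * (R -> 'rV[R]_n -> 'rV[R]_S))%type.
Local Notation wsum := (wsum n T lm).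
Local Notation wt := (wt n T lm).
Implicit Types (x y : state) (u : 'rV[R]_n) (s t : R).

Definition rhs_v x s u (i : 'I_S) : R :=
  - ph s u (x.1 s u) (x.2 s u) 0 i
  - \sum_(j < S) Qh s u (x.1 s u) (x.2 s u) i j * x.2 s u 0 j
  - (if (Z u < n)%N then
       lam s (x.1 s u) (Z u).+1 * (x.2 s (uright u s) 0 (J s i) - x.2 s u 0 i)
     else 0).

(* Right-hand side of the equation of [expR (q t) mu(t, u)]: since [Qh + q I] has
   nonnegative entries, its Picard iterates stay in the simplex. *)
Definition rhs_m x s u (i : 'I_S) : R :=
  expR (q * s) * (x.1 s u *m (Qh s u (x.1 s u) (x.2 s u) + q%:M)) 0 i.

Definition init x u : 'rV[R]_S :=
  if Z u == 0%N then m0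
  else x.1 (last_jump u) (uleft u) *m Jmx (J (last_jump u)).

(** Supersolution for the size of [v] itself: rate [q + lm], terminal data [Pm], source [psm]. The
    constant [vm] is its value at [k = 0], [t = 0]. *)
Definition vbound (k : nat) (t : R) : R := wt (q + lm) (Pm + psm * T) k t.
Definition vm : R := (Pm + psm * T) * expR ((q + lm) * T)
  * \sum_(i < n.+1) (expR ((q + lm) * T) * lm * T) ^+ i.
Definition K1 : R := LpsiH + LQH * vm + 2 * vm * Llam.
Definition K2 : R := LpsiH + vm * LQH + q + lm.

Lemma vbound0_ge0 : 0 <= Pm + psm * T.
Proof. by rewrite addr_ge0 // mulr_ge0 // ltW. Qed.

Lemma vbound_le_vm (k : nat) (t : R) : 0 <= t -> vbound k t <= vm.
Proof.
move=> t0; apply: le_trans.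
  by apply: wt_le => //; [exact: addr_ge0 | exact: vbound0_ge0].
by rewrite /vm /wsum subn0 -(mulrA (Pm + _)) [X in _ <= _ * X]mulrC.
Qed.

Lemma vm_ge0 : 0 <= vm.
Proof.
rewrite !mulr_ge0 ?vbound0_ge0 ?expR_ge0 // sumr_ge0 // => i _.
by rewrite exprn_ge0 // !mulr_ge0 ?expR_ge0 // ltW.
Qed.

Lemma TS_time t u : TS T t u -> 0 <= t <= T.
Proof. by case. Qed.

Lemma TS_Z t u : TS T t u -> (Z u <= n)%N.
Proof. by move=> /TS_inU/inUP[]. Qed.

Lemma rhs_v_le x s u i (b b' : R) : TS T s u -> simplex (x.1 s u) ->
  vnorm (x.2 s u) <= b -> 0 <= b' ->
  ((Z u < n)%N -> vnorm (x.2 s (uright u s)) <= b') ->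
  `|rhs_v x s u i| <= psm + (q + lm) * b + lm * b'.
Proof.
move=> su mS xb b'0 xb'.
have b0 : 0 <= b := le_trans (vnorm_ge0 _) xb.
have h1 : `|ph s u (x.1 s u) (x.2 s u) 0 i| <= psm by apply: le_trans (ler_vnorm _ _) (phM _ su mS).
have h2 : `|\sum_(j < S) Qh s u (x.1 s u) (x.2 s u) i j * x.2 s u 0 j| <= q * b.
  apply: le_trans (mnorm_vnorm _ _ _) _; apply: ler_pM; rewrite ?mnorm_ge0 ?vnorm_ge0 //.
  exact: QhM.
have h3 : `|if (Z u < n)%N then
     lam s (x.1 s u) (Z u).+1 * (x.2 s (uright u s) 0 (J s i) - x.2 s u 0 i) else 0|
     <= lm * (b' + b).
  case: ifPn => Zn; last by rewrite normr0 mulr_ge0 // addr_ge0.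
  have /andP[l0 l1] := lamP (k := (Z u).+1) (TS_time su) mS Zn.
  rewrite normrM ger0_norm //; apply: ler_pM => //.
  rewrite (le_trans (ler_normB _ _)) // lerD //.
    by apply: le_trans (ler_vnorm _ _) (xb' Zn).
  by apply: le_trans (ler_vnorm _ _) xb.
rewrite /rhs_v; apply: le_trans (ler_normB _ _) _.
have : `|- ph s u (x.1 s u) (x.2 s u) 0 i -
  \sum_(j < S) Qh s u (x.1 s u) (x.2 s u) i j * x.2 s u 0 j| <= psm + q * b.
  by apply: le_trans (ler_normB _ _) _; rewrite normrN lerD.
rewrite mulrDl; move: h3; rewrite mulrDr; lra.
Qed.

(** Origin of [K1] and [K2]. Products are split so that an undifferenced [v] always belongs to [y],
    and the bound [vm] is asked of [y] alone; the 2 in [K1] comes from the difference of two entries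
    of [v] in the jump term. *)
Lemma rhs_v_lip x y s u i (a b b' : R) : TS T s u ->
  simplex (x.1 s u) -> simplex (y.1 s u) ->
  vnorm (y.2 s u) <= vm -> ((Z u < n)%N -> vnorm (y.2 s (uright u s)) <= vm) ->
  norm1 (x.1 s u - y.1 s u) <= a -> vnorm (x.2 s u - y.2 s u) <= b -> 0 <= b' ->
  ((Z u < n)%N -> vnorm (x.2 s (uright u s) - y.2 s (uright u s)) <= b') ->
  `|rhs_v x s u i - rhs_v y s u i| <= K1 * a + K2 * b + lm * b'.
Proof.
move=> su xS yS yv yv' xya xyb b'0 xyb'.
have a0 : 0 <= a := le_trans (norm1_ge0 _) xya.
have b0 : 0 <= b := le_trans (vnorm_ge0 _) xyb.
have vxya : vnorm (x.1 s u - y.1 s u) <= a := le_trans (vnorm_norm1 _) xya.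
have h1 : `|ph s u (x.1 s u) (x.2 s u) 0 i - ph s u (y.1 s u) (y.2 s u) 0 i| <= LpsiH * (a + b).
  have := ler_vnorm (ph s u (x.1 s u) (x.2 s u) - ph s u (y.1 s u) (y.2 s u)) i.
  rewrite !mxE => /le_trans; apply; apply: le_trans (phL _ _ su xS yS) _.
  by rewrite ler_wpM2l ?lerD // ltW.
have h2 : `|\sum_(j < S) Qh s u (x.1 s u) (x.2 s u) i j * x.2 s u 0 j -
            \sum_(j < S) Qh s u (y.1 s u) (y.2 s u) i j * y.2 s u 0 j|
          <= q * b + LQH * (a + b) * vm.
  have -> : \sum_(j < S) Qh s u (x.1 s u) (x.2 s u) i j * x.2 s u 0 j -
            \sum_(j < S) Qh s u (y.1 s u) (y.2 s u) i j * y.2 s u 0 j =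
     \sum_(j < S) Qh s u (x.1 s u) (x.2 s u) i j * (x.2 s u - y.2 s u) 0 j +
     \sum_(j < S) (Qh s u (x.1 s u) (x.2 s u) - Qh s u (y.1 s u) (y.2 s u)) i j * y.2 s u 0 j.
    rewrite -sumrB -big_split; apply: eq_bigr => j _ /=; rewrite !mxE; ring.
  apply: le_trans (ler_normD _ _) _; apply: lerD.
    apply: le_trans (mnorm_vnorm _ _ _) _; apply: ler_pM; rewrite ?mnorm_ge0 ?vnorm_ge0 //.
    exact: QhM.
  apply: le_trans (mnorm_vnorm _ _ _) _; apply: ler_pM; rewrite ?mnorm_ge0 ?vnorm_ge0 //.
  apply: le_trans (QhL _ _ su xS yS) _.
  by rewrite ler_wpM2l ?lerD // ltW.
have h3 : `|(if (Z u < n)%N then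
     lam s (x.1 s u) (Z u).+1 * (x.2 s (uright u s) 0 (J s i) - x.2 s u 0 i) else 0) -
     (if (Z u < n)%N then
     lam s (y.1 s u) (Z u).+1 * (y.2 s (uright u s) 0 (J s i) - y.2 s u 0 i) else 0)|
     <= lm * (b' + b) + Llam * a * (vm + vm).
  case: ifPn => Zn; last first.
    by rewrite subrr normr0 addr_ge0 ?mulr_ge0 ?addr_ge0 ?vm_ge0 // ltW.
  have /andP[l0 l1] := lamP (k := (Z u).+1) (TS_time su) xS Zn.
  set lx := lam s (x.1 s u) _; set ly := lam s (y.1 s u) _.
  set wx := x.2 s (uright u s) 0 _; set wy := y.2 s (uright u s) 0 _.
  have -> : lx * (wx - x.2 s u 0 i) - ly * (wy - y.2 s u 0 i) =
    lx * ((wx - wy) - (x.2 s u 0 i - y.2 s u 0 i)) + (lx - ly) * (wy - y.2 s u 0 i) by ring.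
  apply: le_trans (ler_normD _ _) _; rewrite !normrM; apply: lerD.
    rewrite (ger0_norm l0); apply: ler_pM => //.
    rewrite (le_trans (ler_normB _ _)) // lerD //.
      have := ler_vnorm (x.2 s (uright u s) - y.2 s (uright u s)) (J s i).
      by rewrite !mxE => /le_trans; apply; exact: xyb'.
    by have := ler_vnorm (x.2 s u - y.2 s u) i; rewrite !mxE => /le_trans; apply.
  apply: ler_pM => //.
    by apply: le_trans (lamL (k := (Z u).+1) (TS_time su) Zn xS yS) _; rewrite ler_wpM2l // ltW.
  rewrite (le_trans (ler_normB _ _)) // lerD //.
    by apply: le_trans (ler_vnorm _ _) (yv' Zn).
  by apply: le_trans (ler_vnorm _ _) yv.
rewrite /rhs_v.
move: h1 h2 h3.
set p1 := ph _ _ _ _ 0 i; set p2 := ph _ _ (y.1 s u) _ 0 i.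
set s1 := \sum_(j < S) _; set s2 := \sum_(j < S) _; set c1 := if _ then _ else _.
set c2 := if _ then _ else _ => h1 h2 h3.
have -> : - p1 - s1 - c1 - (- p2 - s2 - c2) = - ((p1 - p2) + (s1 - s2) + (c1 - c2)) by ring.
rewrite normrN; apply: le_trans (ler_normD _ _) _.
apply: (@le_trans _ _ (LpsiH * (a + b) + (q * b + LQH * (a + b) * vm)
  + (lm * (b' + b) + Llam * a * (vm + vm)))).
  by apply: lerD => //; apply: le_trans (ler_normD _ _) _; apply: lerD.
rewrite /K1 /K2 le_eqVlt; apply/orP; left; apply/eqP; ring.
Qed.

Lemma rhs_m_ge0 x s u i : TS T s u -> simplex (x.1 s u) -> 0 <= rhs_m x s u i.
Proof.
move=> su xS; rewrite mulr_ge0 ?expR_ge0 // mxE sumr_ge0 // => j _.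
rewrite mulr_ge0 //; first by case: xS.
by apply: intensity_shift_ge0; [exact: QhI | exact: QhM].
Qed.

(** The row sums [q] make the total mass of [expR (q t) mu] grow exactly like [expR (q t)], so that
    [mu] keeps mass 1. *)
Lemma rhs_m_sum x s u : TS T s u -> simplex (x.1 s u) ->
  \sum_(i < S) rhs_m x s u i = q * expR (q * s).
Proof.
move=> su xS; rewrite -mulr_sumr mulrC; congr (_ * _).
under eq_bigr do rewrite mxE.
rewrite exchange_big /= -[RHS]mul1r -(proj2 xS) mulr_suml; apply: eq_bigr => j _.
by rewrite -mulr_sumr intensity_shift_row //; exact: QhI.
Qed.

(** The difference splits into that of the measures, moved by a nonnegative matrix with row sums
    [q], and that of the matrices, applied to a vector of l1 norm 1. *)
Lemma rhs_m_lip x y s u (a b : R) : TS T s u -> simplex (x.1 s u) -> simplex (y.1 s u) ->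
  norm1 (x.1 s u - y.1 s u) <= a -> vnorm (x.2 s u - y.2 s u) <= b ->
  \sum_(i < S) `|rhs_m x s u i - rhs_m y s u i| <= expR (q * s) * ((q + LQH) * a + LQH * b).
Proof.
move=> su xS yS xya xyb.
set A := Qh s u (x.1 s u) (x.2 s u); set B := Qh s u (y.1 s u) (y.2 s u).
have E : x.1 s u *m (A + q%:M) - y.1 s u *m (B + q%:M) =
    (x.1 s u - y.1 s u) *m (A + q%:M) + y.1 s u *m (A - B).
  rewrite mulmxBl !mulmxDr mulmxN.
  move: (x.1 s u *m A) (x.1 s u *m q%:M) (y.1 s u *m A) (y.1 s u *m B) (y.1 s u *m q%:M).
  by move=> a1 a2 a3 a4 a5; apply/rowP => i; rewrite !mxE; ring.
apply: (@le_trans _ _ (expR (q * s) * norm1 (x.1 s u *m (A + q%:M) - y.1 s u *m (B + q%:M)))).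
  rewrite /norm1 mulr_sumr; apply: ler_sum => i _; rewrite /rhs_m -/A -/B -mulrBr normrM.
  by rewrite ger0_norm ?expR_ge0 // !mxE.
rewrite ler_wpM2l ?expR_ge0 // E.
apply: (@le_trans _ _ (norm1 ((x.1 s u - y.1 s u) *m (A + q%:M)) + norm1 (y.1 s u *m (A - B)))).
  by rewrite /norm1 -big_split; apply: ler_sum => i _; rewrite !mxE; exact: ler_normD.
have h1 : norm1 ((x.1 s u - y.1 s u) *m (A + q%:M)) <= a * q.
  apply: (@le_trans _ _ (norm1 (x.1 s u - y.1 s u) * q)); last by rewrite ler_wpM2r.
  apply: norm1_mulmx => j; rewrite -[leRHS](intensity_shift_row q (QhI (x.2 s u) su xS) j).
  apply: ler_sum => i _; rewrite ger0_norm //.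
  by apply: intensity_shift_ge0; [exact: QhI | exact: QhM].
have h2 : norm1 (y.1 s u *m (A - B)) <= LQH * (a + b).
  apply: (@le_trans _ _ (norm1 (y.1 s u) * mnorm (A - B))).
    by apply: norm1_mulmx => j; exact: ler_mnorm.
  rewrite simplex_norm1 // mul1r; apply: le_trans (QhL _ _ su xS yS) _.
  rewrite ler_wpM2l ?lerD //; first exact: ltW.
  exact: le_trans (vnorm_norm1 _) xya.
rewrite mulrDl; move: h2; rewrite mulrDr (mulrC q); move: h1; lra.
Qed.

(** * Admissible pairs and the Picard relation *)

Definition adm x : Prop := forall t u, TS T t u ->
  simplex (x.1 t u) /\ vnorm (x.2 t u) <= vbound (Z u) t.

(** A relation rather than a map: it says that [y] results from [x] by one Picard iteration, without
    any measurability. Hence [step x x] can hold for an arbitrary solution, and existence and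
    uniqueness share the same estimates. *)
Definition step x y : Prop := forall u, inU T u ->
  [/\ forall i, prim_on (last_jump u) T (fun t => y.2 t u 0 i) (fun s => rhs_v x s u i),
      forall i, prim_on (last_jump u) T (fun t => expR (q * t) * y.1 t u 0 i)
                  (fun s => rhs_m x s u i),
      y.2 T u = Psi (Z u) (x.1 T u)
    & y.1 (last_jump u) u = init x u].

Lemma init_simplex x u : adm x -> inU T u -> simplex (init x u).
Proof.
move=> ax uU; rewrite /init; case: eqVneq => // Z0; apply: simplex_Jmx.
by have [] := ax _ _ (TS_uleft T0 uU ltac:(by rewrite lt0n)).
Qed.

Lemma TS_between u s : inU T u -> last_jump u <= s <= T -> TS T s u.
Proof. by move=> uU h; apply/TSP. Qed.

Lemma step_adm x y : adm x -> step x y -> adm y.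
Proof.
move=> ax xy t u tu; have uU := TS_inU tu.
have [ut tT] : last_jump u <= t /\ t <= T by have /TSP[_ /andP] := tu.
have inTS s : last_jump u < s < t -> TS T s u.
  by move=> /andP[h1 h2]; apply: TS_between => //; rewrite !ltW // (lt_le_trans h2).
have [pv pm yT yi] := xy u uU.
have [i0 i1] := init_simplex ax uU.
split; first split.
- move=> i.
  have := prim_on_le ut (prim_onN (prim_onW (lexx _) tT (pm i))) (prim_on_cst _ _ 0).
  rewrite subrr => h; have {}h : expR (q * last_jump u) * y.1 (last_jump u) u 0 i
      <= expR (q * t) * y.1 t u 0 i.
    rewrite -subr_le0; move: h; rewrite opprK addrC; apply => s /inTS su.
    by rewrite oppr_le0 rhs_m_ge0 //; have [] := ax _ _ su.
  by rewrite -(pmulr_rge0 _ (expR_gt0 (q * t))) (le_trans _ h) // yi mulr_ge0 ?expR_ge0.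
- have ps := prim_onW (lexx _) tT (prim_on_sum pm).
  have rs s : last_jump u < s < t -> \sum_(i < S) rhs_m x s u i = q * expR (q * s).
    by move=> /inTS su; rewrite rhs_m_sum //; have [] := ax _ _ su.
  have h1 := prim_on_le ut ps (prim_on_expRM _ _ q)
    (fun s hs => eq_ind_r (fun z => z <= _) (lexx _) (rs s hs)).
  have h2 := prim_on_le ut (prim_on_expRM _ _ q) ps
    (fun s hs => eq_ind_r (fun z => _ <= z) (lexx _) (rs s hs)).
  move: h1 h2; rewrite -!mulr_sumr yi i1 mulr1.
  set E := expR (q * t) => h1 h2; have E0 : E != 0 by rewrite gt_eqF // expR_gt0.
  by apply: (mulfI E0); rewrite mulr1; lra.
- apply: vnorm_leP => [|i]; first by rewrite wt_ge0 // vbound0_ge0.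
  have [lv dv] := prim_onW ut (lexx T) (pv i).
  have /andP[t0 _] := TS_time tu.
  (* The case [D' = D] of [wt_backward]: the bound reproduces itself, without gain. *)
  rewrite -[leRHS]subr0 -(subrr (Pm + psm * T)).
  apply: (wt_backward (d := psm) (e := Pm) _ _ _ _ _ _ _ _ (lip_on_ac_on lv) dv) => //.
  + exact: addr_ge0.
  + exact: vbound0_ge0.
  + exact: TS_Z tu.
  + move=> s /andP[ts sT].
    have su : TS T s u by apply: TS_between; rewrite // (le_trans ut) ltW.
    have [xS xv] := ax _ _ su.
    apply: rhs_v_le => //; first by rewrite wt_ge0 // vbound0_ge0.
    move=> Zn; have [_ <-] := inU_uright su Zn.
    by have [] := ax _ _ (TS_uright su Zn).
  + rewrite yT; apply: le_trans (ler_vnorm _ _) (PsiM (TS_Z tu) _).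
    by have [] := ax _ _ (TS_T T0 uU).
Qed.

(** * Weights and constants of the contraction *)

Definition kap : R := LQH * T * (n.+1%:R * expR ((q + LQH) * T)) * (LPsi + K1 * T)
  * expR (K2 * T) * wsum K2 0.
(* [rho > 1] and [rho ^ 2 kap <= 1]: the slack in [kap < 1] is shared equally between the
   forward and the backward estimate. *)
Definition rho : R := 2 / (1 + kap).
Definition bbar : R := wsum K2 0 * expR (K2 * T).
Definition Da : R := rho * LQH * T * expR (q * T) * bbar.
(** [k.+1] counts the intervals between jumps, the current one included. The rate is [LQH] alone,
    because [q] is carried by the factor [expR (q t)] of the quantity that is estimated. *)
Definition al (k : nat) (t : R) : R := k.+1%:R * Da * expR (LQH * t).
Definition be (k : nat) (t : R) : R := wt K2 1 k t.
Definition abar : R := n.+1%:R * Da * expR (LQH * T).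
(** The absolute gains [1 - rho^-1] for [v] and [Da * (1 - rho^-1)] for [expR (q t) mu] become one
    relative gain after division by upper bounds of the weights. *)
Definition dlt : R := (1 - rho^-1) / (bbar * (n.+1%:R * expR ((q + LQH) * T))).

Hypothesis small : kap < 1.

Let LpsiH_ge0 : 0 <= LpsiH := ltW LpsiH0.
Let LQH_ge0 : 0 <= LQH := ltW LQH0.
Let LPsi_ge0 : 0 <= LPsi := ltW LPsi0.
Let Llam_ge0 : 0 <= Llam := ltW Llam0.
Let T_ge0 : 0 <= T := ltW T0.

Lemma K1_ge0 : 0 <= K1.
Proof.
rewrite /K1; move: vm_ge0; move: vm => w w0.
by rewrite !(addr_ge0, mulr_ge0).
Qed.

Lemma K2_ge0 : 0 <= K2.
Proof.
rewrite /K2; move: vm_ge0; move: vm => w w0.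
by rewrite !(addr_ge0, mulr_ge0).
Qed.

Lemma kap_ge0 : 0 <= kap.
Proof.
rewrite /kap; move: K1_ge0 (wsum_ge0 n T0 lm0 K2 0); move: K1 (wsum K2 0) => k w k0 w0.
by rewrite !(mulr_ge0, addr_ge0, expR_ge0).
Qed.

Lemma rho_gt0 : 0 < rho.
Proof. by rewrite divr_gt0 // ltr_wpDr // kap_ge0. Qed.

Lemma rhoV_lt1 : rho^-1 < 1.
Proof. by rewrite /rho invf_div ltr_pdivrMr // mul1r; move: small; lra. Qed.

Lemma bbar_ge1 : 1 <= bbar.
Proof.
rewrite /bbar -[1]mulr1 ler_pM ?wsum_ge1 // -expR0 ler_expR mulr_ge0 ?K2_ge0 // ltW //.
Qed.

Lemma Da_gt0 : 0 < Da.
Proof.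
rewrite /Da; move: (lt_le_trans ltr01 bbar_ge1) rho_gt0; move: bbar rho => b r b0 r0.
by rewrite !mulr_gt0 ?expR_gt0.
Qed.

Lemma al_gt0 k t : 0 < al k t.
Proof. by rewrite /al; move: Da_gt0; move: Da => D D0; rewrite !mulr_gt0 ?expR_gt0. Qed.

Lemma be_ge1 k t : (k <= n)%N -> t <= T -> 1 <= be k t.
Proof. by move=> kn tT; apply: wt_ge => //; exact: K2_ge0. Qed.

Lemma be_le k t : 0 <= t -> be k t <= bbar.
Proof. by move=> t0; rewrite -[bbar]mul1r; apply: wt_le => //; exact: K2_ge0. Qed.

Lemma al_le k t : (k <= n)%N -> t <= T -> al k t <= abar.
Proof.
move=> kn tT; rewrite /al /abar; move: Da_gt0; move: Da => D Da0.
rewrite /al /abar ler_pM ?mulr_ge0 ?expR_ge0 ?(ltW Da0) //.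
  by rewrite ler_pM2r // ler_nat.
by rewrite ler_expR ler_wpM2l // ltW.
Qed.

(** The left side is [rho * kap], and [rho ^ 2 * kap <= 1] amounts to [4 * kap <= (1 + kap) ^ 2]. *)
Lemma abar_small : (LPsi + K1 * T) * abar <= rho^-1.
Proof.
have -> : (LPsi + K1 * T) * abar = rho * kap.
  by rewrite /abar /Da /kap /bbar (mulrDl q) expRD; ring.
rewrite /rho invf_div mulrAC ler_pdivrMr; last by rewrite ltr_wpDr // kap_ge0.
by rewrite mulrAC ler_pdivlMr //; have := sqr_ge0 (1 - kap); nra.
Qed.

Lemma dlt_gt0 : 0 < dlt.
Proof.
rewrite /dlt; move: (lt_le_trans ltr01 bbar_ge1) rhoV_lt1; move: bbar rho^-1 => b r b0 r1.
by rewrite divr_gt0 ?subr_gt0 ?mulr_gt0 ?expR_gt0.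
Qed.

Let growth_ge1 : 1 <= n.+1%:R * expR ((q + LQH) * T).
Proof.
rewrite -[leLHS]mulr1 ler_pM ?ler1n //.
by rewrite -[leLHS]expR0 ler_expR mulr_ge0 // addr_ge0.
Qed.

Lemma dlt_le1 : dlt <= 1.
Proof.
rewrite /dlt ler_pdivrMr ?mul1r; last first.
  by move: (lt_le_trans ltr01 bbar_ge1); move: bbar => b b0; rewrite !mulr_gt0 ?expR_gt0.
apply: (@le_trans _ _ 1); first by rewrite lerBlDr lerDl invr_ge0 ltW // rho_gt0.
by rewrite -[leLHS]mulr1 ler_pM ?bbar_ge1 ?growth_ge1.
Qed.

Lemma dlt_be k t : 0 <= t -> dlt * be k t <= 1 - rho^-1.
Proof.
move=> t0; apply: (@le_trans _ _ (dlt * bbar)).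
  by rewrite ler_wpM2l ?be_le // ltW // dlt_gt0.
have -> : dlt * bbar = (1 - rho^-1) * (n.+1%:R * expR ((q + LQH) * T))^-1.
  have := lt_le_trans ltr01 bbar_ge1; have := lt_le_trans ltr01 growth_ge1; rewrite /dlt.
  move: bbar (n.+1%:R * _) rho^-1 => b g r g0 b0; field; by rewrite !gt_eqF.
rewrite ler_piMr ?subr_ge0 ?(ltW rhoV_lt1) // invf_le1; last by rewrite mulr_gt0 ?expR_gt0.
exact: growth_ge1.
Qed.

Lemma dlt_al k t : (k <= n)%N -> 0 <= t -> t <= T ->
  dlt * (expR (q * t) * al k t) <= Da * (1 - rho^-1).
Proof.
move=> kn t0 tT; apply: (@le_trans _ _ (dlt * (Da * (n.+1%:R * expR ((q + LQH) * T))))).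
  rewrite ler_wpM2l ?(ltW dlt_gt0) // (mulrDl q) expRD.
  have -> : Da * (n.+1%:R * (expR (q * T) * expR (LQH * T))) = expR (q * T) * abar.
    by rewrite /abar; ring.
  by rewrite ler_pM ?expR_ge0 ?(ltW (al_gt0 _ _)) ?al_le // ler_expR ler_wpM2l.
rewrite mulrCA ler_wpM2l ?(ltW Da_gt0) //.
have -> : dlt * (n.+1%:R * expR ((q + LQH) * T)) = (1 - rho^-1) * bbar^-1.
  have := lt_le_trans ltr01 bbar_ge1; have := lt_le_trans ltr01 growth_ge1; rewrite /dlt.
  move: bbar (n.+1%:R * _) rho^-1 => b g r g0 b0; field; by rewrite !gt_eqF.
by rewrite ler_piMr ?subr_ge0 ?(ltW rhoV_lt1) // invf_le1 ?bbar_ge1 // (lt_le_trans ltr01 bbar_ge1).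
Qed.

(** * The contraction estimate *)

Definition close (C : R) x y : Prop := forall t u, TS T t u ->
  norm1 (x.1 t u - y.1 t u) <= C * al (Z u) t /\
  vnorm (x.2 t u - y.2 t u) <= C * be (Z u) t.

(** [wt_backward] with [D = C] and [D' = C * rho^-1]: the error in [mu] enters through its uniform
    bound [C * abar], whose total effect [abar_small] limits to [D']. *)
Lemma step_close_v C x x' y y' : 0 <= C -> adm x -> adm x' -> step x y -> step x' y' ->
  close C x x' -> forall t u, TS T t u ->
  vnorm (y.2 t u - y'.2 t u) <= (1 - dlt) * C * be (Z u) t.
Proof.
move=> C0 ax ax' xy xy' xx' t u tu; have uU := TS_inU tu.
have [ut tT] : last_jump u <= t /\ t <= T by have /TSP[_ /andP] := tu.
have /andP[t0 _] := TS_time tu.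
have [pv _ yT _] := xy u uU; have [pv' _ yT' _] := xy' u uU.
have be0 : 0 <= be (Z u) t by apply: wt_ge0.
apply: vnorm_leP => [|i].
  by rewrite mulr_ge0 // mulr_ge0 // subr_ge0 dlt_le1.
rewrite !mxE.
have CbeE k s : C * be k s = wt K2 C k s by rewrite -[in RHS](mulr1 C) wtM.
apply: (@le_trans _ _ (wt K2 C (Z u) t - (C - C * rho^-1))); last first.
  rewrite -CbeE mulrBl mul1r mulrBl lerD2l lerN2 [dlt * C]mulrC -mulrA.
  rewrite -[X in _ <= X - _]mulr1 -mulrBr.
  by rewrite ler_wpM2l // dlt_be.
have [lv dv] := prim_onW ut (lexx T) (prim_onD (pv i) (prim_onN (pv' i))).
have abar0 : 0 <= C * abar.
  by rewrite mulr_ge0 // (le_trans (ltW (al_gt0 (Z u) t))) // al_le // (TS_Z tu).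
apply: (wt_backward (d := K1 * (C * abar)) (e := LPsi * (C * abar)) _ _ _ _ _ _ _ _
  (lip_on_ac_on lv) dv) => //.
- exact: K2_ge0.
- by rewrite mulr_ge0 // K1_ge0.
- exact: TS_Z tu.
- move=> s /andP[ts sT].
  have su : TS T s u by apply: TS_between; rewrite // (le_trans ut) ltW.
  have [xS xv] := ax _ _ su; have [xS' xv'] := ax' _ _ su.
  have [xm xxv] := xx' _ _ su; have /andP[s0 _] := TS_time su.
  apply: rhs_v_lip => //.
  + exact: le_trans xv' (vbound_le_vm _ s0).
  + move=> Zn; have [_ h] := ax' _ _ (TS_uright su Zn).
    exact: le_trans h (vbound_le_vm _ s0).
  + by apply: le_trans xm _; rewrite ler_wpM2l // al_le ?(TS_Z su) // ltW.
  + by rewrite -CbeE.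
  + exact: wt_ge0.
  + move=> Zn; have [_ <-] := inU_uright su Zn; rewrite -CbeE.
    by have [] := xx' _ _ (TS_uright su Zn).
- have TU := TS_T T0 uU; rewrite yT yT'.
  have := ler_vnorm (Psi (Z u) (x.1 T u) - Psi (Z u) (x'.1 T u)) i.
  rewrite !mxE => /le_trans; apply.
  apply: le_trans (PsiL (TS_Z tu) _ _) _; [by have [] := ax _ _ TU | by have [] := ax' _ _ TU |].
  rewrite ler_wpM2l //; apply: le_trans (vnorm_norm1 _) _; have [h _] := xx' _ _ TU.
  by apply: le_trans h _; rewrite ler_wpM2l // al_le // (TS_Z tu).
- have -> : LPsi * (C * abar) + K1 * (C * abar) * T = C * ((LPsi + K1 * T) * abar) by ring.
  by rewrite ler_wpM2l // abar_small.
Qed.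

(** A Gronwall estimate for [expR (q t) mu] on one interval between jumps, starting from the error
    of the previous interval. The weight grows at the rate [q + LQH] of the error, and the error in
    [v] acts as a constant source. *)
Lemma step_close_m C x x' y y' : 0 <= C -> adm x -> adm x' -> step x y -> step x' y' ->
  close C x x' -> forall t u, TS T t u ->
  norm1 (y.1 t u - y'.1 t u) <= (1 - dlt) * C * al (Z u) t.
Proof.
move=> C0 ax ax' xy xy' xx' t u tu; have uU := TS_inU tu.
have [ut tT] : last_jump u <= t /\ t <= T by have /TSP[_ /andP] := tu.
have /andP[t0 _] := TS_time tu.
have [_ pm _ yi] := xy u uU; have [_ pm' _ yi'] := xy' u uU.
have inTS s : last_jump u < s < t -> TS T s u.
  by move=> /andP[h1 h2]; apply: TS_between => //; rewrite !ltW // (lt_le_trans h2).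
set k := Z u.
(* Signs frozen at the final time [t] turn the l1 norm at [t] into a linear functional, which has a
   derivative a.e. along the interval and is at most the l1 norm at its start. *)
pose sg (i : 'I_S) := Num.sg ((y.1 t u - y'.1 t u) 0 i).
pose c := q + LQH.
have pf := prim_onW (lexx _) tT
  (prim_on_sum (fun i => prim_onZ (sg i) (prim_onD (pm i) (prim_onN (pm' i))))).
have pg : prim_on (last_jump u) t
    (fun s => (C * k.+1%:R * Da) * expR (c * s) + (LQH * (C * bbar) * expR (q * T)) * s)
    (fun s => (C * k.+1%:R * Da) * (c * expR (c * s)) + (LQH * (C * bbar) * expR (q * T)) * 1).
  by apply: prim_onD; apply: prim_onZ; [exact: prim_on_expRM | exact: prim_on_id].
have sg1 i : `|sg i| <= 1 by rewrite normr_sg; case: (_ == _).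
have hle : forall s, last_jump u < s < t ->
    \sum_(i < S) sg i * (rhs_m x s u i + - rhs_m x' s u i) <=
    (C * k.+1%:R * Da) * (c * expR (c * s)) + (LQH * (C * bbar) * expR (q * T)) * 1.
  move=> s hs; have su := inTS s hs; have /andP[s0 sT] := TS_time su.
  have [xS _] := ax _ _ su; have [xS' _] := ax' _ _ su; have [xm xv] := xx' _ _ su.
  apply: (@le_trans _ _ (\sum_(i < S) `|rhs_m x s u i - rhs_m x' s u i|)).
    apply: ler_sum => i _; apply: le_trans (ler_norm _) _; rewrite normrM.
    by rewrite ler_piMl.
  apply: le_trans (rhs_m_lip su xS xS' xm xv) _; rewrite -/k mulrDr; apply: lerD.
    rewrite /al /c (mulrDl q LQH s) expRD le_eqVlt; apply/orP; left; apply/eqP; ring.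
  rewrite mulr1 mulrC; apply: ler_pM.
  - by apply: mulr_ge0 => //; apply: mulr_ge0 => //; exact: wt_ge0.
  - exact: expR_ge0.
  - by rewrite ler_wpM2l // ler_wpM2l // be_le.
  - by rewrite ler_expR ler_wpM2l.
have {hle} h := prim_on_le ut pf pg hle.
pose D s := y.1 s u - y'.1 s u.
have Et : \sum_(i < S) sg i * (expR (q * t) * y.1 t u 0 i + - (expR (q * t) * y'.1 t u 0 i))
    = expR (q * t) * norm1 (D t).
  rewrite /norm1 mulr_sumr; apply: eq_bigr => i _.
  by rewrite normrEsg !mxE /sg !mxE; ring.
have E0 : \sum_(i < S) sg i * (expR (q * last_jump u) * y.1 (last_jump u) u 0 i +
      - (expR (q * last_jump u) * y'.1 (last_jump u) u 0 i))
    <= expR (q * last_jump u) * norm1 (D (last_jump u)).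
  rewrite /norm1 mulr_sumr; apply: ler_sum => i _.
  rewrite !mxE -mulrBr mulrCA ler_wpM2l ?expR_ge0 // (le_trans (ler_norm _)) // normrM.
  by rewrite ler_piMl.
(* [uleft u] has [k.-1] jumps, hence the factor [k] in its weight; without jumps both pairs start at
   [m0], in agreement with [k = 0]. *)
have Di : norm1 (D (last_jump u)) <= C * (k%:R * Da * expR (LQH * last_jump u)).
  rewrite /D yi yi' /init /k; case: eqVneq => [->|Z0].
    rewrite subrr mul0r mul0r mulr0 /norm1 big1 // => i _; rewrite mxE normr0 //.
  rewrite -lt0n in Z0; rewrite -mulmxBl; apply: le_trans (norm1_Jmx _ _) _.
  have [h' _] := xx' _ _ (TS_uleft T0 uU Z0); apply: le_trans h' _.
  by have [_ ->] := inU_uleft uU Z0; rewrite /al (ltn_predK Z0).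
rewrite Et in h.
set E := expR (c * last_jump u) in h.
have EE : expR (q * last_jump u) * expR (LQH * last_jump u) = E.
  by rewrite -expRD -mulrDl.
have E1 : 1 <= E by rewrite -expR0 ler_expR mulr_ge0 ?last_jump_ge0 // addr_ge0.
have h0 : expR (q * last_jump u) * norm1 (D (last_jump u)) <= C * k%:R * Da * E.
  apply: (@le_trans _ _ (expR (q * last_jump u) * (C * (k%:R * Da * expR (LQH * last_jump u))))).
    by rewrite ler_wpM2l // expR_ge0.
  by rewrite -EE le_eqVlt; apply/orP; left; apply/eqP; ring.
have hT : LQH * (C * bbar) * expR (q * T) * (t - last_jump u) <= C * (Da * rho^-1).
  apply: (@le_trans _ _ (LQH * (C * bbar) * expR (q * T) * T)).
    rewrite ler_wpM2l; first by [].
      by move: (le_trans ler01 bbar_ge1); move: bbar => b b0; rewrite !(mulr_ge0, expR_ge0).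
    by rewrite lerBlDr (le_trans tT) // lerDl last_jump_ge0.
  have rho0 : rho != 0 by rewrite gt_eqF // rho_gt0.
  have -> : Da * rho^-1 = LQH * T * expR (q * T) * bbar.
    rewrite /Da; move: bbar => b; field; exact: rho0.
  by rewrite le_eqVlt; apply/orP; left; apply/eqP; ring.
have aE : expR (q * t) * al k t = k.+1%:R * Da * expR (c * t).
  by rewrite /al /c (mulrDl q LQH t) expRD; ring.
have key : expR (q * t) * norm1 (D t) <= C * (expR (q * t) * al k t - Da * (1 - rho^-1)).
  have kS : (k.+1%:R : R) = k%:R + 1 by rewrite -natr1.
  have CD : C * Da * 1 <= C * Da * E by rewrite ler_wpM2l // mulr_ge0 // ltW // Da_gt0.
  rewrite aE kS; rewrite kS in h.
  exact: (forward_gain h E0 h0 hT CD).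
rewrite -(ler_pM2l (expR_gt0 (q * t))); apply: le_trans key _.
have -> : expR (q * t) * ((1 - dlt) * C * al k t) =
  C * (expR (q * t) * al k t - dlt * (expR (q * t) * al k t)) by ring.
by rewrite ler_wpM2l // lerD2l lerN2 dlt_al // (TS_Z tu).
Qed.

Lemma step_close C x x' y y' : 0 <= C -> adm x -> adm x' -> step x y -> step x' y' ->
  close C x x' -> close ((1 - dlt) * C) y y'.
Proof.
move=> C0 ax ax' xy xy' xx' t u tu; split.
  exact: (step_close_m C0 ax ax' xy xy' xx' tu).
exact: (step_close_v C0 ax ax' xy xy' xx' tu).
Qed.

(** * Solutions as fixed points, and uniqueness *)

Definition is_sol x : Prop :=
  [/\ forall t u, TS T t u -> simplex (x.1 t u),
      forall u, inU T u -> abs_cont_on (fun t => TS T t u) (fun t => x.1 t u)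
           /\ abs_cont_on (fun t => TS T t u) (fun t => x.2 t u),
      forall u, inU T u -> {ae (@lebesgue_measure R), forall t, TS T t u -> forall i : 'I_S,
            is_derive t (1 : R) (fun s => x.2 s u 0 i) (rhs_v x t u i)},
      forall u, inU T u -> {ae (@lebesgue_measure R), forall t, TS T t u -> forall i : 'I_S,
            is_derive t (1 : R) (fun s => x.1 s u 0 i)
              (\sum_(j < S) x.1 t u 0 j * Qh t u (x.1 t u) (x.2 t u) j i)}
    & [/\ forall u, inU T u -> x.2 T u = Psi (Z u) (x.1 T u),
          x.1 0 (@u0 R n) = m0
        & forall u (i : 'I_n), inU T u -> (i.+1 = Z u)%N ->
           x.1 (u 0 i) u = x.1 (u 0 i) (uleft u) *m Jmx (J (u 0 i))]].

Lemma TS_open_between u t : inU T u -> last_jump u < t < T -> TS T t u.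
Proof. by move=> uU /andP[h1 h2]; apply: TS_between; rewrite // !ltW. Qed.

(** At first only some bound depending on [u] is known. Inserting a bound of amplitude [D] into the
    equation improves the amplitude to [D0 + (D - D0) * (1 - W^-1)], and iterating brings it down to
    [D0]. The jump term has to be bounded beforehand, as nothing is known uniformly over the vectors
    [uright u t]. *)
Lemma sol_vbound_jump x u : is_sol x -> inU T u ->
  (forall t, TS T t u -> (Z u < n)%N -> vnorm (x.2 t (uright u t)) <= vbound (Z u).+1 t) ->
  forall t, TS T t u -> vnorm (x.2 t u) <= vbound (Z u) t.
Proof.
move=> [xS xac xv _ [xT _ _]] uU xr.
pose c := q + lm; pose D0 := Pm + psm * T; set k := Z u.
have c0 : 0 <= c by exact: addr_ge0.
have D00 : 0 <= D0 := vbound0_ge0.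
have kn : (k <= n)%N := TS_Z (TS_T T0 uU).
have ac i : ac_on (last_jump u) T (fun t => x.2 t u 0 i).
  apply: abs_cont_on_coord (xac u uU).2 => t h1 h2; apply: TS_between => //.
  by rewrite h1.
have dv i : {ae (@lebesgue_measure R), forall t, last_jump u < t < T ->
    is_derive t 1 (fun s => x.2 s u 0 i) (rhs_v x t u i)}.
  by apply: filterS (xv u uU) => t h ht; apply: h; exact: TS_open_between.
(* Upper bound of the weight of amplitude 1; it turns the absolute gain [D - D0] into a relative
   one. *)
pose W := wsum c 0 * expR (c * T).
have W1 : 1 <= W.
  by rewrite -[leLHS]mulr1 ler_pM ?wsum_ge1 // -[leLHS]expR0 ler_expR mulr_ge0.
have W0 : 0 < W := lt_le_trans ltr01 W1.
have improve D : D0 <= D -> (forall t, TS T t u -> vnorm (x.2 t u) <= wt c D k t) ->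
    forall t, TS T t u -> vnorm (x.2 t u) <= wt c (D0 + (D - D0) * (1 - W^-1)) k t.
  move=> D0D xD t tu; have DD : 0 <= D := le_trans D00 D0D.
  have [ut tT] : last_jump u <= t /\ t <= T by have /TSP[_ /andP] := tu.
  have /andP[t0 _] := TS_time tu.
  have V1 : W^-1 <= 1 by rewrite invf_le1.
  apply: vnorm_leP => [|i].
    by rewrite wt_ge0 // addr_ge0 // mulr_ge0 // subr_ge0.
  apply: (@le_trans _ _ (wt c D k t - (D - D0))); last first.
    have -> : D0 + (D - D0) * (1 - W^-1) = D - (D - D0) * W^-1 by ring.
    rewrite wtB lerD2l lerN2 -[X in wt c X]mulr1 wtM -mulrA ler_piMr ?subr_ge0 //.
    by rewrite mulrC ler_pdivrMr // mul1r -[W]mul1r wt_le.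
  apply: (wt_backward (d := psm) (e := Pm) _ _ _ _ _ _ _ (f' := fun s => rhs_v x s u i)
    (f := fun s => x.2 s u 0 i)) => //.
  - exact: ac_onW (ac i).
  - by apply: filterS (dv i) => s h /andP[ts sT]; apply: h; rewrite (le_lt_trans ut).
  - move=> s /andP[ts sT].
    have su : TS T s u by apply: TS_between; rewrite // (le_trans ut) ltW.
    apply: rhs_v_le => //; [exact: xS | exact: xD | exact: wt_ge0 |].
    move=> Zn; apply: le_trans (xr s su Zn) _.
    by rewrite /vbound /wt -!mulrA ler_wpM2r // mulr_ge0 ?wsum_ge0 ?expR_ge0.
  - by rewrite xT //; apply: le_trans (ler_vnorm _ _) (PsiM kn (xS _ _ (TS_T T0 uU))).
have [B B0 BP] : exists2 B : R, 0 <= B & forall t, TS T t u -> vnorm (x.2 t u) <= B.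
  have h i : exists B : R, 0 <= B /\ forall t, last_jump u <= t -> t <= T -> `|x.2 t u 0 i| <= B.
    by have [B ? ?] := ac_on_bounded (ac i); exists B.
  have [F FP] := fin_all_exists h.
  exists (\sum_i F i) => [|t tu]; first by apply: sumr_ge0 => i _; have [] := FP i.
  have /TSP[_ /andP[h1 h2]] := tu.
  apply: le_trans (vnorm_norm1 _) _; apply: ler_sum => i _; have [_] := FP i; exact.
pose r := 1 - W^-1.
have r0 : 0 <= r by rewrite subr_ge0 invf_le1.
have r1 : r < 1 by rewrite ltrBlDr ltrDl invr_gt0.
have iter j t : TS T t u -> vnorm (x.2 t u) <= wt c (D0 + B * r ^+ j) k t.
  elim: j t => [|j IH] t tu.
    rewrite expr0 mulr1; apply: le_trans (BP t tu) _; have /andP[_ tT] := TS_time tu.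
    apply: (@le_trans _ _ (D0 + B)); first by rewrite lerDr.
    by apply: wt_ge => //; exact: addr_ge0.
  have -> : D0 + B * r ^+ j.+1 = D0 + (D0 + B * r ^+ j - D0) * (1 - W^-1).
    by rewrite exprSr -/r; ring.
  apply: improve => //.
  by rewrite lerDl mulr_ge0 // exprn_ge0.
move=> t tu; apply: (le_geometric r0 r1 (K := B * wt c 1 k t)) => j.
apply: le_trans (iter j t tu) _; rewrite /vbound -/c -/D0 /wt.
by rewrite le_eqVlt; apply/orP; left; apply/eqP; ring.
Qed.

Lemma sol_adm x : is_sol x -> adm x.
Proof.
move=> xs; have [xS _ _ _ _] := xs.
suff h : forall j t u, TS T t u -> (n - Z u)%N = j -> vnorm (x.2 t u) <= vbound (Z u) t.
  by move=> t u tu; split; [exact: xS | exact: h tu erefl].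
elim => [|j IH] t u tu Zj; apply: sol_vbound_jump => //; try exact: TS_inU tu.
  by move=> s su; rewrite ltnNge -subn_eq0 Zj.
move=> s su Zn; have [_ ZS] := inU_uright su Zn; rewrite -ZS; apply: IH.
  exact: TS_uright.
by rewrite ZS subnS Zj.
Qed.

(** With [v] bounded by [sol_adm], both right-hand sides are bounded, which upgrades absolute
    continuity to [prim_on]; the product rule brings in the factor [expR (q t)]. *)
Lemma sol_step x : is_sol x -> step x x.
Proof.
move=> xs; have ax := sol_adm xs; case: xs => xS xac xv xm [xT x0 xJ] u uU.
have acv i : ac_on (last_jump u) T (fun t => x.2 t u 0 i).
  by apply: abs_cont_on_coord (xac u uU).2 => t h1 h2; apply: TS_between; rewrite // h1.
have acm i : ac_on (last_jump u) T (fun t => x.1 t u 0 i).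
  by apply: abs_cont_on_coord (xac u uU).1 => t h1 h2; apply: TS_between; rewrite // h1.
split => //.
- move=> i.
  have dv : {ae (@lebesgue_measure R), forall t, last_jump u < t < T ->
      is_derive t 1 (fun s => x.2 s u 0 i) (rhs_v x t u i)}.
    by apply: filterS (xv u uU) => t h ht; apply: h; exact: TS_open_between.
  split => //; apply: (ac_on_lip_on (M := psm + (q + lm) * vm + lm * vm) (acv i) dv) => t ht.
  have tu := TS_open_between uU ht; have /andP[t0 _] := TS_time tu.
  apply: rhs_v_le => //; [exact: xS | | exact: vm_ge0 |].
    exact: le_trans (ax _ _ tu).2 (vbound_le_vm _ t0).
  by move=> Zn; exact: le_trans (ax _ _ (TS_uright tu Zn)).2 (vbound_le_vm _ t0).
- move=> i.
  have dm : {ae (@lebesgue_measure R), forall t, last_jump u < t < T ->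
      is_derive t 1 (fun s => x.1 s u 0 i)
        (\sum_(j < S) x.1 t u 0 j * Qh t u (x.1 t u) (x.2 t u) j i)}.
    by apply: filterS (xm u uU) => t h ht; apply: h; exact: TS_open_between.
  have pm : prim_on (last_jump u) T (fun s => x.1 s u 0 i)
      (fun t => \sum_(j < S) x.1 t u 0 j * Qh t u (x.1 t u) (x.2 t u) j i).
    split => //; apply: (ac_on_lip_on (M := q) (acm i) dm) => t ht.
    have tu := TS_open_between uU ht.
    have := ler_vnorm (x.1 t u *m Qh t u (x.1 t u) (x.2 t u)) i; rewrite mxE => /le_trans; apply.
    apply: le_trans (vnorm_norm1 _) _; rewrite -[q]mul1r -(simplex_norm1 (xS _ _ tu)).
    apply: norm1_mulmx => j; apply: le_trans (ler_mnorm _ _) (QhM _ tu (xS _ _ tu)).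
  apply: prim_on_eq (prim_onM (prim_on_expRM _ _ q) pm) => t _.
  rewrite /rhs_m; set Qt := Qh _ _ _ _.
  have -> : (x.1 t u *m (Qt + q%:M)) 0 i = \sum_(j < S) x.1 t u 0 j * Qt j i + q * x.1 t u 0 i.
    by rewrite mulmxDr mul_mx_scalar !mxE.
  ring.
- exact: xT.
- rewrite /init; case: eqVneq => [Z0|Z0].
    by rewrite (inU_Z0 uU Z0) last_jump_u0.
  rewrite -lt0n in Z0; have Zn := TS_Z (TS_T T0 uU).
  (* [(Z u).-1] is the 0-based index of the last jump. *)
  have Pn : ((Z u).-1 < n)%N by rewrite (ltn_predK Z0).
  have iZ : (Ordinal Pn).+1 = Z u by rewrite /= (ltn_predK Z0).
  by rewrite (last_jumpE uU iZ); exact: xJ.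
Qed.

Let start_ge0 : 0 <= 2 / Da + 2 * vm.
Proof.
apply: addr_ge0; last by apply: mulr_ge0 => //; exact: vm_ge0.
by apply: divr_ge0 => //; exact: ltW Da_gt0.
Qed.

(** The l1 diameter of the simplex is at most 2 while [al] is at least [Da]; two values of [v]
    differ by at most [2 * vm] while [be] is at least 1. *)
Lemma adm_close x y : adm x -> adm y -> close (2 / Da + 2 * vm) x y.
Proof.
move=> ax ay t u tu; have [xS xv] := ax _ _ tu; have [yS yv] := ay _ _ tu.
have /andP[t0 tT] := TS_time tu; have Zn := TS_Z tu.
have v0 := vm_ge0; have D0 := Da_gt0.
have D1 : 0 <= 2 / Da by rewrite divr_ge0 // ltW.
split.
  apply: le_trans (norm1B _ _) _; rewrite !simplex_norm1 //.
  apply: (@le_trans _ _ (2 / Da * Da)); first by rewrite divfK // gt_eqF.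
  have al1 : Da <= al (Z u) t.
    rewrite /al -[leLHS]mul1r -[leLHS]mulr1 ler_pM ?mul1r ?(ltW D0) //.
      by rewrite ler_peMl ?(ltW D0) // ler1n.
    by rewrite -[leLHS]expR0 ler_expR mulr_ge0.
  by apply: ler_pM; rewrite // ?(ltW D0) // lerDl mulr_ge0.
apply: le_trans (vnormB _ _) _.
apply: (@le_trans _ _ (2 * vm)).
  have := le_trans xv (vbound_le_vm _ t0); have := le_trans yv (vbound_le_vm _ t0); lra.
rewrite -[leLHS]mulr1; apply: ler_pM => //; [exact: mulr_ge0 | by rewrite lerDr | exact: be_ge1].
Qed.

Lemma close_iter x y (C : R) : 0 <= C -> adm x -> adm y -> step x x -> step y y ->
  close C x y -> forall j : nat, close (C * (1 - dlt) ^+ j) x y.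
Proof.
move=> C0 ax ay sx sy xy; elim => [|j IH]; first by rewrite expr0 mulr1.
have d1 : 0 <= 1 - dlt by rewrite subr_ge0 dlt_le1.
have := step_close _ ax ay sx sy IH; rewrite mulrCA -exprS; apply.
by rewrite mulr_ge0 ?exprn_ge0.
Qed.

Lemma close_eq x y (C : R) : (forall j : nat, close (C * (1 - dlt) ^+ j) x y) ->
  forall t u, TS T t u -> x.1 t u = y.1 t u /\ x.2 t u = y.2 t u.
Proof.
move=> h t u tu.
have d1 : 0 <= 1 - dlt by rewrite subr_ge0 dlt_le1.
have d2 : 1 - dlt < 1 by rewrite ltrBlDr ltrDl dlt_gt0.
split; apply/rowP => i; apply/eqP; rewrite -subr_eq0 -normr_le0.
  apply: (le_geometric d1 d2 (K := C * al (Z u) t)) => j; rewrite add0r mulrAC.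
  have [+ _] := h j t u tu; apply: le_trans; apply: le_trans (vnorm_norm1 _).
  by have := ler_vnorm (x.1 t u - y.1 t u) i; rewrite !mxE.
apply: (le_geometric d1 d2 (K := C * be (Z u) t)) => j; rewrite add0r mulrAC.
have [_] := h j t u tu; apply: le_trans.
by have := ler_vnorm (x.2 t u - y.2 t u) i; rewrite !mxE.
Qed.

Lemma sol_unique x y : is_sol x -> is_sol y ->
  forall t u, TS T t u -> x.1 t u = y.1 t u /\ x.2 t u = y.2 t u.
Proof.
move=> xs ys; apply: close_eq; apply: (close_iter start_ge0); try exact: sol_adm.
- exact: sol_step.
- exact: sol_step.
- by apply: adm_close; exact: sol_adm.
Qed.

Lemma step_sol x : adm x -> step x x -> is_sol x.
Proof.
move=> ax sx.
have pv u i : inU T u -> prim_on (last_jump u) T (fun t => x.2 t u 0 i) (fun s => rhs_v x s u i).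
  by move=> /sx[].
have pm u i : inU T u -> prim_on (last_jump u) T (fun t => x.1 t u 0 i)
    (fun t => \sum_(j < S) x.1 t u 0 j * Qh t u (x.1 t u) (x.2 t u) j i).
  move=> uU; have [_ pm _ _] := sx u uU.
  have eN t : expR (- q * t) * expR (q * t) = 1 by rewrite -expRD mulNr addNr expR0.
  have := prim_onM (prim_on_expRM (last_jump u) T (- q)) (pm i).
  under eq_fun do rewrite mulrA eN mul1r.
  apply: prim_on_eq => t _; rewrite /rhs_m; set Qt := Qh _ _ _ _.
  have -> : (x.1 t u *m (Qt + q%:M)) 0 i = \sum_(j < S) x.1 t u 0 j * Qt j i + q * x.1 t u 0 i.
    by rewrite mulmxDr mul_mx_scalar !mxE.
  set sm := \sum_(j < S) _; rewrite mulrA eN mul1r.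
  have -> : expR (q * t) * x.1 t u 0 i * (- q * expR (- q * t)) =
    - q * x.1 t u 0 i * (expR (- q * t) * expR (q * t)) by ring.
  by rewrite eN; ring.
(* [TS] contains the endpoints [last_jump u] and [T], where the two-sided derivative is not
   controlled; they form a null set. *)
have ae_TS u (f : 'I_S -> R -> R) (f' : 'I_S -> R -> R) : inU T u ->
    (forall i, prim_on (last_jump u) T (f i) (f' i)) ->
    {ae (@lebesgue_measure R), forall t, TS T t u -> forall i, is_derive t (1 : R) (f i) (f' i t)}.
  move=> uU pf; have h : {ae (@lebesgue_measure R), forall t, forall i,
      last_jump u < t < T -> is_derive t (1 : R) (f i) (f' i t)}.
    by apply: filter_forall => i; have [] := pf i.
  apply: filterS3 h (ae_neq (last_jump u)) (ae_neq T) => t h t1 t2 /TSP[_ /andP[ut tT]] i.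
  by apply: h; rewrite !lt_neqAle ut tT eq_sym t1 t2.
split.
- by move=> t u /ax[].
- move=> u uU; split; apply: (lip_on_abs_cont_on (a := last_jump u) (b := T)).
  + by move=> t /TSP[].
  + by move=> i; have [] := pm u i uU.
  + by move=> t /TSP[].
  + by move=> i; have [] := pv u i uU.
- by move=> u uU; apply: ae_TS => // i; exact: pv.
- by move=> u uU; apply: (ae_TS u (fun i s => x.1 s u 0 i)
    (fun i t => \sum_(j < S) x.1 t u 0 j * Qh t u (x.1 t u) (x.2 t u) j i)) => // i; exact: pm.
- split.
  + by move=> u /sx[].
  + have [_ _ _] := sx _ (inU_u0 n T); rewrite last_jump_u0 /init Z_u0 eqxx; exact.
  + move=> u i uU iZ; have [_ _ _] := sx u uU.
    by rewrite /init -iZ /= (last_jumpE uU iZ).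
Qed.

(** * Joint measurability and the Picard map *)

Local Notation BU := (borelmx R 1 n).
Definition TSset : set (R * BU) := [set z | TS T z.1 (z.2 : 'rV[R]_n)].

Definition meas x : Prop := forall i,
  measurable_fun TSset (fun z => x.1 z.1 z.2 0 i) /\
  measurable_fun TSset (fun z => x.2 z.1 z.2 0 i).

(** Coefficients are measurable in composed form, along measurable admissible pairs; this keeps the
    action space and the selection [h] out of the section. *)
Hypothesis mQh : forall x i j, meas x -> adm x ->
  measurable_fun TSset (fun z => Qh z.1 z.2 (x.1 z.1 z.2) (x.2 z.1 z.2) i j).
Hypothesis mph : forall x i, meas x -> adm x ->
  measurable_fun TSset (fun z => ph z.1 z.2 (x.1 z.1 z.2) (x.2 z.1 z.2) 0 i).
Hypothesis mlam : forall x k, (1 <= k <= n)%N -> meas x -> adm x ->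
  measurable_fun TSset (fun z => lam z.1 (x.1 z.1 z.2) k).
Hypothesis mPsi : forall x i k, (k <= n)%N -> meas x -> adm x ->
  measurable_fun TSset (fun z => Psi k (x.1 T z.2) 0 i).
Hypothesis mJ : forall i j, measurable_fun (`[0, T]%classic : set R) (fun t => (J t i == j)%:R : R).

Let mTS : measurable TSset. Proof. exact: measurable_TS. Qed.

(** [J] takes finitely many values, so a lookup along [J] is a finite sum of indicators times real
    measurable functions. *)
Lemma measurable_fun_mulmx_Jmx (D : set (R * BU)) (f : R * BU -> 'rV[R]_S) (g : R * BU -> R) i :
  measurable D -> (forall z, D z -> 0 <= g z <= T) -> measurable_fun D g ->
  (forall j, measurable_fun D (fun z => f z 0 j)) ->
  measurable_fun D (fun z => (f z *m Jmx (J (g z))) 0 i).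
Proof.
move=> mD gT mg mf.
apply: (eq_measurable_fun (fun z => \sum_(j < S) f z 0 j * (J (g z) j == i)%:R)).
  by move=> z _; rewrite mxE; apply: eq_bigr => j _; rewrite mxE.
apply: measurable_sum => j; apply: measurable_funM => //.
apply: (@measurable_comp _ _ _ _ _ _ (`[0, T]%classic : set R) (fun t => (J t j == i)%:R : R)
  D g) => //.
by move=> _ [z Dz <-] /=; rewrite in_itv; exact: gT.
Qed.

Lemma meas_rhs_v x i : meas x -> adm x -> measurable_fun TSset (fun z => rhs_v x z.1 z.2 i).
Proof.
move=> mx ax; rewrite /rhs_v; apply: measurable_funB; first apply: measurable_funB.
- by apply: measurableT_comp => //; exact: mph.
- by apply: measurable_sum => j; apply: measurable_funM; [exact: mQh | have [] := mx j].
(* The index of [lam] depends on [Z u], but is constant on each level set of [Z]. *)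
apply: (measurable_fun_split_Z (G := fun k z => if (k < n)%N then
   lam z.1 (x.1 z.1 z.2) k.+1 * (x.2 z.1 (uright z.2 z.1) 0 (J z.1 i) - x.2 z.1 z.2 0 i) else 0)).
move=> k kn; case: ltnP => // {}kn.
apply: measurable_funM; first by apply: measurable_funS (mlam (k := k.+1) kn mx ax).
apply: measurable_funB; last by have [_] := mx i; apply: measurable_funS.
apply: (eq_measurable_fun (fun z : R * BU =>
  \sum_(j < S) (J z.1 i == j)%:R * x.2 z.1 (uright z.2 z.1) 0 j)).
  move=> z _; rewrite (bigD1 (J z.1 i)) //= eqxx mul1r big1 ?addr0 // => j.
  by rewrite eq_sym => /negbTE ->; rewrite mul0r.
apply: measurable_sum => j; apply: measurable_funM.
  apply: (@measurable_comp _ _ _ _ _ _ (`[0, T]%classic : set R) (fun t => (J t i == j)%:R : R)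
    _ fst) => //.
    by move=> _ [z [/= zT _] <-] /=; rewrite in_itv; exact: TS_time zT.
  exact: measurable_funTS measurable_fst.
have [_ mv] := mx j.
apply: (@measurable_comp _ _ _ _ _ _ TSset (fun z => x.2 z.1 z.2 0 j) _
  (fun z : R * BU => (z.1, uright (z.2 : 'rV[R]_n) z.1) : R * BU)) => //.
  by move=> _ [z [/= zT zk] <-]; apply: TS_uright; rewrite // zk.
exact: measurable_funTS (@measurable_uright R n).
Qed.

Lemma meas_rhs_m x i : meas x -> adm x -> measurable_fun TSset (fun z => rhs_m x z.1 z.2 i).
Proof.
move=> mx ax; apply: measurable_funM.
  apply: measurableT_comp; first exact: measurable_expR.
  by apply: measurable_funM => //; exact: measurable_funTS measurable_fst.
apply: (eq_measurable_fun (fun z : R * BU => \sum_(j < S) x.1 z.1 z.2 0 j *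
  (Qh z.1 z.2 (x.1 z.1 z.2) (x.2 z.1 z.2) j i + (j == i)%:R * q))).
  by move=> z _; rewrite mxE; apply: eq_bigr => j _; rewrite !mxE mulr_natl.
apply: measurable_sum => j; apply: measurable_funM; first by have [] := mx j.
by apply: measurable_funD => //; exact: mQh.
Qed.

Lemma meas_init x i : meas x -> adm x -> measurable_fun TSset (fun z => init x z.2 0 i).
Proof.
move=> mx ax.
apply: (eq_measurable_fun (fun z : R * BU => if Z (z.2 : 'rV[R]_n) == 0%N then m0 0 i else
  (x.1 (last_jump (z.2 : 'rV[R]_n)) (uleft z.2) *m Jmx (J (last_jump (z.2 : 'rV[R]_n)))) 0 i)).
  by move=> z _; rewrite /init; case: ifP.
apply: measurable_fun_if => //; first exact: measurable_funTS (@measurable_Z R n 0).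
set D := TSset `&` _.
have mD : measurable D by exact: (measurable_funTS (@measurable_Z R n 0)).
have DP z : D z -> TS T (last_jump (z.2 : 'rV[R]_n)) (uleft z.2).
  by move=> [/= /TS_inU zU /negbT]; rewrite -lt0n; exact: TS_uleft.
apply: measurable_fun_mulmx_Jmx => //.
- by move=> z /DP/TS_time.
- exact: measurable_funTS (@measurable_last_jump R n).
move=> j; have [mm _] := mx j.
apply: (@measurable_comp _ _ _ _ _ _ TSset (fun z => x.1 z.1 z.2 0 j) _
  (fun z : R * BU => (last_jump (z.2 : 'rV[R]_n), uleft (z.2 : 'rV[R]_n)) : R * BU)) => //.
  by move=> _ [z /DP zT <-].
exact: measurable_funTS (@measurable_uleft R n).
Qed.

(** Extension by zero and a lower limit common to all [u] give joint measurability in [(t, u)];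
    [picard] uses only increments between times from the last jump on. *)
Definition prim_TS (g : R -> 'rV[R]_n -> R) (t : R) (u : 'rV[R]_n) : R :=
  (\int[lebesgue_measure]_(s in `[0, t]) ((fun z : R * BU => g z.1 z.2) \_ TSset) (s, u))%R.

Lemma prim_on_prim_TS (g : R -> 'rV[R]_n -> R) (M : R) (u : 'rV[R]_n) : inU T u ->
  measurable_fun TSset (fun z => g z.1 z.2) ->
  (forall t u', TS T t u' -> `|g t u'| <= M) ->
  prim_on (last_jump u) T (fun t => prim_TS g t u) (fun t => g t u).
Proof.
move=> uU mg gM.
have M0 : 0 <= M := le_trans (normr_ge0 _) (gM _ _ (TS_T T0 uU)).
apply: (@prim_on_eq _ _ _ _ (fun t => ((fun z : R * BU => g z.1 z.2) \_ TSset) (t, u))).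
  by move=> t ht; rewrite patchT // inE; exact: TS_open_between.
apply: (@prim_on_Rintegral _ _ M); first exact: last_jump_ge0.
  have h := (measurable_restrictT (fun z : R * BU => g z.1 z.2) mTS).1 mg.
  apply: (measurableT_comp h); apply: measurable_fun_pair => //.
move=> t; rewrite patchE; case: ifPn => [|_]; last by rewrite normr0.
by rewrite inE; exact: gM.
Qed.

Lemma meas_prim_TS (g : R -> 'rV[R]_n -> R) : measurable_fun TSset (fun z => g z.1 z.2) ->
  measurable_fun setT (fun z : R * BU => prim_TS g z.1 z.2).
Proof.
move=> mg; apply: (@measurable_Rintegral _ BU R ((fun z : R * BU => g z.1 z.2) \_ TSset)).
exact: (measurable_restrictT (fun z : R * BU => g z.1 z.2) mTS).1 mg.
Qed.

(** The integral form of [step], solved for [mu] and [v]. *)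
Definition picard x : state :=
  (fun t u => \row_i (expR (- q * t) * (expR (q * last_jump u) * init x u 0 i +
     (prim_TS (fun s u' => rhs_m x s u' i) t u -
      prim_TS (fun s u' => rhs_m x s u' i) (last_jump u) u))),
   fun t u => \row_i (Psi (Z u) (x.1 T u) 0 i -
     (prim_TS (fun s u' => rhs_v x s u' i) T u - prim_TS (fun s u' => rhs_v x s u' i) t u))).

Lemma meas_picard x : meas x -> adm x -> meas (picard x).
Proof.
move=> mx ax i; split.
  apply: (eq_measurable_fun (fun z : R * BU => expR (- q * z.1) *
    (expR (q * last_jump (z.2 : 'rV[R]_n)) * init x z.2 0 i +
     (prim_TS (fun s u' => rhs_m x s u' i) z.1 z.2 -
      prim_TS (fun s u' => rhs_m x s u' i) (last_jump (z.2 : 'rV[R]_n)) z.2)))).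
    by move=> z _; rewrite mxE.
  have mI := meas_prim_TS (g := fun s u' => rhs_m x s u' i) (meas_rhs_m i mx ax).
  apply: measurable_funM.
    apply: measurableT_comp; first exact: measurable_expR.
    by apply: measurable_funM => //; exact: measurable_funTS measurable_fst.
  apply: measurable_funD; last apply: measurable_funB.
  - apply: measurable_funM; last exact: meas_init.
    apply: measurableT_comp; first exact: measurable_expR.
    by apply: measurable_funM => //; exact: measurable_funTS (@measurable_last_jump R n).
  - exact: measurable_funTS mI.
  - apply: measurable_funTS.
    apply: (measurableT_comp mI
      (g := fun z : R * BU => (last_jump (z.2 : 'rV[R]_n), z.2) : R * BU)).
    by apply: measurable_fun_pair => //; exact: measurable_last_jump.
apply: (eq_measurable_fun (fun z : R * BU => Psi (Z (z.2 : 'rV[R]_n)) (x.1 T z.2) 0 i -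
     (prim_TS (fun s u' => rhs_v x s u' i) T z.2 - prim_TS (fun s u' => rhs_v x s u' i) z.1 z.2))).
  by move=> z _; rewrite mxE.
have mI := meas_prim_TS (g := fun s u' => rhs_v x s u' i) (meas_rhs_v i mx ax).
apply: measurable_funB; last apply: measurable_funB.
- apply: (measurable_fun_split_Z (G := fun k z => Psi k (x.1 T z.2) 0 i)) => k kn.
  by apply: measurable_funS (mPsi i kn mx ax).
- apply: measurable_funTS.
  apply: (measurableT_comp mI (g := fun z : R * BU => (T, z.2) : R * BU)).
  exact: measurable_fun_pair.
- exact: measurable_funTS mI.
Qed.

Lemma step_picard x : meas x -> adm x -> step x (picard x).
Proof.
move=> mx ax u uU; split.
- move=> i; have pI : prim_on (last_jump u) T
      (fun t => prim_TS (fun s u' => rhs_v x s u' i) t u) (fun s => rhs_v x s u i).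
    apply: (prim_on_prim_TS (M := psm + (q + lm) * vm + lm * vm)) => //; first exact: meas_rhs_v.
    move=> t u' tu; have /andP[t0 _] := TS_time tu; have [xS xv] := ax _ _ tu.
    apply: rhs_v_le => //; [exact: le_trans xv (vbound_le_vm _ t0) | exact: vm_ge0 |].
    by move=> Zn; exact: le_trans (ax _ _ (TS_uright tu Zn)).2 (vbound_le_vm _ t0).
  have := prim_onD (prim_on_cst (last_jump u) T (Psi (Z u) (x.1 T u) 0 i -
     prim_TS (fun s u' => rhs_v x s u' i) T u)) pI.
  rewrite [X in prim_on _ _ X](_ : _ = (fun t => (picard x).2 t u 0 i)); last first.
    by apply/funext => t; rewrite mxE; ring.
  by apply: prim_on_eq => t _; rewrite add0r.
- move=> i; have pI : prim_on (last_jump u) T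
      (fun t => prim_TS (fun s u' => rhs_m x s u' i) t u) (fun s => rhs_m x s u i).
    apply: (prim_on_prim_TS (M := q * expR (q * T))) => //; first exact: meas_rhs_m.
    move=> t u' tu; have /andP[t0 tT] := TS_time tu; have [xS xv] := ax _ _ tu.
    rewrite ger0_norm ?rhs_m_ge0 //; apply: (@le_trans _ _ (q * expR (q * t))).
      rewrite -(rhs_m_sum tu xS) (bigD1 i) //= lerDl sumr_ge0 // => j _.
      exact: rhs_m_ge0.
    by rewrite ler_wpM2l // ler_expR ler_wpM2l.
  have := prim_onD (prim_on_cst (last_jump u) T (expR (q * last_jump u) * init x u 0 i -
     prim_TS (fun s u' => rhs_m x s u' i) (last_jump u) u)) pI.
  rewrite [X in prim_on _ _ X](_ : _ = (fun t => expR (q * t) * (picard x).1 t u 0 i)); last first.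
    apply/funext => t; rewrite mxE mulrA -expRD mulNr subrr expR0 mul1r; ring.
  by apply: prim_on_eq => t _; rewrite add0r.
- by apply/rowP => i; rewrite mxE subrr subr0.
- by apply/rowP => i; rewrite mxE subrr addr0 mulrA -expRD mulNr addNr expR0 mul1r.
Qed.

(** * Existence: the limit of the iterates *)

Let ratio_ge0 : 0 <= 1 - dlt. Proof. by rewrite subr_ge0 dlt_le1. Qed.
Let ratio_lt1 : 1 - dlt < 1. Proof. by rewrite ltrBlDr ltrDl dlt_gt0. Qed.

Lemma adm_limit (xs : nat -> state) x (C : R) : (forall k, adm (xs k)) ->
  (forall k, close (C * (1 - dlt) ^+ k) (xs k) x) -> adm x.
Proof.
move=> axs cl t u tu; pose r := 1 - dlt.
have hm k i : `|x.1 t u 0 i - (xs k).1 t u 0 i| <= C * al (Z u) t * r ^+ k.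
  have [h _] := cl k t u tu; rewrite mulrAC; apply: le_trans h.
  apply: le_trans (vnorm_norm1 _).
  by have := ler_vnorm ((xs k).1 t u - x.1 t u) i; rewrite !mxE distrC.
have hv k i : `|x.2 t u 0 i - (xs k).2 t u 0 i| <= C * be (Z u) t * r ^+ k.
  have [_ h] := cl k t u tu; rewrite mulrAC; apply: le_trans h.
  by have := ler_vnorm ((xs k).2 t u - x.2 t u) i; rewrite !mxE distrC.
split; first split.
- move=> i; apply: (le_geometric ratio_ge0 ratio_lt1 (K := C * al (Z u) t)) => k.
  have [[xp _] _] := axs k t u tu.
  by have := xp i; have := hm k i; rewrite ler_norml => /andP[]; lra.
- apply/eqP; rewrite -subr_eq0 -normr_le0.
  apply: (le_geometric ratio_ge0 ratio_lt1 (K := C * al (Z u) t)) => k; rewrite add0r.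
  have [[_ xs1] _] := axs k t u tu; rewrite -[X in `|_ - X|]xs1 -sumrB.
  apply: le_trans (ler_norm_sum _ _ _) _.
  have [h _] := cl k t u tu; rewrite mulrAC; apply: le_trans h.
  by apply: ler_sum => i _; rewrite !mxE distrC.
- apply: vnorm_leP => [|i]; first by rewrite wt_ge0 // vbound0_ge0.
  apply: (le_geometric ratio_ge0 ratio_lt1 (K := C * be (Z u) t)) => k.
  have [_ /(le_trans (ler_vnorm _ i)) xb] := axs k t u tu.
  rewrite -[x.2 t u 0 i](subrK ((xs k).2 t u 0 i)) addrC (le_trans (ler_normD _ _)) //.
  by rewrite lerD.
Qed.

Definition start : state := (fun _ _ => m0, fun _ _ => 0).

Lemma adm_start : adm start.
Proof.
move=> t u tu; split => //; apply: vnorm_leP => [|i]; rewrite ?mxE ?normr0;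
  by rewrite wt_ge0 // vbound0_ge0.
Qed.

Definition iterate (k : nat) : state := iter k picard start.

Lemma adm_meas_iterate k : adm (iterate k) /\ meas (iterate k).
Proof.
elim: k => [|k [ak mk]]; first by split;
  [exact: adm_start | move=> i; split; exact: measurable_cst].
by split; [exact: step_adm ak (step_picard mk ak) | exact: meas_picard].
Qed.

Lemma close_iterate k :
  close ((2 / Da + 2 * vm) * (1 - dlt) ^+ k) (iterate k) (iterate k.+1).
Proof.
elim: k => [|k IH].
  by rewrite expr0 mulr1; apply: adm_close; exact: (adm_meas_iterate _).1.
rewrite exprS mulrCA.
have st j : step (iterate j) (iterate j.+1).
  by have [aj mj] := adm_meas_iterate j; exact: step_picard.
apply: step_close (st k) (st k.+1) IH.
- by apply: mulr_ge0; [exact: start_ge0 | exact: exprn_ge0].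
- exact: (adm_meas_iterate _).1.
- exact: (adm_meas_iterate _).1.
Qed.

Definition limit : state :=
  (fun t u => \row_i limn (fun k => (iterate k).1 t u 0 i),
   fun t u => \row_i limn (fun k => (iterate k).2 t u 0 i)).

(** Sum of the geometric series of ratio [1 - dlt] that bounds the distances between successive
    iterates. *)
Let C0 := (2 / Da + 2 * vm) / dlt.

Let limit_m t u i : TS T t u ->
  (fun k => (iterate k).1 t u 0 i) @ \oo --> limit.1 t u 0 i /\
  forall k, `|limit.1 t u 0 i - (iterate k).1 t u 0 i| <= C0 * (1 - dlt) ^+ k * al (Z u) t.
Proof.
move=> tu; rewrite mxE.
have [|h1 h2] := cvg_geometric_increments ratio_ge0 ratio_lt1
   (a := fun k => (iterate k).1 t u 0 i) (K := (2 / Da + 2 * vm) * al (Z u) t).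
  move=> k; have [h _] := close_iterate k tu; rewrite mulrAC; apply: le_trans h.
  apply: le_trans (vnorm_norm1 _).
  by have := ler_vnorm ((iterate k).1 t u - (iterate k.+1).1 t u) i; rewrite !mxE distrC.
split => // k; apply: le_trans (h2 k) _.
by rewrite subKr /C0 le_eqVlt; apply/orP; left; apply/eqP; ring.
Qed.

Let limit_v t u i : TS T t u ->
  (fun k => (iterate k).2 t u 0 i) @ \oo --> limit.2 t u 0 i /\
  forall k, `|limit.2 t u 0 i - (iterate k).2 t u 0 i| <= C0 * (1 - dlt) ^+ k * be (Z u) t.
Proof.
move=> tu; rewrite mxE.
have [|h1 h2] := cvg_geometric_increments ratio_ge0 ratio_lt1
   (a := fun k => (iterate k).2 t u 0 i) (K := (2 / Da + 2 * vm) * be (Z u) t).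
  move=> k; have [_ h] := close_iterate k tu; rewrite mulrAC; apply: le_trans h.
  by have := ler_vnorm ((iterate k).2 t u - (iterate k.+1).2 t u) i; rewrite !mxE distrC.
split => // k; apply: le_trans (h2 k) _.
by rewrite subKr /C0 le_eqVlt; apply/orP; left; apply/eqP; ring.
Qed.

Let C0_ge0 : 0 <= C0.
Proof. by apply: divr_ge0; [exact: start_ge0 | exact: ltW dlt_gt0]. Qed.

Let S_ge1 : (1 : R) <= S%:R.
Proof.
rewrite ler1n lt0n; apply/eqP => S0; have [_] := m0S.
rewrite big1 => [/eqP|i _]; first by rewrite eq_sym oner_eq0.
by have := ltn_ord i; rewrite [X in (_ < X)%N]S0.
Qed.

(** Limits are taken entrywise, so that the l1 estimate adds up [S] equal errors; the factor [S%:R]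
    is at least 1 and is kept for [v] as well. *)
Lemma close_limit k : close (S%:R * C0 * (1 - dlt) ^+ k) (iterate k) limit.
Proof.
move=> t u tu; split.
  apply: (@le_trans _ _ (\sum_(i < S) C0 * (1 - dlt) ^+ k * al (Z u) t)).
    by apply: ler_sum => i _; rewrite !mxE distrC; have [_] := limit_m i tu; rewrite mxE.
  rewrite sumr_const card_ord -mulr_natl; move: C0 => C.
  by rewrite le_eqVlt; apply/orP; left; apply/eqP; ring.
have be0 : 0 <= be (Z u) t by exact: wt_ge0.
have Ck : 0 <= C0 * (1 - dlt) ^+ k by apply: mulr_ge0 => //; exact: exprn_ge0.
apply: (@le_trans _ _ (C0 * (1 - dlt) ^+ k * be (Z u) t)).
  apply: vnorm_leP => [|i]; first exact: mulr_ge0.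
  by rewrite !mxE distrC; have [_] := limit_v i tu; rewrite mxE.
have -> : S%:R * C0 * (1 - dlt) ^+ k * be (Z u) t = S%:R * (C0 * (1 - dlt) ^+ k * be (Z u) t).
  by move: C0 => C; ring.
by rewrite ler_peMl //; exact: mulr_ge0.
Qed.

Lemma adm_limit_iterate : adm limit.
Proof. exact: (adm_limit (fun k => (adm_meas_iterate k).1) close_limit). Qed.

Lemma meas_limit : meas limit.
Proof.
move=> i; split.
  apply: (measurable_fun_cvg (h := fun k (z : R * BU) => (iterate k).1 z.1 z.2 0 i)).
    by move=> k; have [_ mk] := adm_meas_iterate k; have [] := mk i.
  by move=> z zT; exact: (limit_m i zT).1.
apply: (measurable_fun_cvg (h := fun k (z : R * BU) => (iterate k).2 z.1 z.2 0 i)).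
  by move=> k; have [_ mk] := adm_meas_iterate k; have [] := mk i.
by move=> z zT; exact: (limit_v i zT).1.
Qed.

(** [iterate j.+1] is the Picard image of [iterate j], so by contraction it is as close to
    [picard limit] as the error bound puts it to [limit]; the two errors explain the factor 2. *)
Lemma picard_limit t u : TS T t u ->
  limit.1 t u = (picard limit).1 t u /\ limit.2 t u = (picard limit).2 t u.
Proof.
have al' := adm_limit_iterate; have sl := step_picard meas_limit al'.
apply: (close_eq (C := (S%:R * C0 * (1 - dlt)) *+ 2)) => j {t u} t u tu.
have [aj mj] := adm_meas_iterate j.
have SC : 0 <= S%:R * C0 * (1 - dlt) ^+ j.
  by apply: mulr_ge0; [exact: mulr_ge0 | exact: exprn_ge0].
have c1 := step_close SC aj al' (step_picard mj aj) sl (close_limit j).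
have [m1 v1] := c1 t u tu; have [m2 v2] := close_limit j.+1 tu.
have E : S%:R * C0 * (1 - dlt) * (1 - dlt) ^+ j = (1 - dlt) * (S%:R * C0 * (1 - dlt) ^+ j) by ring.
have E' : S%:R * C0 * (1 - dlt) ^+ j.+1 = (1 - dlt) * (S%:R * C0 * (1 - dlt) ^+ j).
  by rewrite exprS; ring.
rewrite E' in m2 v2.
have dbl (a : R) : S%:R * C0 * (1 - dlt) *+ 2 * (1 - dlt) ^+ j * a =
   (1 - dlt) * (S%:R * C0 * (1 - dlt) ^+ j) * a + (1 - dlt) * (S%:R * C0 * (1 - dlt) ^+ j) * a.
  by rewrite -E mulr2n; ring.
split; rewrite dbl.
  have -> : limit.1 t u - (picard limit).1 t u =
     ((iterate j.+1).1 t u - (picard limit).1 t u) - ((iterate j.+1).1 t u - limit.1 t u).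
    by rewrite opprB [RHS]addrC subrKA.
  by apply: le_trans (norm1B _ _) _; exact: lerD.
have -> : limit.2 t u - (picard limit).2 t u =
   ((iterate j.+1).2 t u - (picard limit).2 t u) - ((iterate j.+1).2 t u - limit.2 t u).
  by rewrite opprB [RHS]addrC subrKA.
by apply: le_trans (vnormB _ _) _; exact: lerD.
Qed.

(** The solution is [picard limit] rather than [limit]: the two are known to agree on [TS] only, and
    [step] provides the derivatives of [picard limit] as it stands. What remains is to exchange
    values on [TS] in the right-hand sides. *)
Lemma exists_sol : exists x, is_sol x.
Proof.
have al' := adm_limit_iterate; have sl := step_picard meas_limit al'.
have E := picard_limit.
exists (picard limit); apply: step_sol; first exact: step_adm al' sl.
move=> u uU; have [pv pm yT yi] := sl u uU; split.
- move=> i; apply: prim_on_eq (pv i) => s hs; have su := TS_open_between uU hs.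
  rewrite /rhs_v; have [-> ->] := E _ _ su; case: ifP => // Zn.
  by have [_ ->] := E _ _ (TS_uright su Zn).
- move=> i; apply: prim_on_eq (pm i) => s hs; have su := TS_open_between uU hs.
  by rewrite /rhs_m; have [-> ->] := E _ _ su.
- by rewrite yT; have [-> _] := E _ _ (TS_T T0 uU).
- rewrite yi /init; case: eqVneq => // Z0; rewrite -lt0n in Z0.
  by have [-> _] := E _ _ (TS_uleft T0 uU Z0).
Qed.

End system.

(** * Measurability of the coefficients *)

Lemma sup_nonneg (R : realType) (E : set R) : (forall x, E x -> 0 <= x) -> 0 <= sup E.
Proof.
(* [sup] is 0 by default on a set without supremum, as for [lammax] when [n = 0]. *)
move=> E0; have [hE|nE] := pselect (has_sup E); last by rewrite sup_out.
by have [[x Ex] _] := hE; apply: le_trans (E0 x Ex) _; exact: sup_upper_bound.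
Qed.

Lemma measurable_row_mx (d : measure_display) (V : measurableType d) (R : realType)
    (D : set V) (p q : nat) (f : V -> 'rV[R]_p) (g : V -> 'rV[R]_q) :
  (forall i, measurable_fun D (fun z => f z 0 i)) ->
  (forall i, measurable_fun D (fun z => g z 0 i)) ->
  forall i, measurable_fun D (fun z => row_mx (f z) (g z) 0 i).
Proof.
move=> mf mg i.
case: (splitP i) => j ij.
  apply: (eq_measurable_fun (fun z => f z 0 j)) => // z _.
  by rewrite (_ : i = lshift q j) ?row_mxEl //; exact: val_inj.
apply: (eq_measurable_fun (fun z => g z 0 j)) => // z _.
by rewrite (_ : i = rshift p j) ?row_mxEr //; exact: val_inj.
Qed.

Section instance.
Context (R : realType) (S dA n : nat) (T : R) (AA : set 'rV[R]_dA).
Context (lam : R -> 'rV[R]_S -> nat -> R)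
  (Q : R -> nat -> 'rV[R]_S -> 'rV[R]_dA -> 'M[R]_S)
  (psi : R -> nat -> 'rV[R]_S -> 'rV[R]_dA -> 'rV[R]_S)
  (Psi : nat -> 'rV[R]_S -> 'rV[R]_S)
  (J : R -> 'rV[R]_S -> 'I_S -> 'I_S)
  (h : R -> 'rV[R]_n -> 'rV[R]_S -> 'rV[R]_S -> 'I_S -> 'rV[R]_dA).
Local Notation BU := (borelmx R 1 n).
Local Notation state := ((R -> 'rV[R]_n -> 'rV[R]_S) * (R -> 'rV[R]_n -> 'rV[R]_S))%type.

Hypothesis T0 : 0 < T.
Hypothesis hAA : forall t u m v i, TS T t u -> simplex m -> AA (h t u m v i).
Hypothesis hB : borel_on [set x : 'rV[R]_(1 + n + S + S) |
    TS T (fst3 (lsubmx x) 0 0) (snd3 (lsubmx x)) /\ simplex (thd3 (lsubmx x))]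
  (fun x => \matrix_(i < S, a < dA)
    h (fst3 (lsubmx x) 0 0) (snd3 (lsubmx x)) (thd3 (lsubmx x)) (rsubmx x) i 0 a).

Let mTS : measurable (TSset T : set (R * BU)). Proof. exact: measurable_TS. Qed.

Lemma measurable_fun_time (D : set (R * BU)) (i : 'I_1) :
  measurable_fun D (fun z => (const_mx z.1 : 'rV[R]_1) 0 i).
Proof.
apply: (eq_measurable_fun (fun z : R * BU => z.1)); first by move=> z _; rewrite mxE.
exact: measurable_funTS measurable_fst.
Qed.

Lemma meas_h (x : state) i a : meas T x -> (forall t u, TS T t u -> simplex (x.1 t u)) ->
  measurable_fun (TSset T)
    (fun z : R * BU => h z.1 z.2 (x.1 z.1 z.2) (x.2 z.1 z.2) i 0 a).
Proof.
move=> mx xS.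
pose g (z : R * BU) : 'rV[R]_(1 + n + S + S) :=
  row_mx (row_mx (row_mx (const_mx z.1) (z.2 : 'rV[R]_n)) (x.1 z.1 z.2)) (x.2 z.1 z.2).
have E z : [/\ fst3 (lsubmx (g z)) 0 0 = z.1, snd3 (lsubmx (g z)) = z.2,
    thd3 (lsubmx (g z)) = x.1 z.1 z.2 & rsubmx (g z) = x.2 z.1 z.2].
  by rewrite /fst3 /snd3 /thd3 /g !(row_mxKl, row_mxKr) mxE.
apply: eq_measurable_fun (borel_on_comp mTS hB (g := g) _ _ i a).
- by move=> z _; have [e1 e2 e3 e4] := E z; rewrite mxE e1 e2 e3 e4.
- move=> z zT /=; have [-> -> -> _] := E z; split => //; exact: xS.
- apply: measurable_row_mx => [|j]; last by have [] := mx j.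
  apply: measurable_row_mx => [|j]; last by have [] := mx j.
  apply: measurable_row_mx => [|j]; first exact: measurable_fun_time.
  exact: measurable_funTS (measurable_entry _).
Qed.

Let g3 (x : state) (i : 'I_S) (z : R * BU) : 'rV[R]_(1 + S + dA) :=
  row_mx (row_mx (const_mx z.1) (x.1 z.1 z.2)) (h z.1 z.2 (x.1 z.1 z.2) (x.2 z.1 z.2) i).

Let g3E x i z : [/\ fst3 (g3 x i z) 0 0 = z.1, snd3 (g3 x i z) = x.1 z.1 z.2
  & thd3 (g3 x i z) = h z.1 z.2 (x.1 z.1 z.2) (x.2 z.1 z.2) i].
Proof. by rewrite /fst3 /snd3 /thd3 /g3 !(row_mxKl, row_mxKr) mxE. Qed.

(** The Borel assumptions are made for each fixed number of jumps [k], hence the split along the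
    level sets of [Z]. *)
Lemma meas_action_comp (p q : nat) (f : R -> nat -> 'rV[R]_S -> 'rV[R]_dA -> 'M[R]_(p, q))
    (x : state) i j l :
  (forall k, (k <= n)%N ->
     borel_on [set x : 'rV[R]_(1 + S + dA) | 0 <= fst3 x 0 0 <= T
                  /\ simplex (snd3 x) /\ AA (thd3 x)]
       (fun x => f (fst3 x 0 0) k (snd3 x) (thd3 x))) ->
  meas T x -> (forall t u, TS T t u -> simplex (x.1 t u)) ->
  measurable_fun (TSset T) (fun z : R * BU =>
    f z.1 (Z (z.2 : 'rV[R]_n)) (x.1 z.1 z.2) (h z.1 z.2 (x.1 z.1 z.2) (x.2 z.1 z.2) i) j l).
Proof.
move=> fB mx xS.
apply: (measurable_fun_split_Z (G := fun k (z : R * BU) =>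
  f z.1 k (x.1 z.1 z.2) (h z.1 z.2 (x.1 z.1 z.2) (x.2 z.1 z.2) i) j l)) => k kn.
apply: (measurable_funS mTS); first by move=> z [].
apply: eq_measurable_fun (borel_on_comp mTS (fB k kn) (g := g3 x i) _ _ j l).
- by move=> z _; have [-> -> ->] := g3E x i z.
- move=> z zT /=; have [-> -> ->] := g3E x i z.
  by split; [exact: (TS_time zT) | split; [exact: xS | apply: hAA => //; exact: xS]].
- apply: measurable_row_mx => [|a]; last exact: meas_h.
  by apply: measurable_row_mx => a; [exact: measurable_fun_time | have [] := mx a].
Qed.

End instance.

(** * Reduction of the theorem to the abstract system *)

Theorem theoremB2 (R : realType) (S dA n : nat) (T : R) (AA : set 'rV[R]_dA)
  (lam : R -> 'rV[R]_S -> nat -> R)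
  (Q : R -> nat -> 'rV[R]_S -> 'rV[R]_dA -> 'M[R]_S)
  (psi : R -> nat -> 'rV[R]_S -> 'rV[R]_dA -> 'rV[R]_S)
  (Psi : nat -> 'rV[R]_S -> 'rV[R]_S)
  (J : R -> 'rV[R]_S -> 'I_S -> 'I_S)
  (h : R -> 'rV[R]_n -> 'rV[R]_S -> 'rV[R]_S -> 'I_S -> 'rV[R]_dA)
  (LpsiH LQH LPsi Llam : R) (m0 : 'rV[R]_S) :
  (* standing assumptions *)
  0 < T ->
  (* lambda : [0,T] x P(S) -> (0,oo)^n, bounded, Borel *)
  (forall t m k, 0 <= t <= T -> simplex m -> (1 <= k <= n)%N -> 0 < lam t m k) ->
  (exists M : R, forall t m k, 0 <= t <= T -> simplex m -> (1 <= k <= n)%N ->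
     lam t m k <= M) ->
  borel_on [set x : 'rV[R]_(1 + S) | 0 <= lsubmx x 0 0 <= T /\ simplex (rsubmx x)]
    (fun x => \row_(k < n) lam (lsubmx x 0 0) (rsubmx x) k.+1) ->
  (* Q : intensity matrices, bounded, Borel *)
  (forall t k m a, 0 <= t <= T -> (k <= n)%N -> simplex m -> AA a ->
     intensity (Q t k m a)) ->
  (exists M : R, forall t k m a, 0 <= t <= T -> (k <= n)%N -> simplex m -> AA a ->
     mnorm (Q t k m a) <= M) ->
  (forall k, (k <= n)%N ->
     borel_on [set x : 'rV[R]_(1 + S + dA) | 0 <= fst3 x 0 0 <= T
                  /\ simplex (snd3 x) /\ AA (thd3 x)]
       (fun x => Q (fst3 x 0 0) k (snd3 x) (thd3 x))) ->
  (* psi : bounded, Borel *)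
  (exists M : R, forall t k m a, 0 <= t <= T -> (k <= n)%N -> simplex m -> AA a ->
     vnorm (psi t k m a) <= M) ->
  (forall k, (k <= n)%N ->
     borel_on [set x : 'rV[R]_(1 + S + dA) | 0 <= fst3 x 0 0 <= T
                  /\ simplex (snd3 x) /\ AA (thd3 x)]
       (fun x => psi (fst3 x 0 0) k (snd3 x) (thd3 x))) ->
  (* Psi : bounded, Borel *)
  (exists M : R, forall k m, (k <= n)%N -> simplex m -> vnorm (Psi k m) <= M) ->
  (forall k, (k <= n)%N -> borel_on (@simplex R S) (Psi k)) ->
  (* J : Borel *)
  borel_on [set x : 'rV[R]_(1 + S) | 0 <= lsubmx x 0 0 <= T /\ simplex (rsubmx x)]
    (fun x => Jmx (J (lsubmx x 0 0) (rsubmx x))) ->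
  (* h : Borel selection of the argmax *)
  borel_on [set x : 'rV[R]_(1 + n + S + S) |
              TS T (fst3 (lsubmx x) 0 0) (snd3 (lsubmx x)) /\ simplex (thd3 (lsubmx x))]
    (fun x => \matrix_(i < S, a < dA)
        h (fst3 (lsubmx x) 0 0) (snd3 (lsubmx x)) (thd3 (lsubmx x)) (rsubmx x) i 0 a) ->
  (forall t u m v i, TS T t u -> simplex m ->
     AA (h t u m v i) /\
     (forall a, AA a ->
        psi t (Z u) m a 0 i + \sum_(j < S) Q t (Z u) m a i j * v 0 j
        <= psi t (Z u) m (h t u m v i) 0 i
           + \sum_(j < S) Q t (Z u) m (h t u m v i) i j * v 0 j)) ->
  (* Lipschitz assumptions (i)-(v) *)
  0 < LpsiH -> 0 < LQH -> 0 < LPsi -> 0 < Llam ->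
  (forall t u m1 m2 v1 v2, TS T t u -> simplex m1 -> simplex m2 ->
     vnorm (psihat psi h t u m1 v1 - psihat psi h t u m2 v2)
       <= LpsiH * (vnorm (m1 - m2) + vnorm (v1 - v2))) ->
  (forall t u m1 m2 v1 v2, TS T t u -> simplex m1 -> simplex m2 ->
     mnorm (Qhat Q h t u m1 v1 - Qhat Q h t u m2 v2)
       <= LQH * (vnorm (m1 - m2) + vnorm (v1 - v2))) ->
  (forall k m1 m2, (k <= n)%N -> simplex m1 -> simplex m2 ->
     vnorm (Psi k m1 - Psi k m2) <= LPsi * vnorm (m1 - m2)) ->
  (forall t k m1 m2, 0 <= t <= T -> (1 <= k <= n)%N -> simplex m1 -> simplex m2 ->
     `|lam t m1 k - lam t m2 k| <= Llam * vnorm (m1 - m2)) ->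
  (forall t m1 m2 i, 0 <= t <= T -> simplex m1 -> simplex m2 -> J t m1 i = J t m2 i) ->
  simplex m0 ->
  (* smallness condition *)
  (let Qm := Qmax n T AA Q in
   let lm := lammax n T lam in
   let vm := vmax n T AA lam Q psi Psi in
   let K1 := LpsiH + LQH * vm + 2 * vm * Llam in
   let K2 := LpsiH + vm * LQH + Qm + lm in
   LQH * T * (\sum_(i < n.+1) expR ((Qm + LQH) * T) ^+ i.+1 * Jmax T J ^+ i)
     * (LPsi + K1 * T) * expR (K2 * T)
     * (\sum_(i < n.+1) (expR (K2 * T) * lm * T) ^+ i) < 1) ->
  (* conclusion: existence and uniqueness of a regular solution *)
  let sol := fun (mu : R -> 'rV[R]_n -> 'rV[R]_S) (v : R -> 'rV[R]_n -> 'rV[R]_S) =>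
    [/\ (forall t u, TS T t u -> simplex (mu t u)),
        (* regularity *)
        (forall u, inU T u ->
           abs_cont_on (fun t => TS T t u) (fun t => mu t u)
           /\ abs_cont_on (fun t => TS T t u) (fun t => v t u)),
        (* (E1) *)
        (forall u, inU T u ->
          {ae (@lebesgue_measure R), forall t, TS T t u -> forall i : 'I_S,
            is_derive t (1 : R) (fun s => v s u 0 i)
              (- psihat psi h t u (mu t u) (v t u) 0 i
               - \sum_(j < S) Qhat Q h t u (mu t u) (v t u) i j * v t u 0 j
               - (if (Z u < n)%N then
                    lam t (mu t u) (Z u).+1
                    * (v t (uright u t) 0 (J t (mu t u) i) - v t u 0 i)
                  else 0))}),
        (* (E2) *)
        (forall u, inU T u ->
          {ae (@lebesgue_measure R), forall t, TS T t u -> forall i : 'I_S,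
            is_derive t (1 : R) (fun s => mu s u 0 i)
              (\sum_(j < S) mu t u 0 j * Qhat Q h t u (mu t u) (v t u) j i)})
        (* (E3), (E4) *)
      & [/\ (forall u, inU T u -> v T u = Psi (Z u) (mu T u)),
            mu 0 (@u0 R n) = m0
          & (* (E5) *)
        (forall u (i : 'I_n), inU T u -> (i.+1 = Z u)%N ->
           mu (u 0 i) u = mu (u 0 i) (uleft u) *m Jmx (J (u 0 i) (mu (u 0 i) u)))]] in
  exists mu v, sol mu v /\
    forall mu' v', sol mu' v' -> forall t u, TS T t u -> mu' t u = mu t u /\ v' t u = v t u.
Proof.
move=> T0 lam0 lamM lamB QI QM QB psiM psiB PsiM PsiB JB hB hP Lpsi0 LQ0 LPsi0 Llam0.
move=> psiL QL PsiL lamL JL m0S small sol.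
pose q := Qmax n T AA Q; pose lm := lammax n T lam; pose Pm := Psimax n Psi.
pose psm := psimax n T AA psi.
(* By assumption (v) [J t m] is the same for all [m] in the simplex; [m0] serves as reference
   point. *)
pose J0 t i := J t m0 i.
have hAA t u m v i : TS T t u -> simplex m -> AA (h t u m v i).
  by move=> tu mS; have [] := hP t u m v i tu mS.
have Qle t k m a : 0 <= t <= T -> (k <= n)%N -> simplex m -> AA a -> mnorm (Q t k m a) <= q.
  move=> tT kn mS aA; apply: ub_le_sup; last by exists t, k, m, a.
  by have [M hM] := QM; exists M => _ [t' [k' [m' [a' [[? ? ? ?] ->]]]]]; exact: hM.
have psile t k m a : 0 <= t <= T -> (k <= n)%N -> simplex m -> AA a -> vnorm (psi t k m a) <= psm.
  move=> tT kn mS aA; apply: ub_le_sup; last by exists t, k, m, a.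
  by have [M hM] := psiM; exists M => _ [t' [k' [m' [a' [[? ? ? ?] ->]]]]]; exact: hM.
have Psile k m : (k <= n)%N -> simplex m -> vnorm (Psi k m) <= Pm.
  move=> kn mS; apply: ub_le_sup; last by exists k, m.
  by have [M hM] := PsiM; exists M => _ [k' [m' [[? ?] ->]]]; exact: hM.
have lamle t m k : 0 <= t <= T -> simplex m -> (1 <= k <= n)%N -> 0 <= lam t m k <= lm.
  move=> tT mS kn; rewrite (ltW (lam0 _ _ _ tT mS kn)) /=.
  apply: ub_le_sup; last by exists t, k, m.
  by have [M hM] := lamM; exists M => _ [t' [k' [m' [[? ? ?] ->]]]]; exact: hM.
have q0 : 0 <= q by apply: sup_nonneg => _ [? [? [? [? [_ ->]]]]]; exact: mnorm_ge0.
have psm0 : 0 <= psm by apply: sup_nonneg => _ [? [? [? [? [_ ->]]]]]; exact: vnorm_ge0.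
have Pm0 : 0 <= Pm by apply: sup_nonneg => _ [? [? [_ ->]]]; exact: vnorm_ge0.
have lm0 : 0 <= lm.
  by apply: sup_nonneg => _ [? [? [? [[? ? ?] ->]]]]; apply: ltW; exact: lam0.
have TSk (t : R) (u : 'rV[R]_n) : TS T t u -> 0 <= t <= T /\ (Z u <= n)%N.
  by move=> tu; split; [exact: TS_time tu | exact: TS_Z tu].
have QhI t u m v : TS T t u -> simplex m -> intensity (Qhat Q h t u m v).
  move=> tu mS; have [tT Zn] := TSk _ _ tu.
  have I i : intensity (Q t (Z u) m (h t u m v i)) by apply: QI => //; exact: hAA.
  split => [i j ij|i]; first by rewrite mxE; have [+ _] := I i; exact.
  by under eq_bigr do rewrite mxE; have [_] := I i; exact.
have QhM t u m v : TS T t u -> simplex m -> mnorm (Qhat Q h t u m v) <= q.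
  move=> tu mS; have [tT Zn] := TSk _ _ tu; apply: bigmax_le => // i _.
  under eq_bigr do rewrite mxE.
  by apply: le_trans (ler_mnorm _ i) _; apply: Qle => //; exact: hAA.
have phM t u m v : TS T t u -> simplex m -> vnorm (psihat psi h t u m v) <= psm.
  move=> tu mS; have [tT Zn] := TSk _ _ tu; apply: vnorm_leP => // i; rewrite mxE.
  by apply: le_trans (ler_vnorm _ i) _; apply: psile => //; exact: hAA.
(* Since [m0] has mass 1, there is a state [i0], and the fibre of [J 0 m0] through it is
   nonempty. *)
have J1 : 1 <= Jmax T J.
  have [i0 _] : exists i : 'I_S, true.
    case: (pickP (fun _ : 'I_S => true)) => [i _|e]; first by exists i.
    have [_] := m0S; rewrite big1 => [/eqP|i]; first by rewrite eq_sym oner_eq0.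
    by have := e i.
  apply: (@le_trans _ _ (#|[set i | J 0 m0 i == J 0 m0 i0]|%:R)).
    by rewrite ler1n; apply/card_gt0P; exists i0; apply/mem_set; exact: eqxx.
  apply: ub_le_sup; last by exists 0, m0, (J 0 m0 i0); rewrite lexx ltW.
  by exists S%:R => _ [t [m [j [_ ->]]]]; rewrite ler_nat -[leqRHS]card_ord max_card.
(* [kap] contains [n.+1] copies of [expR ((q + LQH) * T)]; each is at most the matching term of the
   assumed sum, because this exponential and [Jmax] are at least 1. *)
have small' : kap n T q lm Pm psm LpsiH LQH LPsi Llam < 1.
  apply: le_lt_trans small; rewrite /kap /wsum subn0.
  rewrite -/q -/lm -[vmax _ _ _ _ _ _ _]/(vm n T q lm Pm psm).
  rewrite -/(K1 n T q lm Pm psm LpsiH LQH Llam) -/(K2 n T q lm Pm psm LpsiH LQH).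
  have K10 : 0 <= K1 n T q lm Pm psm LpsiH LQH Llam by apply: K1_ge0.
  move: (K1 _ _ _ _ _ _ _ _ _) (K2 _ _ _ _ _ _ _ _) K10 => k1 k2 k10.
  have T1 := ltW T0.
  apply: ler_wpM2r.
    by apply: sumr_ge0 => i _; rewrite exprn_ge0 // !mulr_ge0 ?expR_ge0.
  apply: ler_wpM2r; first exact: expR_ge0.
  apply: ler_wpM2r; first by apply: addr_ge0; [exact: ltW | exact: mulr_ge0].
  apply: ler_wpM2l; first by apply: mulr_ge0 => //; exact: ltW.
  rewrite -[X in X%:R * _]card_ord mulr_natl -sumr_const; apply: ler_sum => i _.
  have e1 : 1 <= expR ((q + LQH) * T) by rewrite -[leLHS]expR0 ler_expR mulr_ge0 // addr_ge0 // ltW.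
  rewrite -[leLHS]mulr1 ler_pM ?expR_ge0 // ?exprn_ege1 //.
  by rewrite exprS ler_peMr ?expR_ge0 // exprn_ege1.
have JE t m : 0 <= t <= T -> simplex m -> J t m = J0 t.
  by move=> tT mS; apply/funext => i; exact: JL.
have TSi (u : 'rV[R]_n) (i : 'I_n) : inU T u -> i.+1 = Z u -> TS T (u 0 i) u.
  by move=> uU iZ; rewrite -(last_jumpE uU iZ); exact: TS_last_jump.
(* [sol] evaluates [J] at the current measure, [is_sol] at [m0]. *)
have solE mu v : sol mu v <-> is_sol T lam (Qhat Q h) (psihat psi h) Psi J0 m0 (mu, v).
  split=> [[s1 s2 s3 s4 [s5 s6 s7]]|[s1 s2 s3 s4 [s5 s6 s7]]]; split => //=.
  - move=> u uU; apply: filterS (s3 u uU) => t ht tu i; have [tT _] := TSk _ _ tu.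
    by have := ht tu i; rewrite (JE _ _ tT (s1 _ _ tu)).
  - split => // u i uU iZ; have tu := TSi u i uU iZ; have [tT _] := TSk _ _ tu.
    by have := s7 u i uU iZ; rewrite JE //; exact: s1.
  - move=> u uU; apply: filterS (s3 u uU) => t ht tu i; have [tT _] := TSk _ _ tu.
    by have := ht tu i; rewrite /rhs_v /= (JE _ _ tT (s1 _ _ tu)).
  - split => // u i uU iZ; have tu := TSi u i uU iZ; have [tT _] := TSk _ _ tu.
    by have := s7 u i uU iZ; rewrite JE //; exact: s1.
have [[mu v] xs] : exists x, is_sol T lam (Qhat Q h) (psihat psi h) Psi J0 m0 x.
  apply: (exists_sol T0 q0 lm0 Pm0 psm0 Lpsi0 LQ0 LPsi0 Llam0 lamle QhI QhM phM Psile psiL QL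
    PsiL lamL m0S small').
  - move=> x i j mx ax.
    apply: eq_measurable_fun (meas_action_comp hAA hB i i j QB mx _).
      by move=> z _; rewrite mxE.
    by move=> t u /ax[].
  - move=> x i mx ax.
    apply: eq_measurable_fun (meas_action_comp hAA hB i 0 i psiB mx _).
      by move=> z _; rewrite mxE.
    by move=> t u /ax[].
  - move=> x k kn mx ax.
    pose g (z : R * borelmx R 1 n) : 'rV[R]_(1 + S) := row_mx (const_mx z.1) (x.1 z.1 z.2).
    (* The intensities are numbered from 1, the entries of their row from 0. *)
    have k0 : (k.-1 < n)%N by case: k kn => // k /=.
    apply: eq_measurable_fun (borel_on_comp (@measurable_TS R n T) lamB
      (g := g) _ _ 0 (Ordinal k0)).
    + move=> z _; rewrite mxE /g row_mxKl row_mxKr mxE /=.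
      by case: k kn {k0}.
    + move=> z zT /=; rewrite /g row_mxKl row_mxKr mxE; have [? _] := TSk _ _ zT.
      by split => //; have [] := ax _ _ zT.
    + by apply: measurable_row_mx => a; [exact: measurable_fun_time | have [] := mx a].
  - move=> x i k kn mx ax.
    apply: (borel_on_comp (g := fun z : R * borelmx R 1 n => x.1 T z.2)
      (@measurable_TS R n T) (PsiB k kn)).
      by move=> z /TS_inU zU; have [] := ax _ _ (TS_T T0 zU).
    move=> a; have [mm _] := mx a.
    apply: (@measurable_comp _ _ _ _ _ _ (TSset T) (fun z : R * borelmx R 1 n => x.1 z.1 z.2 0 a) _
      (fun z : R * borelmx R 1 n => (T, z.2) : R * borelmx R 1 n)) => //.
    + exact: measurable_TS.
    + by move=> _ [z /TS_inU zU <-]; exact: TS_T.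
    + by apply: measurable_funTS; exact: measurable_fun_pair.
  - move=> i j.
    pose g (t : R) : 'rV[R]_(1 + S) := row_mx (const_mx t) m0.
    apply: eq_measurable_fun (borel_on_comp (D0 := `[0, T]%classic) _ JB (g := g) _ _ i j) => //.
    + by move=> t _; rewrite mxE /g row_mxKl row_mxKr mxE.
    + by move=> t; rewrite /= in_itv /= /g row_mxKl row_mxKr mxE.
    + apply: measurable_row_mx => a; last exact: measurable_cst.
      apply: (eq_measurable_fun id); first by move=> t _; rewrite mxE.
      exact: measurable_id.
exists mu, v; split; first exact/solE.
move=> mu' v' /solE xs' t u tu.
exact: (sol_unique T0 q0 lm0 Pm0 psm0 Lpsi0 LQ0 LPsi0 Llam0 lamle QhI QhM phM Psile psiL QL
    PsiL lamL small' xs' xs tu).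
Qed.
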